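(* Consider the finite-sum problem of minimizing $f=\frac1N\sum_{i=1}^N f_i:\mathbb{R}^d\to\mathbb{R}$, where $f$ has a gradient that is $L$-Lipschitz continuous at all points of interest and a Hessian that is $M$-Lipschitz continuous, and is uniformly bounded below by $\bar f$. For each iterate $x$, let $G(x)<\infty$ and $K(x)<\infty$ be such that $\|\nabla f_i(x)\|\le G(x)$ and $\|\nabla^2 f_i(x)\|\le K(x)$ for all $i\in\{1,\dots,N\}$. Choose $\delta\in(0,0.5]$. Apply the algorithm described in the context with $\alpha_k=\epsilon_H$ at every negative curvature step and $\alpha=\epsilon_H$, the approximate minimum eigenvalues satisfying $|\hat\lambda_k-\lambda_{\min}(H_k)|\le\frac19\epsilon_H$. Let the inexact gradient and Hessian oracles be obtained by independent with-replacement batch subsampling, that is, $g(x)=\frac1{|S_g|}\sum_{i\in S_g}\nabla f_i(x)$ and $H(x)=\frac1{|S_H|}\sum_{i\in S_H}\nabla^2 f_i(x)$, where $|S_g|$ and $|S_H|$ are given by the sample-size bounds $$|S_g| \ge 256\left(\frac{G(x)}{\max\{\epsilon_g,\|\nabla f(x)\|\}}\right)^2\log\frac1\xi,\qquad |S_H| \ge 484\left(\frac{K(x)}{\epsilon_H}\right)^2\log\frac{2d}{\xi}$$ (taken as the smallest integers satisfying them), with $\xi=\delta/n$ and $n=2\left(\frac{f(x_0)-\bar f}{R_\epsilon}\right)+B\bar K$, where $$R_\epsilon=\min\left(\frac{\epsilon_g^2}{6L},\frac{2\epsilon_H^3}{9M^2}\right),\quad B=1+\frac{18\epsilon_H L}{M\epsilon_g},\quad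 C=2304\frac{M^2\epsilon_g^2}{\epsilon_H^4},$$ $$\bar K=C\max\left\{\log\left(\frac1\delta\right),\log\left(4\frac{f(x_0)-\bar f}{R_\epsilon}\right),2\log(2BC),1\right\}.$$ Then with probability at least $1-2\delta$ the algorithm outputs a $(\frac43\epsilon_g,\frac43\epsilon_H)$-approximate second-order stationary point of $f$ within $$\tilde O\left(\max\{\epsilon_g^{-4},\ \epsilon_g^{-2}\epsilon_H^{-3},\ \epsilon_H^{-11/2},\ \epsilon_g^{2}\epsilon_H^{-13/2}\}\right)$$ total sample-operations, defined as the total number of stochastic gradient or Hessian-vector product evaluations for single functions $f_i$.
   Context: Norms are the Euclidean norm for vectors and the spectral norm for matrices; Lipschitz continuity of the Hessian is measured in the spectral norm. A point $x$ is an $(\epsilon_1,\epsilon_2)$-approximate second-order stationary point if $\|\nabla f(x)\|\le\epsilon_1$ and $\lambda_{\min}(\nabla^2f(x))\ge-\epsilon_2$. A sample-operation is one evaluation of $\nabla f_i(x)$, or of one Hessian-vector product $\nabla^2 f_i(x)v$, for a single index $i$; thus computing $g(x)$ costs $|S_g|$ sample-operations and one product $H(x)v$ costs $|S_H|$. $\tilde O$ suppresses factors polylogarithmic in $\epsilon_g$ and $\epsilon_H$, logarithmic factors in $\delta$, and dependence on $L$, $M$, $f(x_0)-\bar f$; the quantities $G(x)$, $K(x)$ and the $\log d$ factors are likewise treated as constants in this rate. Oracles: at the iterate $x_k$ the algorithm receives an approximate gradient $g_k=g(x_k)$ and, if requested, a symmetric approximate Hessian $H_k=H(x_k)$ together with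 a unit vector $\hat p_k$ (approximate minimum eigenvector of $H_k$) and the value $\hat\lambda_k:=\hat p_k^T H_k\hat p_k$. The index sets $S_g$, $S_H$ are sampled uniformly with replacement from $\{1,\dots,N\}$, independently at each iteration. Eigenvector computation (known result): for a real symmetric $H\in\mathbb{R}^{d\times d}$, $0<\epsilon_H\le 9\|H\|$ and $\delta'\in(0,1)$, there is a Lanczos-type algorithm which, with probability at least $1-\delta'$ over a uniformly random initialization on the unit sphere, outputs a unit vector $v$ with $v^\top Hv\le\lambda_{\min}(H)+\epsilon_H/9$ in at most $\min\{d,\,1+2\ln(25d/\delta'^2)\sqrt{\|H\|/\epsilon_H}\}$ matrix-vector multiplications by $H$; the vectors $\hat p_k$ are obtained from it, and sample-operations are counted accordingly. Algorithm: inputs are tolerances $\epsilon_g,\epsilon_H>0$, Lipschitz constants $L,M$, an upper bound $\alpha\in[\epsilon_H,L]$ on negative curvature stepsizes, and an initial point $x_0\in\mathbb{R}^d$. For $k=0,1,2,\dots$: (i) if $\|g_k\|>\epsilon_g$, set $x_{k+1}=x_k-\frac1L g_k$ (gradient step); (ii) else if $\hat\lambda_k<-\epsilon_H$, choose $\alpha_k\in[\epsilon_H,\min(\alpha,|\hat\lambda_k|)]$, then draw $\sigma_k\in\{+1,-1\}$ with probability $\frac12$ each, and set $x_{k+1}=x_k+\frac{2\alpha_k}{M}\sigma_k\hat p_k$ (negative curvature step); (iii) else terminate and return $x_k$. The draw $\sigma_k$ is independent of everything generated before it: all $\sigma_i$ with $i<k$, and all $x_i,g_i,H_i,\hat p_i,\hat\lambda_i,\alpha_i$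 with $i\le k$.
   Formalization: The formal theorem also assumes n ≥ 1 (and G, K Borel, batches nonempty): if n < δ then ξ = δ/n > 1, the bound on |S_g| is negative, and the claim fails, e.g. for f = 0 with f_1 = -f_2 linear and steep, where the algorithm never terminates. *)

(* Defs.v *)
Set Warnings "-notation-overridden,-notation-incompatible-prefix,-ambiguous-paths".
From HB Require Import structures.
From mathcomp Require Import all_boot all_order all_algebra.
From mathcomp Require Import all_classical all_reals all_analysis.
Set Implicit Arguments.
Unset Strict Implicit.
Unset Printing Implicit Defensive.
Import Order.TTheory GRing.Theory Num.Theory.
Import numFieldNormedType.Exports.
Local Open Scope classical_set_scope.
Local Open Scope ring_scope.

(* Vectors of R^d are row vectors, as in the library's [eigenvalue] and
   ['J f]; the product H v of a symmetric H is [v *m H]. The library norm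
   [`|v|] on ['rV_d] is the sup norm, hence [enorm]. *)
Section Norms.
Context {R : realType} {d : nat}.
Implicit Types (v p : 'rV[R]_d) (A H : 'M[R]_d).

Definition enorm v : R := Num.sqrt (\sum_(j < d) v 0 j ^+ 2).

Definition specnorm A : R :=
  sup [set enorm (v *m A) | v in [set v | enorm v = 1]].

Definition lambda_min A : R := inf [set a : R | eigenvalue A a].

Definition qform H p : R := (p *m H *m p^T) 0 0.

End Norms.

Section Calculus.
Context {R : realType} {d : nat}.
Implicit Types (f : 'rV[R]_d -> R) (x : 'rV[R]_d).

Definition grad f x : 'rV[R]_d := \row_j 'D_(delta_mx 0 j) f x.

Definition hess f x : 'M[R]_d := 'J (grad f) x.

Definition twice_differentiable f : Prop :=
  (forall x, differentiable f x) /\ (forall x, differentiable (grad f) x).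

Definition gradient_lipschitz_on (D : set 'rV[R]_d) (L : R) f : Prop :=
  forall x y, D x -> D y -> enorm (grad f x - grad f y) <= L * enorm (x - y).

Definition hessian_lipschitz (M : R) f : Prop :=
  forall x y, specnorm (hess f x - hess f y) <= M * enorm (x - y).

Definition approx_sosp f (e1 e2 : R) x : Prop :=
  enorm (grad f x) <= e1 /\ - e2 <= lambda_min (hess f x).

Definition borel_fun (G : 'rV[R]_d -> R) : Prop :=
  forall U : set R, open U -> <<s (@open 'rV[R]_d) >> (G @^-1` U).

End Calculus.

Record problem (R : realType) (N d : nat) := Problem {
  fcomp : 'I_N -> 'rV[R]_d -> R;   (* the f_i *)
  x0 : 'rV[R]_d;
  fbar : R;
  Lg : R;                         (* L *)
  Mh : R;                         (* M *)
  epsg : R;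
  epsH : R;
  delta : R;
  Gbd : 'rV[R]_d -> R;            (* G(x) *)
  Kbd : 'rV[R]_d -> R             (* K(x) *)
}.

Section Constants.
Context {R : realType} {N d : nat}.
Variable S : problem R N d.

Definition objective (x : 'rV[R]_d) : R :=
  N%:R^-1 * \sum_(i < N) fcomp S i x.

Definition gap : R := objective (x0 S) - fbar S.

Definition R_eps : R :=
  Num.min (epsg S ^+ 2 / (6 * Lg S)) (2 * epsH S ^+ 3 / (9 * Mh S ^+ 2)).

Definition Bconst : R := 1 + 18 * epsH S * Lg S / (Mh S * epsg S).

Definition Cconst : R := 2304 * (Mh S ^+ 2 * epsg S ^+ 2 / epsH S ^+ 4).

(* When [gap = 0] the second logarithm is log 0, which the library sets to 0
   instead of -oo; the last entry of the maximum makes this immaterial. *)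
Definition Kbar : R :=
  Cconst * Num.max (ln (delta S)^-1)
          (Num.max (ln (4 * (gap / R_eps)))
          (Num.max (2 * ln (2 * Bconst * Cconst)) 1)).

Definition n_iter : R := 2 * (gap / R_eps) + Bconst * Kbar.

Definition xi : R := delta S / n_iter.

(* Smallest positive integer that is >= b: a batch is never empty, even if
   G(x) = 0 or K(x) = 0. *)
Definition batch_size (b : R) : nat := `|Num.max 1%Z (Num.ceil b)|%N.

Definition size_g (x : 'rV[R]_d) : nat :=
  batch_size (256 * (Gbd S x / Num.max (epsg S) (enorm (grad objective x))) ^+ 2
              * ln xi^-1).

Definition size_H (x : 'rV[R]_d) : nat :=
  batch_size (484 * (Kbd S x / epsH S) ^+ 2 * ln (2 * d%:R / xi)).

(* Number of multiplications by H of the eigenvector computation at accuracy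
   e and failure probability dl. The known bound is for e <= 9 ||H||; for a
   larger e the computation is run with 9 ||H|| in place of e. *)
Definition lanczos_budget (dl e : R) (H : 'M[R]_d) : R :=
  Num.min d%:R
    (1 + 2 * ln (25 * d%:R / dl ^+ 2)
         * Num.sqrt (specnorm H / Num.min e (9 * specnorm H))).

End Constants.

(* Random inputs. For each iteration k, [idxg k] and [idxH k] are infinite
   streams of indices; the batches S_g and S_H of iteration k are their
   initial segments, of lengths depending on the current iterate. The sign
   sigma_k is [(-1) ^+ sgn k w]. [nmv k] is the number of Hessian-vector
   products H_k v spent on [phat k]. Inputs that the algorithm does not request
   (after termination, or [phat] and [idxH] at a gradient step) have no
   effect on its output or on its cost. *)
Record inputs (R : realType) (N d : nat) (Omega : Type) := Inputs {
  idxg : nat -> nat -> Omega -> 'I_N;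
  idxH : nat -> nat -> Omega -> 'I_N;
  phat : nat -> Omega -> 'rV[R]_d;
  nmv : nat -> Omega -> nat;
  sgn : nat -> Omega -> bool
}.

Section Algorithm.
Context {R : realType} {N d : nat} {Omega : Type}.
Variables (S : problem R N d) (O : inputs R N d Omega).
Implicit Types (k : nat) (w : Omega) (x g p : 'rV[R]_d).

Definition grad_oracle k w x : 'rV[R]_d :=
  (size_g S x)%:R^-1 *:
    \sum_(j < size_g S x) grad (fcomp S (idxg O k j w)) x.

Definition hess_oracle k w x : 'M[R]_d :=
  (size_H S x)%:R^-1 *:
    \sum_(j < size_H S x) hess (fcomp S (idxH O k j w)) x.

Definition next_iterate (alphak : R) x g (lam : R) p (b : bool) : 'rV[R]_d :=
  if epsg S < enorm g then x - (Lg S)^-1 *: g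
  else if lam < - epsH S then x + (2 * alphak / Mh S * (-1) ^+ b) *: p
  else x.

Fixpoint xk k w : 'rV[R]_d :=
  if k is k'.+1 then
    let x := xk k' w in
    next_iterate (epsH S) x (grad_oracle k' w x)
      (qform (hess_oracle k' w x) (phat O k' w)) (phat O k' w) (sgn O k' w)
  else x0 S.

Definition gk k w : 'rV[R]_d := grad_oracle k w (xk k w).
Definition Hk k w : 'M[R]_d := hess_oracle k w (xk k w).
Definition lamk k w : R := qform (Hk k w) (phat O k w).

Definition stops k w : Prop := enorm (gk k w) <= epsg S /\ - epsH S <= lamk k w.

Definition reached k w : Prop := forall i, (i < k)%N -> ~ stops i w.

Definition returns_at k w : Prop := reached k w /\ stops k w.

(* Sample-operations spent in iterations 0, ..., k. *)
Definition sample_ops k w : nat :=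
  (\sum_(i < k.+1) (size_g S (xk i w)
    + (if (enorm (gk i w) <= epsg S)%R then nmv O i w * size_H S (xk i w)
       else 0)))%N.

(* "Points of interest" must contain the segments between successive
   iterates. *)
Definition points_of_interest (D : set 'rV[R]_d) : Prop :=
  forall k w, reached k.+1 w -> forall t : R, 0 <= t <= 1 ->
    D (xk k w + t *: (xk k.+1 w - xk k w)).

Definition eigenvector_oracle (dl : R) : Prop :=
  forall k w, reached k w -> enorm (gk k w) <= epsg S ->
  [/\ enorm (phat O k w) = 1,
      `|lamk k w - lambda_min (Hk k w)| <= epsH S / 9
    & (nmv O k w)%:R <= lanczos_budget dl (epsH S) (Hk k w)].

End Algorithm.

Section Probability.
Context {R : realType} {N d : nat} {dO : measure_display}.
Context {Omega : measurableType dO}.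
Variables (P : probability Omega R) (S : problem R N d).
Variable O : inputs R N d Omega.

(* The library does not constrain the value of a measure on a nonmeasurable
   set, hence the measurable subset. *)
Definition prob_ge (A : set Omega) (q : R) : Prop :=
  exists E : set Omega, [/\ measurable E, E `<=` A & (q%:E <= P E)%E].

Definition observations (T : topologicalType) (X : Omega -> T)
  : set (set Omega) := [set X @^-1` U | U in (@open T)].

Definition measurable_inputs : Prop :=
  [/\ forall k j a, measurable [set w | idxg O k j w = a],
      forall k j a, measurable [set w | idxH O k j w = a],
      forall k b, measurable [set w | sgn O k w = b]
    & forall k, observations (phat O k) `<=` measurable].

(* Generators of the sigma-algebra of what precedes the sampling of S_g and
   S_H in iteration k. *)
Definition before_sampling (k : nat) : set (set Omega) :=
  \bigcup_(i in [set i | (i <= k)%N]) observations (xk S O i)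
  `|` \bigcup_(i in [set i | (i < k)%N])
    (observations (gk S O i) `|` observations (Hk S O i)
     `|` observations (phat O i)
     `|` [set [set w | idxg O i p.1 w = p.2] | p in [set: nat * 'I_N]]
     `|` [set [set w | idxH O i p.1 w = p.2] | p in [set: nat * 'I_N]]
     `|` [set [set w | sgn O i w = b] | b in [set: bool]]).

(* Generators of the sigma-algebra of what precedes the draw of sigma_k; the
   stepsizes alpha_i are constant. *)
Definition before_draw (k : nat) : set (set Omega) :=
  \bigcup_(i in [set i | (i <= k)%N])
    (observations (xk S O i) `|` observations (gk S O i)
     `|` observations (Hk S O i) `|` observations (phat O i)
     `|` observations (lamk S O i))
  `|` \bigcup_(i in [set i | (i < k)%N])
     [set [set w | sgn O i w = b] | b in [set: bool]].

(* The indices of iteration k are i.i.d. uniform on {1, ..., N} and independent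
   of the past. *)
Definition uniform_sampling : Prop :=
  forall k (m m' : nat) (s : 'I_m -> 'I_N) (t : 'I_m' -> 'I_N) (A : set Omega),
  <<s before_sampling k >> A ->
  P (A `&` [set w | (forall j : 'I_m, idxg O k j w = s j)
                 /\ (forall j : 'I_m', idxH O k j w = t j)])
  = (P A * (N%:R ^- (m + m'))%:E)%E.

Definition fair_signs : Prop :=
  forall k (b : bool) (A : set Omega), <<s before_draw k >> A ->
  P (A `&` [set w | sgn O k w = b]) = (P A * (2^-1)%:E)%E.

End Probability.

Section Rate.
Context {R : realType}.

Definition rate (eg eH : R) : R :=
  Num.max (eg ^- 4)
  (Num.max (eg ^- 2 * eH ^- 3)
  (Num.max (eH `^ (- (11 / 2))) (eg ^+ 2 * eH `^ (- (13 / 2))))).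

Definition log_factor (eg eH dl dlL : R) (d : nat) : R :=
  1 + `|ln eg| + `|ln eH| + ln dl^-1 + ln dlL^-1 + ln d%:R.

End Rate.

(* Main.v *)
(** Exchanging one draw of a batch for an independent copy turns the trace
    moments of a centered sample sum into a recursion, which gives sub-Gaussian
    tails for sampled vectors and symmetric matrices without spectral theory.
    With the prescribed batch sizes, outside an event of probability at most
    [xi / 2] the gradient error at iteration [k] is at most
    [max(epsg, |grad f|) / 4] and the Hessian error at most [2 epsH / 9].

    While the oracles are accurate, a gradient step decreases [f] by at least
    [r1 = epsg^2 / (6 L)], and a negative curvature step by at least
    [r2 = 2 epsH^3 / (9 M^2)], up to the signed first order term
    [sigma_k * a_k], where [|a_k| <= c = 8 epsH epsg / (3 M)]. The process
    [exp (lam * sum sigma_k a_k - lam^2/2 * sum a_k^2)] is a supermartingale,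
    so it stays below [delta^-2] with probability at least [1 - delta^2]. For
    [lam = r2 / (2 c^2)] this means that after [Cconst * ln (1/delta)] negative
    curvature steps the drift has eaten at most half of their decrease, and the
    run has at most [2 gap / R_eps] steps; with fewer negative curvature steps,
    bounding the drift by [c] per step leaves at most
    [gap / R_eps + Bconst * Kbar] steps. *)
Require Import Defs.
From HB Require Import structures.
From mathcomp Require Import all_boot all_order all_algebra.
From mathcomp Require Import all_classical all_reals all_analysis.
From mathcomp Require Import measurable_realfun zify ring lra.
Set Implicit Arguments.
Unset Strict Implicit.
Unset Printing Implicit Defensive.
Import Order.TTheory GRing.Theory Num.Theory.
Import numFieldNormedType.Exports.
Local Open Scope classical_set_scope.
Local Open Scope ring_scope.

(** * Euclidean norm and trace inequalities *)

(** The accuracy margins fit together as follows. A gradient error of a quarter of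
    [max(epsg, |grad f|)] is at most [|g_k| / 3] at a gradient step and leaves
    [|grad f| <= 4/3 epsg] otherwise; times the step length [2 epsH / M] this gives [c]. The Hessian
    error [2/9 epsH] and the eigenvalue error [1/9 epsH] add up to the extra [1/3 epsH] of the
    conclusion.

    The batch lengths depend on the random iterate. The union bound therefore runs over pairs of a
    length and a list of indices; for each pair, whether this list would be bad depends on the
    iterate alone, hence on the past.

    Fairness of a sign is used as an identity between two measures on the past sigma-algebra, which
    extends to integrals of past-measurable functions. The exponential process runs on past
    termination and is inspected only at the deterministic time [T = floor(n_iter) + 1]; an accurate
    run still active at [T] would contradict the step count. Since [T <= 2 n_iter], the oracle
    failures cost at most [T * xi / 2 <= delta], and the sign failure costs [delta^2 <= delta]. *)

Section InnerProduct.
Context {R : realType} {d : nat}.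
Implicit Types (u v w : 'rV[R]_d) (A : 'M[R]_d).

Definition dotp u v : R := \sum_(j < d) u 0 j * v 0 j.

Lemma dotpC u v : dotp u v = dotp v u.
Proof. by apply: eq_bigr => j _; rewrite mulrC. Qed.

Lemma dotpDl u v w : dotp (u + v) w = dotp u w + dotp v w.
Proof. by rewrite /dotp -big_split /=; apply: eq_bigr => j _; rewrite mxE mulrDl. Qed.

Lemma dotpZl a u v : dotp (a *: u) v = a * dotp u v.
Proof. by rewrite /dotp mulr_sumr; apply: eq_bigr => j _; rewrite mxE mulrA. Qed.

Lemma dotpDr u v w : dotp u (v + w) = dotp u v + dotp u w.
Proof. by rewrite dotpC dotpDl !(dotpC u). Qed.

Lemma dotpZr a u v : dotp u (a *: v) = a * dotp u v.
Proof. by rewrite dotpC dotpZl dotpC. Qed.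

Lemma dotpNl u v : dotp (- u) v = - dotp u v.
Proof. by rewrite -scaleN1r dotpZl mulN1r. Qed.

Lemma dotpNr u v : dotp u (- v) = - dotp u v.
Proof. by rewrite dotpC dotpNl dotpC. Qed.

Lemma dotp0l v : dotp 0 v = 0.
Proof. by rewrite -(scale0r 0) dotpZl mul0r. Qed.

Lemma dotp_ge0 u : 0 <= dotp u u.
Proof. by apply: sumr_ge0 => j _; rewrite -expr2 sqr_ge0. Qed.

Lemma dotp_mulmx u v : (u *m v^T) 0 0 = dotp u v.
Proof. by rewrite mxE; apply: eq_bigr => j _; rewrite mxE. Qed.

Lemma qform_dotp A u : qform A u = dotp (u *m A) u.
Proof. by rewrite /qform dotp_mulmx. Qed.

Lemma enorm_sqr u : enorm u ^+ 2 = dotp u u.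
Proof.
rewrite sqr_sqrtr; first by apply: eq_bigr => j _; rewrite expr2.
by apply: sumr_ge0 => j _; rewrite sqr_ge0.
Qed.

Lemma enorm_ge0 u : 0 <= enorm u.
Proof. exact: sqrtr_ge0. Qed.

Lemma enormZ a u : enorm (a *: u) = `|a| * enorm u.
Proof.
apply/eqP; rewrite -(eqrXn2 (n := 2)) ?mulr_ge0 ?enorm_ge0 ?normr_ge0 //.
by rewrite exprMn !enorm_sqr dotpZl dotpZr mulrA real_normK ?num_real.
Qed.

Lemma enormN u : enorm (- u) = enorm u.
Proof. by rewrite -scaleN1r enormZ normrN1 mul1r. Qed.

Lemma enorm0 : enorm (0 : 'rV[R]_d) = 0.
Proof. by rewrite -(scale0r 0) enormZ normr0 mul0r. Qed.

Lemma enorm0_eq u : enorm u = 0 -> u = 0.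
Proof.
move=> h; have : dotp u u = 0 by rewrite -enorm_sqr h expr0n.
move/eqP; rewrite psumr_eq0; last by move=> j _; rewrite -expr2 sqr_ge0.
move=> /allP H; apply/rowP => j; rewrite mxE; apply/eqP.
by have := H j (mem_index_enum _); rewrite mulf_eq0 orbb.
Qed.

Lemma dotp_le_amgm u v : 2 * dotp u v <= dotp u u + dotp v v.
Proof.
have := dotp_ge0 (u - v).
by rewrite dotpDl !dotpDr !dotpNl !dotpNr opprK (dotpC v u); lra.
Qed.

Lemma dotp_le_enorm u v : dotp u v <= enorm u * enorm v.
Proof.
have [->|u0] := eqVneq u 0; first by rewrite dotp0l enorm0 mul0r.
have [->|v0] := eqVneq v 0; first by rewrite dotpC dotp0l enorm0 mulr0.
have nu : 0 < enorm u by rewrite lt0r enorm_ge0 andbT; apply: contra_neq u0 => /enorm0_eq.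
have nv : 0 < enorm v by rewrite lt0r enorm_ge0 andbT; apply: contra_neq v0 => /enorm0_eq.
have := dotp_le_amgm (enorm v *: u) (enorm u *: v).
rewrite !dotpZl !dotpZr -!enorm_sqr => H.
rewrite -(ler_pM2l (mulr_gt0 nu nv)).
nra.
Qed.

Lemma normr_dotp_le u v : `|dotp u v| <= enorm u * enorm v.
Proof. by rewrite ler_norml dotp_le_enorm andbT lerNl -dotpNl -(enormN u) dotp_le_enorm. Qed.

Lemma enormD u v : enorm (u + v) <= enorm u + enorm v.
Proof.
rewrite -(ler_pXn2r (n := 2)) ?nnegrE ?addr_ge0 ?enorm_ge0 //.
rewrite enorm_sqr dotpDl !dotpDr (dotpC v u) sqrrD !enorm_sqr.
by have := dotp_le_enorm u v; lra.
Qed.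

Lemma enormB u v : enorm (u - v) <= enorm u + enorm v.
Proof. by rewrite -(enormN v) enormD. Qed.

Lemma enorm_sum (I : Type) (r : seq I) (F : I -> 'rV[R]_d) :
  enorm (\sum_(i <- r) F i) <= \sum_(i <- r) enorm (F i).
Proof.
elim: r => [|i r IH]; first by rewrite !big_nil enorm0.
by rewrite !big_cons (le_trans (enormD _ _)) // lerD2l.
Qed.

Lemma normr_coord_le_enorm u j : `|u 0 j| <= enorm u.
Proof.
rewrite -(ler_pXn2r (n := 2)) ?nnegrE ?enorm_ge0 ?normr_ge0 //.
rewrite real_normK ?num_real // enorm_sqr /dotp (bigD1 j) //= -expr2 lerDl.
by apply: sumr_ge0 => k _; rewrite -expr2 sqr_ge0.
Qed.

Lemma enorm_le_sum_normr u : enorm u <= \sum_j `|u 0 j|.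
Proof.
rewrite {1}(row_sum_delta u).
apply: le_trans (enorm_sum _ _) _; apply: ler_sum => j _.
rewrite enormZ ler_piMr // -(ler_pXn2r (n := 2)) ?nnegrE ?enorm_ge0 //.
rewrite enorm_sqr expr1n /dotp (bigD1 j) //= big1 ?addr0; first by rewrite !mxE !eqxx mulr1.
by move=> k kj; rewrite !mxE (negPf kj) andbF mulr0.
Qed.

End InnerProduct.

Lemma dotp_mulmxl {R : realType} {m n : nat} (u : 'rV[R]_m) (v : 'rV[R]_n) (A : 'M[R]_(m, n)) :
  dotp (u *m A) v = dotp u (v *m A^T).
Proof. by rewrite -!dotp_mulmx trmx_mul trmxK mulmxA. Qed.

Section TraceInequalities.
Context {R : realType} {n : nat}.
Implicit Types (A B D V W Y : 'M[R]_n) (u v : 'rV[R]_n).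

Lemma mxtrace_mul_tr A : \tr (A *m A^T) = \sum_i dotp (row i A) (row i A).
Proof.
apply: eq_bigr => i _; rewrite mxE; apply: eq_bigr => j _.
by rewrite !mxE.
Qed.

Lemma mxtrace_mul_tr_ge0 A : 0 <= \tr (A *m A^T).
Proof. by rewrite mxtrace_mul_tr sumr_ge0 // => i _; apply: dotp_ge0. Qed.

Lemma mxtrace_amgm A B :
  2 * \tr (A *m B^T) <= \tr (A *m A^T) + \tr (B *m B^T).
Proof.
have := mxtrace_mul_tr_ge0 (A - B).
have trB (X Z : 'M[R]_n) : \tr (X - Z) = \tr X - \tr Z.
  by rewrite mxtraceD -scaleN1r mxtraceZ mulN1r.
have -> : (A - B)^T = A^T - B^T by apply/matrixP => i j; rewrite !mxE.
rewrite mulmxBl !mulmxBr !trB.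
have -> : \tr (B *m A^T) = \tr (A *m B^T).
  by rewrite -mxtrace_tr trmx_mul trmxK.
lra.
Qed.

Lemma trmx_exp A k : (A ^+ k)^T = A^T ^+ k.
Proof.
elim: k => [|k IH]; first by rewrite !expr0 trmx1.
by rewrite exprS exprSr -mulmxE trmx_mul IH.
Qed.

(* For the sequence [t q = tr (D W^q D V^(2r-q))], even terms are squared
   Frobenius norms of [W^a D V^(r-a)] and [t (a+b)] is their inner product. *)
Lemma mxtrace_interp D V W (r a b : nat) :
  D^T = D -> V^T = V -> W^T = W -> (a <= r)%N -> (b <= r)%N ->
  2 * \tr (D * W ^+ (a + b) * D * V ^+ (r + r - (a + b))) <=
  \tr (D * W ^+ (a + a) * D * V ^+ (r + r - (a + a))) +
  \tr (D * W ^+ (b + b) * D * V ^+ (r + r - (b + b))).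
Proof.
move=> sD sV sW ar br.
have key c e : (c <= r)%N -> (e <= r)%N ->
   \tr (D * W ^+ (c + e) * D * V ^+ (r + r - (c + e))) =
   \tr ((W ^+ c * D * V ^+ (r - c)) *m (W ^+ e * D * V ^+ (r - e))^T).
  move=> cr er.
  have -> : (r + r - (c + e) = (r - e) + (r - c))%N by lia.
  have mxC (X Z : 'M[R]_n) : \tr (X * Z) = \tr (Z * X) by exact: mxtrace_mulC.
  rewrite -!mulmxE !trmx_mul !trmx_exp sD sV sW !mulmxE.
  rewrite -!mulrA [in LHS]mxC !mulrA [in RHS]mxC !mulrA -exprD.
  by rewrite -(mulrA _ (V ^+ _) (V ^+ _)) -exprD (addnC e) (addnC (r - c)%N).
by rewrite !key //; apply: mxtrace_amgm.
Qed.

(** The left trace is the squared Frobenius norm of [Y^p D], a sum over the rows of [Y^p], each of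
    which [D] stretches by at most [c]. *)
Lemma mxtrace_sqr_mul D Y (c : R) (p : nat) :
  D^T = D -> Y^T = Y -> 0 <= c ->
  (forall u, enorm (u *m D) <= c * enorm u) ->
  \tr (D * D * Y ^+ (p + p)) <= c ^+ 2 * \tr (Y ^+ (p + p)).
Proof.
move=> sD sY c0 hD.
have -> : \tr (D * D * Y ^+ (p + p)) = \tr ((Y ^+ p * D) *m (Y ^+ p * D)^T).
  rewrite -!mulmxE trmx_mul trmx_exp sD sY exprD -mulmxE.
  by rewrite mxtrace_mulC -!mulmxA mxtrace_mulC -!mulmxA.
have -> : \tr (Y ^+ (p + p)) = \tr (Y ^+ p *m (Y ^+ p)^T).
  by rewrite trmx_exp sY exprD mulmxE.
rewrite !mxtrace_mul_tr mulr_sumr; apply: ler_sum => i _.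
rewrite -!enorm_sqr -mulmxE row_mul -exprMn.
by rewrite ler_pXn2r ?nnegrE ?mulr_ge0 ?enorm_ge0.
Qed.

(** The squared norms [m k] of [u Y^k] are log-convex by Cauchy-Schwarz and start at [m 0 = 1], so
    [m 1 ^ p <= m p], and [m p] is at most the squared Frobenius norm of [Y^p]. A stretching factor
    is thus bounded by a trace without diagonalizing [Y]. *)
Lemma enorm_mulmx_exp_le_trace Y u (p : nat) : Y^T = Y -> enorm u = 1 ->
  enorm (u *m Y) ^+ (p + p) <= \tr (Y ^+ (p + p)).
Proof.
move=> sY nu.
pose m k := dotp (u *m Y ^+ k) (u *m Y ^+ k).
have m0 : m 0%N = 1 by rewrite /m expr0 mulmx1 -enorm_sqr nu expr1n.
have m1 : m 1%N = enorm (u *m Y) ^+ 2 by rewrite /m expr1 enorm_sqr.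
have mge k : 0 <= m k by exact: dotp_ge0.
have conv k : m k.+1 ^+ 2 <= m k * m k.+2.
  have -> : m k.+1 = dotp (u *m Y ^+ k) (u *m Y ^+ k.+2).
    have mE a b : dotp (u *m Y ^+ a) (u *m Y ^+ b) = dotp (u *m Y ^+ (a + b)) u.
      by rewrite [in RHS]exprD -mulmxE mulmxA [in RHS]dotp_mulmxl trmx_exp sY.
    by rewrite /m (mE k.+1 k.+1) (mE k k.+2); congr (dotp (u *m Y ^+ _) u); lia.
  rewrite /m -!enorm_sqr -exprMn -(real_normK (num_real (dotp _ _))).
  by rewrite ler_pXn2r ?nnegrE ?mulr_ge0 ?enorm_ge0 ?normr_ge0 // normr_dotp_le.
have m1k k : m 1%N * m k <= m k.+1 /\ m 1%N ^+ k <= m k.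
  elim: k => [|k [IH1 IH2]]; first by rewrite m0 mulr1 expr0.
  split; last by rewrite exprS (le_trans _ IH1) // ler_wpM2l.
  (* Log-convexity is a statement on the ratios [m k.+1 / m k]; when [m k] vanishes, it forces
     [m k.+1 = 0] directly. *)
  have [mk0|mk0] := eqVneq (m k) 0.
    have := conv k; rewrite mk0 mul0r => h.
    have -> : m k.+1 = 0 by apply/eqP; rewrite -sqrf_eq0 eq_le h sqr_ge0.
    by rewrite mulr0.
  have mk : 0 < m k by rewrite lt0r mk0 mge.
  rewrite -(ler_pM2l mk); apply: le_trans (conv k).
  by rewrite expr2 mulrA ler_wpM2r // mulrC.
have -> : enorm (u *m Y) ^+ (p + p) = m 1%N ^+ p by rewrite m1 -exprM; congr (_ ^+ _); lia.
apply: le_trans (m1k p).2 _.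
have -> : \tr (Y ^+ (p + p)) = \tr ((Y ^+ p)^T *m ((Y ^+ p)^T)^T).
  by rewrite trmxK trmx_exp sY exprD mulmxE.
rewrite mxtrace_mul_tr /m; apply: ler_sum => j _.
rewrite -expr2 -(real_normK (num_real _)) -enorm_sqr ler_pXn2r ?nnegrE ?normr_ge0 ?enorm_ge0 //.
have -> : (u *m Y ^+ p) 0 j = dotp u (row j (Y ^+ p)^T).
  by rewrite mxE; apply: eq_bigr => i _; rewrite !mxE.
by apply: le_trans (normr_dotp_le _ _) _; rewrite nu mul1r.
Qed.

End TraceInequalities.

(** By convexity the increments grow, so moving the pair [a], [r - a] outwards by one can only
    increase the sum of its two values. *)
Lemma convex_seq_reflect {R : realDomainType} (e : nat -> R) (r : nat) :
  (forall a, (a.+2 <= r)%N -> 2 * e a.+1 <= e a + e a.+2) ->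
  forall a, (a <= r)%N -> e a + e (r - a)%N <= e 0%N + e r.
Proof.
move=> cv.
have incr k a : (a + k.+1 <= r)%N -> e a.+1 - e a <= e (a + k).+1 - e (a + k)%N.
  elim: k => [|k IH] h; first by rewrite addn0.
  apply: le_trans (IH _) _; first by lia.
  by have := cv (a + k)%N; rewrite addnS => /(_ _) H; have := H ltac:(lia); lra.
have half a : (a + a <= r)%N -> e a + e (r - a)%N <= e 0%N + e r.
  elim: a => [|a IH] h; first by rewrite subn0.
  apply: le_trans (IH _); last by lia.
  have := incr (r - a.+1 - a)%N a ltac:(lia).
  have -> : (a + (r - a.+1 - a)).+1 = (r - a)%N by lia.
  have -> : (a + (r - a.+1 - a))%N = (r - a.+1)%N by lia.
  by lra.
move=> a ar; have [h|h] := leqP (a + a)%N r; first exact: half.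
have := half (r - a)%N ltac:(lia); rewrite subKn // => h'.
by rewrite addrC.
Qed.

(** A trapezoid rule. The even terms form a convex sequence [e], controlled by pairing [a] with
    [r - a]; each odd term is at most the mean of its two even neighbours. *)
Lemma sum_interp_le {R : realDomainType} (t : nat -> R) (r : nat) :
  (forall a b, (a <= r)%N -> (b <= r)%N -> 2 * t (a + b)%N <= t (a + a)%N + t (b + b)%N) ->
  2 * \sum_(q < (r + r).+1) t q <= (r + r).+1%:R * (t 0%N + t (r + r)%N).
Proof.
move=> ht; pose e a := t (a + a)%N.
have conv a : (a.+2 <= r)%N -> 2 * e a.+1 <= e a + e a.+2.
  move=> h; have := ht a a.+2 ltac:(lia) h.
  by rewrite (_ : a + a.+2 = a.+1 + a.+1)%N //; lia.
have refl := convex_seq_reflect conv.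
have split_sum k : \sum_(q < (k + k).+1) t q = \sum_(a < k.+1) e a + \sum_(a < k) t (a + a).+1.
  elim: k => [|k IH]; first by rewrite !big_ord_recr !big_ord0 /= addr0.
  rewrite addSn addnS 2!big_ord_recr /= IH [in RHS]big_ord_recr /= [X in _ = _ + X]big_ord_recr /=.
  by rewrite /e addSn addnS; ring.
have odd_le : 2 * \sum_(a < r) t (a + a).+1 <= \sum_(a < r) e a + \sum_(a < r) e a.+1.
  rewrite mulr_sumr -big_split /=; apply: ler_sum => a _.
  have := ht a a.+1 ltac:(have := ltn_ord a; lia) (ltn_ord a).
  by rewrite addnS.
have even_le : 2 * \sum_(a < r.+1) e a <= r.+1%:R * (e 0%N + e r).
  have -> : 2 * \sum_(a < r.+1) e a = \sum_(a < r.+1) (e a + e (r - a)%N).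
    rewrite big_split /= mulr2n mulrDl mul1r; congr (_ + _).
    by rewrite (reindex_inj rev_ord_inj) /=; apply: eq_bigr => a _; rewrite subSS.
  apply: (@le_trans _ _ (\sum_(a < r.+1) (e 0%N + e r))).
    by apply: ler_sum => a _; apply: refl; rewrite -ltnS.
  by rewrite sumr_const card_ord mulr_natl.
have s1 : \sum_(a < r.+1) e a = \sum_(a < r) e a + e r by rewrite big_ord_recr.
have s2 : \sum_(a < r.+1) e a = e 0%N + \sum_(a < r) e a.+1.
  by rewrite big_ord_recl; congr (_ + _); apply: eq_bigr.
(* Twice the sum is at most [4 * sum e - e 0 - e r], hence at most
   [2 (r + 1) (e 0 + e r) - (e 0 + e r)]. *)
rewrite split_sum.
have -> : (r + r).+1%:R = 2 * r.+1%:R - 1 :> R by rewrite -addn1 natrD natrD -natr1; ring.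
have e0 : e 0%N = t 0%N by [].
have er : e r = t (r + r)%N by [].
by rewrite -e0 -er; nra.
Qed.

Section TraceDifference.
Context {R : realType} {n : nat}.
Implicit Types (V W : 'M[R]_n).

Lemma subrXX_telescope V W k :
  W ^+ k - V ^+ k = \sum_(i < k) W ^+ i * (W - V) * V ^+ (k - i.+1).
Proof.
elim: k => [|k IH]; first by rewrite big_ord0 !expr0 subrr.
rewrite big_ord_recl expr0 mul1r subn1 /=.
rewrite (eq_bigr (fun i : 'I_k => W * (W ^+ i * (W - V) * V ^+ (k - i.+1)))); last first.
  by move=> i _; rewrite exprS -!mulrA.
by rewrite -mulr_sumr -IH mulrBl mulrBr -!exprS [RHS]addrC [RHS]addrA subrK.
Qed.

(** A noncommutative mean value inequality for [Y^(2p+1)]. Telescoping gives terms that mix powers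
    of [W] and [V]; the trapezoid rule trades them for the two extreme terms, each of which involves
    only one of [W] and [V] besides the difference. *)
Lemma mxtrace_exp_diff V W (c : R) (p : nat) :
  V^T = V -> W^T = W -> 0 <= c ->
  (forall u, enorm (u *m (W - V)) <= c * enorm u) ->
  2 * \tr ((W - V) *m (W ^+ (p + p).+1 - V ^+ (p + p).+1)) <=
  (p + p).+1%:R * c ^+ 2 * (\tr (W ^+ (p + p)) + \tr (V ^+ (p + p))).
Proof.
move=> sV sW c0 hD; set D := W - V.
have sD : D^T = D by rewrite /D; apply/matrixP => i j; rewrite !mxE -[in RHS]sW -[in RHS]sV !mxE.
rewrite subrXX_telescope -/D mulmx_sumr raddf_sum /=.
rewrite (eq_bigr (fun i : 'I_(p + p).+1 => \tr (D * W ^+ i * D * V ^+ (p + p - i)))); last first.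
  by move=> i _; rewrite mulmxE !mulrA subSS.
apply: le_trans (sum_interp_le (t := fun q => \tr (D * W ^+ q * D * V ^+ (p + p - q))) _) _.
  by move=> a b ar br; apply: mxtrace_interp.
rewrite -[X in _ <= X]mulrA ler_wpM2l // subn0 subnn !expr0 !mulr1 addrC [X in _ <= X]mulrDr.
apply: lerD; last exact: mxtrace_sqr_mul.
have -> : \tr (D * W ^+ (p + p) * D) = \tr (D * D * W ^+ (p + p)).
  by rewrite -mulmxE mxtrace_mulC mulmxE mulrA.
exact: mxtrace_sqr_mul.
Qed.

End TraceDifference.

(** * Moments of sums of exchangeable samples *)

Lemma eq_ler {R : numDomainType} (x y : R) : x = y -> x <= y.
Proof. by move=> ->. Qed.

Section ExchangeableSums.
Context {R : realFieldType} {N m : nat} {V : zmodType}.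
Variables (X : 'I_N -> V) (Psi : V -> V -> R) (tau : V -> R) (kappa : R).
Hypothesis N_gt0 : (0 < N)%N.
Hypothesis X_centered : \sum_i X i = 0.
Hypothesis PsiD : forall A B Y, Psi (A + B) Y = Psi A Y + Psi B Y.

(** Samples are elements of a finite type, so an expectation under the uniform law is a plain sum,
    up to the factor [N^m]. *)
Definition sample_sum (s : {ffun 'I_m -> 'I_N}) : V := \sum_j X (s j).

Definition resample (s : {ffun 'I_m -> 'I_N}) j i : {ffun 'I_m -> 'I_N} :=
  [ffun k => if k == j then i else s k].

Lemma sample_sum_resample s j i :
  sample_sum s - sample_sum (resample s j i) = X (s j) - X i.
Proof.
rewrite /sample_sum (bigD1 j) //= [X in _ - X](bigD1 j) //= !ffunE eqxx opprD.
rewrite [X in _ + (_ - X)](eq_bigr (fun k => X (s k))); last first.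
  by move=> k kj; rewrite ffunE (negPf kj).
by rewrite addrACA subrr addr0.
Qed.

Let Psi0 Y : Psi 0 Y = 0.
Proof. by apply: (addrI (Psi 0 Y)); rewrite -PsiD !addr0. Qed.

Let PsiN A Y : Psi (- A) Y = - Psi A Y.
Proof. by apply: (addrI (Psi A Y)); rewrite -PsiD !subrr Psi0. Qed.

Let Psi_sum (I : Type) (r : seq I) F Y :
  Psi (\sum_(i <- r) F i) Y = \sum_(i <- r) Psi (F i) Y.
Proof.
elim: r => [|i r IH]; first by rewrite !big_nil Psi0.
by rewrite !big_cons PsiD IH.
Qed.

(** Two kernels are meant: [tr (A Y^(2p+1))] for matrices and the inner product of [a] with
    [|y|^(2p) y] for vectors. On the diagonal [Psi] is then the next even moment, and [tau] is the
    current one. *)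
Hypothesis Psi_diff : forall s j i, let W := sample_sum s in
  let V' := sample_sum (resample s j i) in
  Psi (W - V') W - Psi (W - V') V' <= kappa * (tau W + tau V').

(* Replacing one draw by an independent copy is a measure-preserving
   involution, so the increment of [Psi] may be antisymmetrized. *)
Lemma exchange_moment :
  \sum_s Psi (sample_sum s) (sample_sum s) <= m%:R * kappa * \sum_s tau (sample_sum s).
Proof.
have swapE (G : {ffun 'I_m -> 'I_N} -> 'I_N -> R) j :
    \sum_s \sum_i G s i = \sum_s \sum_i G (resample s j i) (s j).
  rewrite !pair_big /=.
  rewrite (reindex_inj (h := fun z : {ffun 'I_m -> 'I_N} * 'I_N => (resample z.1 j z.2, z.1 j))) //=.
  apply: (can_inj (g := fun z => (resample z.1 j z.2, z.1 j))) => -[s i] /=.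
  rewrite ffunE eqxx; congr (_, _); apply/ffunP => k; rewrite !ffunE.
  by case: eqP => [->|].
have one j : N%:R * \sum_(s : {ffun _ -> _}) Psi (X (s j)) (sample_sum s) <=
    N%:R * (kappa * \sum_s tau (sample_sum s)).
  pose D s i := sample_sum s - sample_sum (resample s j i).
  (* Since [X] is centered, subtracting [Psi (X i)] and summing over [i] changes nothing, and it
     turns [X (s j)] into the increment [D s i]. *)
  have -> : N%:R * \sum_(s : {ffun _ -> _}) Psi (X (s j)) (sample_sum s) =
      \sum_s \sum_i Psi (D s i) (sample_sum s).
    rewrite mulr_sumr; apply: eq_bigr => s _.
    rewrite (eq_bigr (fun i => Psi (X (s j)) (sample_sum s) - Psi (X i) (sample_sum s))).
      by rewrite sumrB -(Psi_sum _ X) X_centered Psi0 subr0 sumr_const card_ord mulr_natl.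
    by move=> i _; rewrite /D sample_sum_resample PsiD PsiN.
  set T := \sum_s _.
  have T2 : T = \sum_s \sum_i - Psi (D s i) (sample_sum (resample s j i)).
    rewrite /T (swapE _ j); apply: eq_bigr => s _; apply: eq_bigr => i _.
    rewrite -PsiN /D opprB; congr (Psi (_ - sample_sum _) _).
    by apply/ffunP => k; rewrite !ffunE; case: eqP => [->|].
  (* Adding the original and the swapped expression of [T] produces exactly the difference bounded
     by [Psi_diff]. *)
  have : T + T <= \sum_s \sum_i kappa * (tau (sample_sum s) + tau (sample_sum (resample s j i))).
    rewrite {2}T2 /T -big_split; apply: ler_sum => s _ /=.
    by rewrite -big_split; apply: ler_sum => i _ /=; apply: Psi_diff.
  under eq_bigr do rewrite -mulr_sumr big_split /=.
  rewrite -mulr_sumr big_split /= -(swapE (fun s _ => tau (sample_sum s)) j).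
  rewrite (eq_bigr (fun s => N%:R * tau (sample_sum s))); last first.
    by move=> s _; rewrite sumr_const card_ord mulr_natl.
  rewrite -mulr_sumr; lra.
have -> : \sum_s Psi (sample_sum s) (sample_sum s) = \sum_j \sum_(s : {ffun _ -> _}) Psi (X (s j)) (sample_sum s).
  by rewrite exchange_big /=; apply: eq_bigr => s _; rewrite {1}/sample_sum Psi_sum.
rewrite -mulrA; apply: (@le_trans _ _ (\sum_(j < m) kappa * \sum_s tau (sample_sum s))).
  apply: ler_sum => j _; have := one j; rewrite ler_pM2l //.
  by rewrite ltr0n.
by rewrite sumr_const card_ord mulr_natl.
Qed.

End ExchangeableSums.

Section MomentRecursion.
Context {R : realType} {N m d : nat}.
Hypothesis N_gt0 : (0 < N)%N.
Variable c : R.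
Hypothesis c_ge0 : 0 <= c.

(** The factor [(2p+1) sigma] with [sigma = m c^2 / 2] is the moment recursion of a Gaussian
    variable of variance [sigma]; this is what makes the tails sub-Gaussian. *)
Lemma matrix_moment_step (X : 'I_N -> 'M[R]_d) (p : nat) :
  \sum_i X i = 0 -> (forall i, (X i)^T = X i) ->
  (forall i i' u, enorm (u *m (X i - X i')) <= c * enorm u) ->
  \sum_s \tr (sample_sum (m := m) X s ^+ (p.+1 + p.+1)) <=
  (p + p).+1%:R * (m%:R * c ^+ 2 / 2) * \sum_s \tr (sample_sum (m := m) X s ^+ (p + p)).
Proof.
move=> X0 sX hX.
have sS s : (sample_sum (m := m) X s)^T = sample_sum X s.
  by rewrite /sample_sum raddf_sum; apply: eq_bigr => j _; apply: sX.
have := @exchange_moment R N m _ X (fun A Y => \tr (A *m Y ^+ (p + p).+1))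
  (fun Y => \tr (Y ^+ (p + p))) ((p + p).+1%:R * c ^+ 2 / 2) N_gt0 X0.
case/(_ _ _)/Wrap; first by move=> A B Y; rewrite mulmxDl mxtraceD.
  move=> s j i; cbv zeta; set W := sample_sum X s; set V' := sample_sum X _; set D := W - V'.
  have hD u : enorm (u *m (W - V')) <= c * enorm u by rewrite /W /V' sample_sum_resample.
  have := mxtrace_exp_diff p (sS _) (sS _) c_ge0 hD.
  rewrite -/D mulmxBr mxtraceD -scaleN1r mxtraceZ mulN1r; lra.
move=> H; apply: le_trans (le_trans _ H) _.
  by apply: ler_sum => s _; rewrite addSn addnS exprS mulmxE.
by apply: eq_ler; ring.
Qed.

(** Both factors on the left contain [a - b]. The cofactor is a sum that is paired with its own
    reversal, and [a^(n-i) b^i + a^i b^(n-i) <= a^n + b^n] by rearrangement. *)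
Lemma subrXX_mul_le (a b : R) (n : nat) : 0 <= a -> 0 <= b ->
  (a ^+ n - b ^+ n) * (a ^+ 2 - b ^+ 2) <= n%:R * (a ^+ n + b ^+ n) * (a - b) ^+ 2.
Proof.
move=> a0 b0.
rewrite subrXX (subr_sqr a b).
rewrite [X in X <= _](_ : _ = ((a + b) * (\sum_(i < n) a ^+ (n.-1 - i) * b ^+ i)) * (a - b) ^+ 2); last by ring.
rewrite ler_wpM2r ?sqr_ge0 // mulrDl !mulr_sumr.
rewrite [X in _ + X](reindex_inj rev_ord_inj) /= -big_split /=.
apply: (@le_trans _ _ (\sum_(i < n) (a ^+ n + b ^+ n))); last first.
  by rewrite sumr_const card_ord mulr_natl.
apply: ler_sum => i _; have ltin := ltn_ord i.
have -> : a * (a ^+ (n.-1 - i) * b ^+ i) = a ^+ (n - i) * b ^+ i.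
  by rewrite mulrA -exprS; congr (a ^+ _ * _); lia.
have -> : b * (a ^+ (n.-1 - (n - i.+1)) * b ^+ (n - i.+1)) = a ^+ i * b ^+ (n - i).
  by rewrite mulrCA -exprS; congr (a ^+ _ * b ^+ _); lia.
have an : a ^+ n = a ^+ (n - i) * a ^+ i by rewrite -exprD subnK // ltnW.
have bn : b ^+ n = b ^+ (n - i) * b ^+ i by rewrite -exprD subnK // ltnW.
rewrite an bn.
suff : 0 <= (a ^+ (n - i) - b ^+ (n - i)) * (a ^+ i - b ^+ i) by lra.
have [ab|/ltW ab] := leP a b; [apply: mulr_le0|apply: mulr_ge0];
  by rewrite ?subr_le0 ?subr_ge0 lerXn2r.
Qed.

(** With [a = |w|^(2p)] and [b = |v|^(2p)], the left side equals [(a + b) |w - v|^2 + (a - b) (|w|^2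
    - |v|^2)]. The second term is at most [2p (a + b) (|w| - |v|)^2], and the reverse triangle
    inequality finishes. *)
Lemma dotp_power_diff (v w : 'rV[R]_d) (p : nat) :
  2 * (dotp (w - v) (enorm w ^+ (p + p) *: w) - dotp (w - v) (enorm v ^+ (p + p) *: v)) <=
  (p + p).+1%:R * enorm (w - v) ^+ 2 * (enorm w ^+ (p + p) + enorm v ^+ (p + p)).
Proof.
have nD : enorm (w - v) ^+ 2 = enorm w ^+ 2 + enorm v ^+ 2 - 2 * dotp w v.
  rewrite !enorm_sqr dotpDl !dotpDr !dotpNl !dotpNr (dotpC v w); ring.
have key : (enorm w - enorm v) ^+ 2 <= enorm (w - v) ^+ 2.
  by rewrite nD; have := dotp_le_enorm w v; lra.
have := subrXX_mul_le (p + p) (enorm_ge0 w) (enorm_ge0 v).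
have s0 : 0 <= enorm w ^+ (p + p) + enorm v ^+ (p + p).
  by rewrite addr_ge0 ?exprn_ge0 ?enorm_ge0.
have := ler_wpM2l (mulr_ge0 (ler0n R (p + p)) s0) key.
rewrite !dotpZr !dotpDl !dotpNl -!enorm_sqr (dotpC v w) -natr1.
move: (enorm w ^+ (p + p)) (enorm v ^+ (p + p)) s0 => a b s0 h1 h2.
rewrite nD in h1 *; lra.
Qed.

Lemma vector_moment_step (X : 'I_N -> 'rV[R]_d) (p : nat) :
  \sum_i X i = 0 -> (forall i i', enorm (X i - X i') <= c) ->
  \sum_s enorm (sample_sum (m := m) X s) ^+ (p.+1 + p.+1) <=
  (p + p).+1%:R * (m%:R * c ^+ 2 / 2) * \sum_s enorm (sample_sum (m := m) X s) ^+ (p + p).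
Proof.
move=> X0 hX.
have := @exchange_moment R N m _ X (fun a y => dotp a (enorm y ^+ (p + p) *: y))
  (fun y => enorm y ^+ (p + p)) ((p + p).+1%:R * c ^+ 2 / 2) N_gt0 X0.
move=> /(_ _ _)/wrap[]; first by move=> A B Y; rewrite dotpDl.
  move=> s j i; cbv zeta; set W := sample_sum X s; set V' := sample_sum X _.
  have hD : enorm (W - V') ^+ 2 <= c ^+ 2.
    by rewrite /W /V' sample_sum_resample ler_pXn2r ?nnegrE ?enorm_ge0.
  have s0 : 0 <= enorm W ^+ (p + p) + enorm V' ^+ (p + p).
    by rewrite addr_ge0 ?exprn_ge0 ?enorm_ge0.
  have := ler_wpM2l (mulr_ge0 (ler0n R (p + p).+1) s0) hD.
  have := dotp_power_diff V' W p.
  lra.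
move=> H; apply: le_trans (le_trans _ H) _.
  apply: ler_sum => s _; rewrite dotpZr -enorm_sqr -exprD.
  by rewrite (_ : p + p + 2 = p.+1 + p.+1)%N //; lia.
by apply: eq_ler; ring.
Qed.

End MomentRecursion.

(** * From even moments to sub-Gaussian tails *)

Section MomentTail.
Context {R : realType}.
Implicit Types (x z : R).

Lemma series_exp_coeff_le_expR x n : 0 <= x -> series (exp_coeff x) n <= expR x.
Proof.
move=> x0; apply: nondecreasing_cvgn_le (is_cvg_series_exp_coeff x) n.
by apply: nondecreasing_series => k _ _; apply: divr_ge0; rewrite ?exprn_ge0.
Qed.

Lemma series_exp_coeff_even z n :
  series (exp_coeff z) (n + n)%N + series (exp_coeff (- z)) (n + n)%N =
  2 * \sum_(p < n) z ^+ (p + p) / (p + p)`!%:R.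
Proof.
elim: n => [|n IH]; first by rewrite /series /= !big_geq // big_ord0 addr0 mulr0.
rewrite addSn addnS /series /= !big_nat_recr //= big_ord_recr /= mulrDr -IH /series /exp_coeff /=.
have e : (- z) ^+ (n + n) = z ^+ (n + n) by rewrite addnn -mul2n !exprM sqrrN.
by rewrite !exprS e !mulNr; lra.
Qed.

(** Moment estimates control finitely many even terms at a time; partial sums of even length already
    determine the limit. *)
Lemma coshM2_le_of_partial_sums z q B :
  (forall n, q * (series (exp_coeff z) (n + n)%N + series (exp_coeff (- z)) (n + n)%N) <= B) ->
  q * (expR z + expR (- z)) <= B.
Proof.
move=> partial.
have cv x : (fun n => series (exp_coeff x) (n + n)%N) @ \oo --> expR x.
  apply: (@cvg_comp _ _ _ (fun n => (n + n)%N) (series (exp_coeff x)) _ \oo); last exact: is_cvg_series_exp_coeff.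
  by apply/cvgnyPge => A; exists A => // k /= Ak; lia.
have h : (fun n => q * (series (exp_coeff z) (n + n)%N + series (exp_coeff (- z)) (n + n)%N))
   @ \oo --> q * (expR z + expR (- z)) by apply: cvgMr; apply: cvgD; exact: cv.
rewrite -(cvg_lim _ h) //; apply: limr_le; first by apply: cvgP h.
by apply: nearW.
Qed.

(** Termwise comparison of [cosh z] with [exp (z^2 / 2)], from [2^p p! <= (2p)!]. *)
Lemma expRD_expRN_le z : expR z + expR (- z) <= 2 * expR (z ^+ 2 / 2).
Proof.
rewrite -[leLHS]mul1r; apply: coshM2_le_of_partial_sums => n.
rewrite mul1r series_exp_coeff_even ler_pM2l //.
have z2 : 0 <= z ^+ 2 / 2 by rewrite divr_ge0 ?sqr_ge0.
apply: le_trans (series_exp_coeff_le_expR n z2).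
rewrite /series /= big_mkord; apply: ler_sum => p _; rewrite /exp_coeff /=.
rewrite addnn -mul2n exprM expr_div_n -mulrA ler_wpM2l ?(exprn_ge0 _ (sqr_ge0 z)) //.
rewrite -invfM lef_pV2 ?posrE ?mulr_gt0 ?exprn_gt0 ?ltr0n ?fact_gt0 //.
rewrite -natrX -natrM ler_nat; elim: (p : nat) => [|k IH]; first by rewrite !fact0.
rewrite mulnS 2!factS factS expnS; move: IH; move: (2 * k)`! (2 ^ k)%N k`! => a b c IH.
nia.
Qed.

(* Weighting the moments by [(r / sigma)^(2p) / (2p)!] turns the left side
   into cosh (r^2 / sigma) and the right side into exp (r^2 / (2 sigma)). *)
Lemma moment_tail (Mo : nat -> R) (D q r sigma : R) :
  0 <= D -> 0 <= q -> 0 < sigma -> 0 <= r ->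
  Mo 0%N <= D ->
  (forall p, Mo p.+1 <= (p + p).+1%:R * sigma * Mo p) ->
  (forall p, q * r ^+ (p + p) <= Mo p) ->
  q <= 2 * D * expR (- (r ^+ 2 / (2 * sigma))).
Proof.
move=> D0 q0 s0 r0 M0 MS Mq.
pose lam := r / sigma; pose z := lam * r; pose w := lam ^+ 2 * sigma / 2.
have wz : w = z / 2 by rewrite /w /z /lam; field; rewrite gt_eqF.
have lam0 : 0 <= lam by rewrite divr_ge0 // ltW.
have w0 : 0 <= w by rewrite wz; apply: divr_ge0 => //; apply: mulr_ge0.
(* One step of the recursion multiplies the weighted moment by at most [lam^2 sigma (2p+1) /
   ((2p+1)(2p+2)) = w / (p+1)], the ratio of consecutive terms of the series of [exp w]. *)
have step p : lam ^+ (p + p) * Mo p / (p + p)`!%:R <= D * (w ^+ p / p`!%:R).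
  elim: p => [|p IH]; first by rewrite !expr0 fact0 !divr1 mul1r mulr1.
  have h1 : lam ^+ (p.+1 + p.+1) * Mo p.+1 / (p.+1 + p.+1)`!%:R <=
      w / p.+1%:R * (lam ^+ (p + p) * Mo p / (p + p)`!%:R).
    apply: (@le_trans _ _ (lam ^+ (p.+1 + p.+1) * ((p + p).+1%:R * sigma * Mo p) / (p.+1 + p.+1)`!%:R)).
      by rewrite ler_wpM2r ?invr_ge0 // ler_wpM2l ?exprn_ge0.
    rewrite addSn addnS !factS !natrM /w.
    have -> : (p + p).+2%:R = 2 * p.+1%:R :> R by rewrite -addn2 !natrD -[p.+1]addn1 natrD; ring.
    have : (p + p)`!%:R != 0 :> R by rewrite pnatr_eq0 -lt0n fact_gt0.
    have : p.+1%:R != 0 :> R by rewrite pnatr_eq0.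
    have : (p + p).+1%:R != 0 :> R by rewrite pnatr_eq0.
    move: (p + p)`!%:R p.+1%:R (p + p).+1%:R => a b c c0 b0 a0.
    by rewrite !exprS; apply: eq_ler; field; rewrite a0 b0 c0.
  apply: le_trans h1 _; apply: (@le_trans _ _ (w / p.+1%:R * (D * (w ^+ p / p`!%:R)))).
    by rewrite ler_wpM2l // divr_ge0.
  have : p`!%:R != 0 :> R by rewrite pnatr_eq0 -lt0n fact_gt0.
  have : p.+1%:R != 0 :> R by rewrite pnatr_eq0.
  rewrite factS natrM exprS; move: p`!%:R p.+1%:R => a b b0 a0.
  by apply: eq_ler; field; rewrite a0 b0.
have partial n : q * (series (exp_coeff z) (n + n)%N + series (exp_coeff (- z)) (n + n)%N)
    <= 2 * D * expR w.
  rewrite series_exp_coeff_even mulrCA -mulrA ler_pM2l // mulr_sumr.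
  apply: (@le_trans _ _ (\sum_(p < n) D * (w ^+ p / p`!%:R))).
    apply: ler_sum => p _; apply: le_trans (step p).
    rewrite mulrA ler_wpM2r ?invr_ge0 // /z exprMn mulrCA ler_wpM2l ?exprn_ge0 //.
  rewrite -mulr_sumr ler_wpM2l //.
  apply: le_trans (series_exp_coeff_le_expR n w0).
  by rewrite /series /= big_mkord.
have lim := coshM2_le_of_partial_sums partial.
have : q * expR z <= 2 * D * expR w.
  by apply: le_trans lim; rewrite ler_wpM2l // lerDl expR_ge0.
have -> : r ^+ 2 / (2 * sigma) = z - w by rewrite wz /z /lam; field; rewrite gt_eqF.
by rewrite opprB expRD expRN mulrA ler_pdivlMr ?expR_gt0.
Qed.

End MomentTail.

(** * Spectral norm and tails of sampled means *)

Section SpectralNorm.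
Context {R : realType} {d : nat}.
Implicit Types (A B : 'M[R]_d) (u : 'rV[R]_d).

(** Coordinatewise Cauchy-Schwarz. It shows that the supremum defining [specnorm] is taken over a
    bounded set. *)
Lemma enorm_mulmx_frob A u : enorm (u *m A) <= enorm u * Num.sqrt (\tr (A^T *m A)).
Proof.
have t0 : 0 <= \tr (A^T *m A) by rewrite -{2}[A]trmxK mxtrace_mul_tr_ge0.
rewrite -(ler_pXn2r (n := 2)) ?nnegrE ?mulr_ge0 ?enorm_ge0 ?sqrtr_ge0 //.
rewrite exprMn (sqr_sqrtr t0) !enorm_sqr.
have -> : \tr (A^T *m A) = \tr (A^T *m A^T^T) by rewrite trmxK.
rewrite mxtrace_mul_tr mulr_sumr.
apply: ler_sum => j _.
rewrite -expr2 -(real_normK (num_real _)) -!enorm_sqr -exprMn.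
rewrite ler_pXn2r ?nnegrE ?normr_ge0 ?mulr_ge0 ?enorm_ge0 //.
have -> : (u *m A) 0 j = dotp u (row j A^T).
  by rewrite mxE; apply: eq_bigr => i _; rewrite !mxE.
exact: normr_dotp_le.
Qed.

Lemma specnorm_has_ubound A :
  has_ubound [set enorm (v *m A) | v in [set v | enorm v = 1]].
Proof.
exists (Num.sqrt (\tr (A^T *m A))) => _ [v /= nv <-].
by have := enorm_mulmx_frob A v; rewrite nv mul1r.
Qed.

Lemma enorm_mulmx_le A u : enorm (u *m A) <= specnorm A * enorm u.
Proof.
have [->|u0] := eqVneq u 0; first by rewrite mul0mx enorm0 mulr0.
have nu : 0 < enorm u by rewrite lt0r enorm_ge0 andbT; apply: contra_neq u0 => /enorm0_eq.
rewrite -ler_pdivrMr // mulrC -[_^-1]gtr0_norm ?invr_gt0 // -enormZ scalemxAl.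
apply: (ub_le_sup (specnorm_has_ubound A)); exists ((enorm u)^-1 *: u) => //=.
by rewrite enormZ gtr0_norm ?invr_gt0 // mulVf // gt_eqF.
Qed.

Lemma specnorm_le A c : 0 <= c -> (forall u, enorm u = 1 -> enorm (u *m A) <= c) ->
  specnorm A <= c.
Proof.
move=> c0 h; rewrite /specnorm; set E := [set _ | _ in _].
(* For [d = 0] there is no unit vector, and the supremum of the empty set is [0]; here [0 <= c] is
   used. *)
have [->|E0] := eqVneq E set0; first by rewrite sup0.
by apply: ge_sup; [exact/set0P|move=> _ [v nv <-]; exact: h].
Qed.

Lemma specnorm_gt A r : 0 <= r -> r < specnorm A ->
  exists2 u, enorm u = 1 & r < enorm (u *m A).
Proof.
move=> r0 hr; apply: contrapT => hn; move: hr; apply/negP; rewrite -leNgt.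
apply: specnorm_le => // u nu; rewrite leNgt; apply/negP => h.
by apply: hn; exists u.
Qed.

Lemma specnorm_ge0 A : 0 <= specnorm A.
Proof.
rewrite /specnorm; set E := [set _ | _ in _].
have [->|/set0P[r [v nv _]]] := eqVneq E set0; first by rewrite sup0.
apply: le_trans (enorm_ge0 (v *m A)) _.
by apply: (ub_le_sup (specnorm_has_ubound A)); exists v.
Qed.

Lemma specnormN A : specnorm (- A) = specnorm A.
Proof.
rewrite /specnorm; congr sup; apply/seteqP; split => _ [v nv <-]; exists v => //;
  by rewrite mulmxN enormN.
Qed.

Lemma specnormD A B : specnorm (A + B) <= specnorm A + specnorm B.
Proof.
apply: specnorm_le => [|u nu]; first by rewrite addr_ge0 ?specnorm_ge0.
rewrite mulmxDr (le_trans (enormD _ _)) //.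
by apply: lerD; apply: le_trans (enorm_mulmx_le _ _) _; rewrite nu mulr1.
Qed.

Lemma specnormZ_le a A : 0 <= a -> specnorm (a *: A) <= a * specnorm A.
Proof.
move=> a0; apply: specnorm_le => [|u nu]; first by rewrite mulr_ge0 ?specnorm_ge0.
rewrite -scalemxAr enormZ ger0_norm // ler_wpM2l //.
by apply: le_trans (enorm_mulmx_le _ _) _; rewrite nu mulr1.
Qed.

Lemma specnorm_sum_le (I : finType) (F : I -> 'M[R]_d) :
  specnorm (\sum_i F i) <= \sum_i specnorm (F i).
Proof.
apply: (big_ind2 (fun x y => specnorm x <= y)) => [|x1 x2 y1 y2 h1 h2|//].
  by apply: specnorm_le => // u _; rewrite mulmx0 enorm0.
by apply: le_trans (specnormD _ _) _; apply: lerD.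
Qed.

Lemma normr_qform_le A u : enorm u = 1 -> `|qform A u| <= specnorm A.
Proof.
move=> nu; rewrite qform_dotp; apply: le_trans (normr_dotp_le _ _) _.
by rewrite nu mulr1; have := enorm_mulmx_le A u; rewrite nu mulr1.
Qed.

End SpectralNorm.

Lemma mxtrace_even_exp_ge0 {R : realType} {d : nat} (Y : 'M[R]_d) p :
  Y^T = Y -> 0 <= \tr (Y ^+ (p + p)).
Proof.
move=> sY; rewrite exprD -[X in _ * X]trmxK trmx_exp sY.
exact: mxtrace_mul_tr_ge0.
Qed.

Section SampleTails.
Context {R : realType} {N m d : nat}.
Hypotheses (N_gt0 : (0 < N)%N) (m_gt0 : (0 < m)%N).
Variables (a K e l : R).
Hypotheses (a_gt0 : 0 < a) (K_ge0 : 0 <= K) (e_gt0 : 0 < e) (l_gt0 : 0 < l).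
Hypothesis m_large : a * (K / e) ^+ 2 * l <= m%:R.

Definition deviation {V : lmodType R} (A : 'I_N -> V) (i : 'I_N) : V :=
  A i - N%:R^-1 *: \sum_k A k.

Lemma deviation_sum0 {V : lmodType R} (A : 'I_N -> V) : \sum_i deviation A i = 0.
Proof.
rewrite sumrB sumr_const card_ord -scaler_nat scalerA mulfV ?scale1r ?subrr //.
by rewrite pnatr_eq0 -lt0n.
Qed.

Lemma deviationB {V : lmodType R} (A : 'I_N -> V) i k :
  deviation A i - deviation A k = A i - A k.
Proof. by rewrite /deviation opprB addrA subrK. Qed.

(* The constant for which the sample-size condition is an equality. *)
Let K' := e * Num.sqrt (m%:R / (a * l)).

Let K'_gt0 : 0 < K'.
Proof. by rewrite mulr_gt0 // sqrtr_gt0 divr_gt0 ?mulr_gt0 ?ltr0n. Qed.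

Let K'_sqr : K' ^+ 2 = e ^+ 2 * (m%:R / (a * l)).
Proof. by rewrite exprMn sqr_sqrtr // divr_ge0 // ltW // mulr_gt0. Qed.

Let K_le : K <= K'.
Proof.
rewrite -(ler_pXn2r (n := 2)) ?nnegrE // ?(ltW K'_gt0) // K'_sqr.
have al : 0 < a * l by rewrite mulr_gt0.
rewrite mulrA ler_pdivlMr // mulrC -ler_pdivrMl ?exprn_gt0 //.
by move: m_large; congr (_ <= _); field; rewrite gt_eqF.
Qed.

(** Two samples differ by at most [2 K'], so the variance proxy is [m (2 K')^2 / 2]. By the choice
    of [K'], the Gaussian exponent at the deviation [m rho e] no longer involves [m], [K] or [e]. *)
Let exponent rho : (m%:R * (rho * e)) ^+ 2 / (2 * (m%:R * (2 * K') ^+ 2 / 2)) = rho ^+ 2 * a / 4 * l.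
Proof.
rewrite (exprMn 2 2 K') K'_sqr; field.
by rewrite !gt_eqF ?ltr0n.
Qed.

Let sigma_gt0 : 0 < m%:R * (2 * K') ^+ 2 / 2.
Proof. by rewrite divr_gt0 // mulr_gt0 ?ltr0n // exprn_gt0 // mulr_gt0. Qed.

Let card_samples : \sum_(s : {ffun 'I_m -> 'I_N}) (1 : R) = N%:R ^+ m.
Proof. by rewrite sumr_const card_ffun !card_ord natrX. Qed.

Lemma vector_sample_tail (A : 'I_N -> 'rV[R]_d) (rho : R) : 0 <= rho ->
  (forall i, enorm (A i) <= K) ->
  \sum_(s : {ffun 'I_m -> 'I_N})
     (m%:R * (rho * e) <= enorm (sample_sum (deviation A) s))%R%:R
  <= N%:R ^+ m * (2 * expR (- (rho ^+ 2 * a / 4 * l))).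
Proof.
move=> rho0 hA; have mre : 0 <= m%:R * (rho * e) by rewrite !mulr_ge0 // ltW.
have hX i i' : enorm (deviation A i - deviation A i') <= 2 * K'.
  rewrite deviationB (le_trans (enormB _ _)) //.
  by have := hA i; have := hA i'; have := K_le; lra.
rewrite -exponent; set E := expR _; have -> : N%:R ^+ m * (2 * E) = 2 * N%:R ^+ m * E by ring.
apply: (moment_tail (Mo := fun p => \sum_s enorm (sample_sum (m := m) (deviation A) s) ^+ (p + p)))
  => //.
- by apply: sumr_ge0.
- by rewrite -card_samples; apply: ler_sum => s _; rewrite expr0.
- move=> p; apply: vector_moment_step => //; last exact: deviation_sum0.
  by rewrite mulr_ge0 // ltW.
- move=> p; rewrite mulr_suml; apply: ler_sum => s _.
  case: (boolP (_ <= enorm _)) => h; last by rewrite mul0r exprn_ge0 ?enorm_ge0.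
  by rewrite mul1r lerXn2r ?nnegrE ?enorm_ge0.
Qed.

(** The counted event is the family of lower bounds that [moment_tail] asks for. The dimension
    enters only as the trace of the identity, the moment of order zero. *)
Lemma matrix_sample_tail (A : 'I_N -> 'M[R]_d) (rho : R) : 0 <= rho ->
  (forall i, (A i)^T = A i) -> (forall i, specnorm (A i) <= K) ->
  \sum_(s : {ffun 'I_m -> 'I_N})
     `[< forall p, (m%:R * (rho * e)) ^+ (p + p) <= \tr (sample_sum (deviation A) s ^+ (p + p)) >]%:R
  <= N%:R ^+ m * (2 * d%:R * expR (- (rho ^+ 2 * a / 4 * l))).
Proof.
move=> rho0 sA hA; have mre : 0 <= m%:R * (rho * e) by rewrite !mulr_ge0 // ltW.
have hX i i' u : enorm (u *m (deviation A i - deviation A i')) <= 2 * K' * enorm u.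
  rewrite deviationB mulmxBr (le_trans (enormB _ _)) // -mulrA mulr2n mulrDl !mul1r.
  have hk k : enorm (u *m A k) <= K' * enorm u.
    apply: le_trans (enorm_mulmx_le _ _) _; rewrite ler_wpM2r ?enorm_ge0 //.
    exact: le_trans (hA k) K_le.
  exact: lerD.
have symD i : (deviation A i)^T = deviation A i.
  apply/matrixP => k j; rewrite !mxE summxE [in RHS]summxE.
  rewrite -[A i in RHS]sA mxE; congr (_ - _ * _); apply: eq_bigr => z _.
  by rewrite -[A z in RHS]sA mxE.
rewrite -exponent; set E := expR _.
have -> : N%:R ^+ m * (2 * d%:R * E) = 2 * (N%:R ^+ m * d%:R) * E by ring.
apply: (moment_tail (Mo := fun p => \sum_s \tr (sample_sum (m := m) (deviation A) s ^+ (p + p))))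
  => //.
- by apply: sumr_ge0.
- rewrite -card_samples mulr_suml; apply: ler_sum => s _.
  by rewrite expr0 mul1r mxtrace1.
- move=> p; apply: matrix_moment_step => //; first by rewrite mulr_ge0 // ltW.
    exact: deviation_sum0.
- move=> p; rewrite mulr_suml; apply: ler_sum => s _.
  case: asboolP => h; first by rewrite mul1r.
  rewrite mul0r mxtrace_even_exp_ge0 // /sample_sum raddf_sum.
  by apply: eq_bigr => j _; apply: symD.
Qed.

End SampleTails.

Lemma sample_mean_deviation {R : realType} {N m : nat} {V : lmodType R}
  (A : 'I_N -> V) (s : {ffun 'I_m -> 'I_N}) : (0 < m)%N ->
  m%:R^-1 *: (\sum_(j < m) A (s j)) - N%:R^-1 *: (\sum_i A i) =
  m%:R^-1 *: sample_sum (deviation A) s.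
Proof.
move=> m0; rewrite /sample_sum /deviation sumrB sumr_const card_ord scalerBr.
by rewrite -[(N%:R^-1 *: _) *+ m]scaler_nat (scalerA _ m%:R) mulVf ?scale1r // pnatr_eq0 -lt0n.
Qed.

(** Connects the spectral norm with the event of [matrix_sample_tail]: one unit vector stretched by
    more than [r] bounds all even trace moments from below. *)
Lemma specnorm_gt_trace {R : realType} {d m : nat} (Y : 'M[R]_d) (r : R) :
  (0 < m)%N -> 0 <= r -> Y^T = Y -> r < specnorm (m%:R^-1 *: Y) ->
  forall p, (m%:R * r) ^+ (p + p) <= \tr (Y ^+ (p + p)).
Proof.
move=> m0 r0 sY h p.
have [u nu hu] := specnorm_gt r0 h.
apply: le_trans (enorm_mulmx_exp_le_trace p sY nu).
rewrite lerXn2r ?nnegrE ?enorm_ge0 ?mulr_ge0 //.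
move: hu; rewrite -scalemxAr enormZ ger0_norm ?invr_ge0 // => /ltW.
by rewrite ler_pdivlMl ?ltr0n.
Qed.

(** * Rayleigh quotients *)

Lemma continuous_sumr {R : realType} {T : topologicalType} (I : Type) (r : seq I)
  (F : I -> T -> R) : (forall i, continuous (F i)) ->
  continuous (fun x => \sum_(i <- r) F i x).
Proof.
move=> cF; elim: r => [|i r IH].
  by under eq_fun do rewrite big_nil; exact: cst_continuous.
under eq_fun do rewrite big_cons.
by move=> x; apply: continuousD; [exact: cF|exact: IH].
Qed.

Lemma continuous_dotp {R : realType} {T : topologicalType} {d : nat}
  (F G : T -> 'rV[R]_d) : (forall j, continuous (fun x => F x 0 j)) ->
  (forall j, continuous (fun x => G x 0 j)) -> continuous (fun x => dotp (F x) (G x)).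
Proof.
move=> cF cG; apply: continuous_sumr => j x.
by apply: continuousM; [exact: cF|exact: cG].
Qed.

Lemma continuous_mulmx_coord {R : realType} {d d' : nat} (A : 'M[R]_(d, d')) j :
  continuous (fun v : 'rV[R]_d => (v *m A) 0 j).
Proof.
have -> : (fun v : 'rV[R]_d => (v *m A) 0 j) = (fun v => \sum_i v 0 i * A i j).
  by apply/funext => v; rewrite mxE.
apply: continuous_sumr => i x.
by apply: continuousM; [exact: coord_continuous|exact: cst_continuous].
Qed.

Section Rayleigh.
Context {R : realType} {d : nat}.
Hypothesis d_gt0 : (0 < d)%N.
Implicit Types (A B : 'M[R]_d) (u v w : 'rV[R]_d).

Lemma compact_sphere : compact [set v : 'rV[R]_d | enorm v = 1].
Proof.
apply: bounded_closed_compact.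
  exists 1; split => [|M M1 v nv]; first exact: num_real.
  rewrite /= [`|v|]mx_normrE; apply: bigmax_le => [|[i j] _ /=]; first by apply: ltW (lt_trans ltr01 M1).
  by rewrite ord1 (le_trans (normr_coord_le_enorm _ _)) // nv ltW.
have -> : [set v : 'rV[R]_d | enorm v = 1] = (fun v => dotp v v) @^-1` [set 1].
  apply/seteqP; split => v /=; first by rewrite -enorm_sqr => ->; rewrite expr1n.
  by rewrite -enorm_sqr => /eqP; rewrite sqrf_eq1 => /orP[/eqP//|/eqP h]; have := enorm_ge0 v; rewrite h; lra.
apply: closed_comp; last exact: closed_eq.
by move=> x _; apply: continuous_dotp => j; exact: coord_continuous.
Qed.

Lemma quadratic_ge0_linear0 (b c : R) :
  (forall t, 0 <= 2 * b * t + c * t ^+ 2) -> b = 0.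
Proof.
move=> h; apply/eqP; apply/negPn/negP => b0.
have c1 : 0 < `|c| + 1 by rewrite ltr_wpDl.
(* This [t] suits either sign of [c]: the quadratic becomes a positive square times
   [c - 2 (|c| + 1)], which is negative. *)
have := h (- b / (`|c| + 1)).
have -> : 2 * b * (- b / (`|c| + 1)) + c * (- b / (`|c| + 1)) ^+ 2 =
   (b / (`|c| + 1)) ^+ 2 * (c - 2 * (`|c| + 1)) by field; rewrite gt_eqF.
rewrite pmulr_rge0; last by rewrite exprn_even_gt0 //= mulf_neq0 // invr_neq0 // gt_eqF.
by have := ler_norm c; have := normr_ge0 c; lra.
Qed.

(** First variation: after homogenization, [v + t u] is admissible for every [u] and [t], so the
    linear term in [t] vanishes. The residual [w] is then orthogonal to every vector, in particular
    to itself. *)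
Lemma qform_minimizer_eigen B v rho : B^T = B -> enorm v = 1 -> qform B v = rho ->
  (forall u, enorm u = 1 -> rho <= qform B u) -> v *m B = rho *: v.
Proof.
move=> sB nv qv hmin.
have hom u : rho * dotp u u <= dotp (u *m B) u.
  have [->|u0] := eqVneq u 0; first by rewrite mul0mx !dotp0l mulr0.
  have nu : 0 < enorm u by rewrite lt0r enorm_ge0 andbT; apply: contra_neq u0 => /enorm0_eq.
  have := hmin ((enorm u)^-1 *: u); rewrite enormZ gtr0_norm ?invr_gt0 // mulVf ?gt_eqF //.
  move=> /(_ erefl); rewrite qform_dotp -scalemxAl dotpZl dotpZr mulrA -expr2 exprVn -enorm_sqr.
  by rewrite ler_pdivlMl ?exprn_gt0 // mulrC.
pose w := v *m B - rho *: v.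
have vw : dotp (v *m B) v = rho * dotp v v by rewrite -qform_dotp -enorm_sqr nv expr1n mulr1.
have key u : dotp (v *m B) u - rho * dotp v u = 0.
  apply: (@quadratic_ge0_linear0 _ (dotp (u *m B) u - rho * dotp u u)) => t.
  have := hom (v + t *: u); rewrite -subr_ge0; congr (0 <= _).
  have uv : dotp (u *m B) v = dotp (v *m B) u by rewrite dotp_mulmxl sB dotpC.
  by rewrite mulmxDl -scalemxAl !dotpDl !dotpDr !dotpZl !dotpZr uv vw (dotpC u v); ring.
have : dotp w w = 0 by rewrite {1}/w dotpDl dotpNl dotpZl key.
rewrite -enorm_sqr => /eqP; rewrite expf_eq0 /= => /eqP/enorm0_eq/eqP.
by rewrite /w subr_eq0 => /eqP.
Qed.

Lemma eigenvalue_unit B a : eigenvalue B a -> exists2 v, enorm v = 1 & qform B v = a.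
Proof.
case/eigenvalueP => v vB v0.
have nv : 0 < enorm v by rewrite lt0r enorm_ge0 andbT; apply: contra_neq v0 => /enorm0_eq.
exists ((enorm v)^-1 *: v); first by rewrite enormZ gtr0_norm ?invr_gt0 // mulVf ?gt_eqF.
rewrite qform_dotp -scalemxAl vB !dotpZl !dotpZr -enorm_sqr.
by field; rewrite gt_eqF.
Qed.

(** A minimizer on the compact sphere is an eigenvector. Besides the variational bound, this makes
    the set whose infimum is [lambda_min] nonempty, so that the infimum is meaningful. *)
Lemma rayleigh_min B : B^T = B ->
  exists2 rho, eigenvalue B rho & forall u, enorm u = 1 -> rho <= qform B u.
Proof.
move=> sB.
have [|||c /set_mem/= nc hc] := @compact_EVT_min _ R (qform B) [set v | enorm v = 1].
- exists 'e_(Ordinal d_gt0) => /=.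
  apply/eqP; rewrite -(eqrXn2 (n := 2)) ?enorm_ge0 // enorm_sqr expr1n /dotp.
  rewrite (bigD1 (Ordinal d_gt0)) //= big1 => [|i i0]; first by rewrite !mxE !eqxx mulr1 addr0.
  by rewrite !mxE (negPf i0) andbF mulr0.
- exact: compact_sphere.
- apply: continuous_subspaceT; have -> : qform B = (fun v => dotp (v *m B) v).
    by apply/funext => v; rewrite qform_dotp.
  apply: continuous_dotp => j; [exact: continuous_mulmx_coord|exact: coord_continuous].
have hc' u : enorm u = 1 -> qform B c <= qform B u by move=> nu; apply: hc; exact/mem_set.
exists (qform B c) => //; apply/eigenvalueP; exists c.
  exact: qform_minimizer_eigen.
by apply/eqP => c0; move: nc; rewrite c0 enorm0 => /eqP; rewrite eq_sym oner_eq0.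
Qed.

Lemma eigenvalue_has_lbound B : has_lbound [set a : R | eigenvalue B a].
Proof.
exists (- specnorm B) => a /= /eigenvalue_unit[v nv <-].
by have := normr_qform_le B nv; rewrite ler_norml => /andP[].
Qed.

Lemma lambda_min_le_qform B u : B^T = B -> enorm u = 1 -> lambda_min B <= qform B u.
Proof.
move=> sB nu; have [rho erho h] := rayleigh_min sB.
by apply: le_trans (h u nu); apply: (ge_inf (eigenvalue_has_lbound B)).
Qed.

(** One half of Weyl's inequality: the quadratic form of [B] is compared with that of [A] at a unit
    eigenvector of [A]. *)
Lemma lambda_min_perturb A B : A^T = A -> B^T = B ->
  lambda_min B - specnorm (A - B) <= lambda_min A.
Proof.
move=> sA sB; have [rho erho h] := rayleigh_min sA.
apply: lb_le_inf; first by exists rho.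
move=> a /= /eigenvalue_unit[v nv <-].
have := lambda_min_le_qform sB nv.
have := normr_qform_le (A - B) nv; rewrite ler_norml => /andP[+ _].
rewrite !qform_dotp mulmxDr mulmxN dotpDl dotpNl; lra.
Qed.

End Rayleigh.

(** * Taylor bounds and symmetry of the Hessian *)

Lemma qformB {R : realType} {d : nat} (A B : 'M[R]_d) s :
  qform (A - B) s = qform A s - qform B s.
Proof. by rewrite !qform_dotp mulmxBr dotpDl dotpNl. Qed.

Lemma qform_le_specnorm {R : realType} {d : nat} (A : 'M[R]_d) s :
  qform A s <= specnorm A * enorm s ^+ 2.
Proof.
rewrite qform_dotp; apply: le_trans (dotp_le_enorm _ _) _.
by rewrite expr2 mulrA ler_wpM2r ?enorm_ge0 // enorm_mulmx_le.
Qed.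

Lemma normr_le_enorm {R : realType} {d : nat} (y : 'rV[R]_d) : `|y| <= enorm y.
Proof.
rewrite [`|y|]mx_normrE; apply: bigmax_le => [|[i j] _ /=]; first exact: enorm_ge0.
by rewrite ord1 normr_coord_le_enorm.
Qed.

Lemma enorm_le_normr {R : realType} {d : nat} (y : 'rV[R]_d) : enorm y <= d%:R * `|y|.
Proof.
apply: le_trans (enorm_le_sum_normr y) _.
apply: (@le_trans _ _ (\sum_(j < d) `|y|)); last by rewrite sumr_const card_ord mulr_natl.
apply: ler_sum => j _; rewrite [`|y|]mx_normrE.
exact: (@le_bigmax _ _ _ 0 (fun i : 'I_1 * 'I_d => `|y i.1 i.2|) (0, j)).
Qed.

Section AlongLines.
Context {R : realType} {d : nat}.
Implicit Types (f : 'rV[R]_d -> R) (x s h k : 'rV[R]_d).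

Lemma is_derive_line {W : normedModType R} (F : 'rV[R]_d -> W) x s (t : R) :
  derivable F (x + t *: s) s ->
  is_derive t (1 : R) (fun t : R => F (x + t *: s)) ('D_s F (x + t *: s)).
Proof.
move=> dF.
have E : (fun u : R => u^-1 *: (((fun t : R => F (x + t *: s)) \o shift t) (u *: (1 : R)) - F (x + t *: s))) =
   (fun u : R => u^-1 *: ((F \o shift (x + t *: s)) (u *: s) - F (x + t *: s))).
  apply/funext => u /=; congr (_ *: (F _ - _)).
  by rewrite /shift /= [u%:A]mulr1 scalerDl addrCA.
by split; rewrite /derivable /derive /= E.
Qed.

Lemma mvt_line (phi dphi : R -> R) (b : R) : 0 <= b ->
  (forall t : R, is_derive t (1 : R) phi (dphi t)) ->
  exists2 c, 0 <= c <= b & phi b - phi 0 = dphi c * b.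
Proof.
move=> b0 dp; have [|c] := @MVT_segment R phi dphi 0 b b0 (fun z _ => dp z).
  by apply: derivable_within_continuous => t _; apply: ex_derive; exact: dp.
by rewrite in_itv /= subr0 => hc e; exists c.
Qed.

(** The mean value theorem for [phi] minus a polynomial antiderivative of the bound; it replaces
    integration in both Taylor estimates. *)
Lemma le_of_derive_le (phi dphi : R -> R) (a0 a1 a2 b : R) : 0 <= b ->
  (forall t : R, is_derive t (1 : R) phi (dphi t)) ->
  (forall t : R, 0 <= t <= b -> dphi t <= a0 + a1 * t + a2 * t ^+ 2) ->
  phi b - phi 0 <= a0 * b + a1 / 2 * b ^+ 2 + a2 / 3 * b ^+ 3.
Proof.
move=> b0 dphi_ hle.
pose p : {poly R} := a0 *: 'X + (a1 / 2) *: 'X^2 + (a2 / 3) *: 'X^3.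
have pE t : p.[t] = a0 * t + a1 / 2 * t ^+ 2 + a2 / 3 * t ^+ 3.
  by rewrite /p !hornerD !hornerZ hornerX !hornerXn.
have dpE t : (p^`()).[t] = a0 + a1 * t + a2 * t ^+ 2.
  rewrite /p !derivD !derivZ derivX !derivXn !hornerD !hornerZ !hornerMn /= hornerX hornerXn hornerC.
  by rewrite -(mulr_natr t 2) -(mulr_natr _ 3); field.
have dd (t : R) : is_derive t (1 : R) (phi - horner p) (dphi t - (p^`()).[t]).
  by apply: is_deriveB.
have [c cb] := mvt_line b0 dd; rewrite !fctE => e.
have : (dphi c - p^`().[c]) * b <= 0 by rewrite mulr_le0_ge0 // subr_le0 dpE hle.
have p0 : p.[0] = 0 by rewrite pE; ring.
by rewrite -e p0 pE; lra.
Qed.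

Lemma derive_grad f x s : differentiable f x -> 'D_s f x = dotp (grad f x) s.
Proof.
move=> df; rewrite deriveE // {1}(row_sum_delta s) linear_sum.
by apply: eq_bigr => j _; rewrite linearZ /= mxE deriveE // mulrC.
Qed.

Lemma derive_grad_dotp f x s k : differentiable (grad f) x ->
  is_derive x s (fun y => dotp (grad f y) k) (dotp (s *m hess f x) k).
Proof.
move=> dg; rewrite /hess -deriveEjacobian //.
have dv : derivable (grad f) x s by exact: diff_derivable.
have E : (fun y => dotp (grad f y) k) = \sum_(j < d) (k 0 j *: (fun y => grad f y 0 j)).
  apply/funext => y; rewrite fct_sumE; apply: eq_bigr => j _ /=.
  by rewrite mulrC.
rewrite E; apply: is_derive_eq.
  apply: is_derive_sum => j; apply: is_deriveZ; apply: derivableP.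
  by move/derivable_mxP: dv; apply.
by apply: eq_bigr => j _; rewrite derive_mx // mxE /= [LHS]mulrC.
Qed.

Lemma is_derive_line_grad f x s (t : R) : (forall y, differentiable f y) ->
  is_derive t (1 : R) (fun t : R => f (x + t *: s)) (dotp (grad f (x + t *: s)) s).
Proof.
by move=> df; rewrite -derive_grad //; apply: is_derive_line; exact: diff_derivable.
Qed.

Lemma is_derive_line_hess f x s k (t : R) : (forall y, differentiable (grad f) y) ->
  is_derive t (1 : R) (fun t : R => dotp (grad f (x + t *: s)) k) (dotp (s *m hess f (x + t *: s)) k).
Proof.
move=> dg; have h := derive_grad_dotp s k (dg (x + t *: s)).
by case: h => hd hv; rewrite -hv; exact: is_derive_line.
Qed.

(** The Lipschitz bound is asked only between [x] and the points of the segment, because the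
    gradient is Lipschitz only on the points of interest. *)
Lemma taylor_grad_lipschitz f x s (L : R) : (forall y, differentiable f y) ->
  (forall t : R, 0 <= t <= 1 -> enorm (grad f (x + t *: s) - grad f x) <= L * enorm (t *: s)) ->
  f (x + s) - f x <= dotp (grad f x) s + L / 2 * enorm s ^+ 2.
Proof.
move=> df hL.
have := @le_of_derive_le (fun t : R => f (x + t *: s)) _ (dotp (grad f x) s)
  (L * enorm s ^+ 2) 0 1 ler01 (fun t => is_derive_line_grad x s t df).
rewrite scale1r scale0r addr0 => H; apply: le_trans (H _) _; last by lra.
move=> t /andP[t0 t1].
have := dotp_le_enorm (grad f (x + t *: s) - grad f x) s.
rewrite dotpDl dotpNl => h1; have := hL t; rewrite t0 t1 => /(_ isT).
rewrite enormZ ger0_norm // => h2.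
have := ler_wpM2r (enorm_ge0 s) h2; lra.
Qed.

Lemma taylor_hess_lipschitz f x s (M : R) : twice_differentiable f ->
  hessian_lipschitz M f ->
  f (x + s) - f x <= dotp (grad f x) s + qform (hess f x) s / 2 + M / 6 * enorm s ^+ 3.
Proof.
move=> [df dg] hM.
have aux (A B v n : R) : A - B <= M * v * n -> A <= B + M * n * v + 0 * v ^+ 2 by lra.
(* The Hessian bound is integrated once here, for the directional derivative along the segment, and
   once more below for [f]. *)
have grad_le t : 0 <= t -> dotp (grad f (x + t *: s)) s - dotp (grad f x) s <=
    qform (hess f x) s * t + M / 2 * enorm s ^+ 3 * t ^+ 2.
  move=> t0; have := @le_of_derive_le _ _ (qform (hess f x) s) (M * enorm s ^+ 3) 0 t t0
    (fun t => is_derive_line_hess x s s t dg).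
  rewrite scale0r addr0 => H; apply: le_trans (H _) _; last by lra.
  move=> u /andP[u0 ut]; rewrite -qform_dotp.
  have : qform (hess f (x + u *: s)) s - qform (hess f x) s <= M * u * enorm s ^+ 3.
    rewrite -qformB; apply: le_trans (qform_le_specnorm _ _) _.
    rewrite (exprS _ 2) mulrA ler_wpM2r ?exprn_ge0 ?enorm_ge0 //.
    apply: le_trans (hM _ _) _.
    by rewrite [x + _]addrC addrK enormZ ger0_norm // mulrA.
  exact: aux.
have := @le_of_derive_le (fun t : R => f (x + t *: s)) _ (dotp (grad f x) s)
  (qform (hess f x) s) (M / 2 * enorm s ^+ 3) 1 ler01 (fun t => is_derive_line_grad x s t df).
rewrite scale1r scale0r addr0 => H; apply: le_trans (H _) _; last by lra.
by move=> t /andP[t0 t1]; have := grad_le t t0; lra.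
Qed.

Lemma differentiable_grad_bound f x : differentiable (grad f) x ->
  forall e : R, 0 < e -> exists2 del : R, 0 < del & forall y, enorm y < del ->
  enorm (grad f (x + y) - grad f x - y *m hess f x) <= e * enorm y.
Proof.
move=> dg e e0.
(* The differential is controlled in the sup norm; returning to [enorm] costs a factor [d], and
   [d.+1] stays nonzero when [d = 0]. *)
have /eqaddoP/(_ (e / d.+1%:R)) := diff_locally dg.
rewrite divr_gt0 // => /(_ isT) /nbhs_ballP[del /= del0 H].
exists del => // y ydel; have := H y.
have yb : ball 0 del y.
  by rewrite -ball_normE /= sub0r normrN (le_lt_trans (normr_le_enorm y)).
have hE : 'd (grad f) x y = y *m hess f x by rewrite -deriveE // deriveEjacobian.
move=> /(_ yb) /=; rewrite !fctE /= hE [y + x]addrC => h.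
rewrite -addrA -opprD; apply: le_trans (enorm_le_normr _) _.
apply: (@le_trans _ _ (d%:R * (e / d.+1%:R * enorm y))).
  rewrite ler_wpM2l //; apply: le_trans h _.
  by rewrite ler_wpM2l ?normr_le_enorm // divr_ge0 // ltW.
rewrite mulrA ler_wpM2r ?enorm_ge0 // mulrCA ler_piMr ?(ltW e0) //.
by rewrite ler_pdivrMr // mul1r ler_nat.
Qed.

(* Both orders of differentiation are limits of the same second difference. *)
Lemma second_difference f x h k : twice_differentiable f ->
  forall e : R, 0 < e -> exists2 del : R, 0 < del & forall t : R, 0 < t -> t < del ->
  `|f (x + t *: k + t *: h) - f (x + t *: h) - f (x + t *: k) + f x
    - t ^+ 2 * dotp (k *m hess f x) h| <= 2 * e * t ^+ 2 * (enorm h + enorm k) ^+ 2.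
Proof.
move=> [df dg] e e0.
have [del0 del00 H] := differentiable_grad_bound (dg x) e0.
set S := enorm h + enorm k; have S0 : 0 <= S by rewrite addr_ge0 ?enorm_ge0.
have S1 : 0 < S + 1 by rewrite ltr_wpDl.
exists (del0 / (S + 1)); first by rewrite divr_gt0.
move=> t t0 tdel.
have tS : t * S < del0.
  have : t * (S + 1) < del0 by rewrite -ltr_pdivlMr.
  by apply: le_lt_trans; rewrite ler_wpM2l ?(ltW t0) // lerDl.
have dd (u : R) := is_deriveB (is_derive_line_grad (x + t *: k) (t *: h) u df)
  (is_derive_line_grad x (t *: h) u df).
(* The mean value theorem is applied to the difference of [f] along two parallel segments in
   direction [t h], one of them shifted by [t k]; two gradient values remain to be compared. *)
have [c /andP[c0 c1]] := mvt_line ler01 dd.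
rewrite !fctE /= !scale1r !scale0r !addr0 mulr1 => mv.
have -> : f (x + t *: k + t *: h) - f (x + t *: h) - f (x + t *: k) + f x =
   f (x + t *: k + t *: h) - f (x + t *: h) - (f (x + t *: k) - f x) by rewrite opprB addrA addrAC.
rewrite mv; set y1 := t *: k + c *: (t *: h); set y2 := c *: (t *: h).
have -> : x + t *: k + c *: (t *: h) = x + y1 by rewrite addrA.
have ny2 : enorm y2 <= t * enorm h.
  by rewrite /y2 !enormZ (ger0_norm c0) (gtr0_norm t0) ler_piMl // mulr_ge0 ?enorm_ge0 // ltW.
have ny1 : enorm y1 <= t * S.
  rewrite /y1 (le_trans (enormD _ _)) // /S mulrDr addrC.
  by apply: lerD; [exact: ny2|rewrite enormZ gtr0_norm].
have ny2' : enorm y2 <= t * S.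
  by apply: le_trans ny2 _; rewrite ler_wpM2l ?(ltW t0) // lerDl enorm_ge0.
have b1 := H y1 (le_lt_trans ny1 tS); have b2 := H y2 (le_lt_trans ny2' tS).
set r1 := grad f (x + y1) - _ - _ in b1; set r2 := grad f (x + y2) - _ - _ in b2.
have e12 : grad f (x + y1) - grad f (x + y2) = t *: (k *m hess f x) + (r1 - r2).
  have -> : t *: (k *m hess f x) = y1 *m hess f x - y2 *m hess f x.
    by rewrite -mulmxBl /y1 /y2 addrK scalemxAl.
  rewrite /r1 /r2; move: (grad f (x + y1)) (grad f (x + y2)) (grad f x) (y1 *m _) (y2 *m _).
  by move=> a b c' d1 d2; rewrite !opprD !opprK; apply/matrixP => i j; rewrite !mxE; ring.
rewrite -dotpNl -dotpDl e12 dotpDl dotpZl !dotpZr.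
rewrite [X in `|X|](_ : _ = t * dotp (r1 - r2) h); last by ring.
rewrite normrM (gtr0_norm t0).
have r12 : enorm (r1 - r2) <= 2 * e * t * S.
  apply: le_trans (enormB _ _) _.
  have h1 : e * enorm y1 <= e * (t * S) by rewrite ler_wpM2l // ltW.
  have h2 : e * enorm y2 <= e * (t * S) by rewrite ler_wpM2l // ltW.
  by lra.
have hS : enorm h <= S by rewrite lerDl enorm_ge0.
apply: (@le_trans _ _ (t * (2 * e * t * S * S))); last by apply: eq_ler; ring.
rewrite ler_wpM2l ?(ltW t0) //; apply: le_trans (normr_dotp_le _ _) _.
by apply: ler_pM; rewrite ?enorm_ge0.
Qed.

(** Young's form of the symmetry theorem, from differentiability of the gradient: the second
    difference is unchanged when [h] and [k] are exchanged, so its two limits agree. *)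
Lemma hess_sym f x : twice_differentiable f -> (hess f x)^T = hess f x.
Proof.
move=> hf.
have key h k : dotp (k *m hess f x) h = dotp (h *m hess f x) k.
  set a := dotp _ _; set b := dotp _ _; set S := enorm h + enorm k.
  have S0 : 0 <= S by rewrite addr_ge0 ?enorm_ge0.
  apply/eqP; rewrite -subr_eq0 -normr_le0; apply/ler_addgt0Pr => e e0; rewrite add0r.
  (* Two errors of size [2 e' t^2 S^2] must add up to at most [e t^2]; the [+ 1] covers [S = 0]. *)
  pose e' := e / (4 * (S ^+ 2 + 1)).
  have S21 : 0 < S ^+ 2 + 1 by rewrite ltr_wpDl // sqr_ge0.
  have e'0 : 0 < e' by rewrite divr_gt0 // mulr_gt0.
  have [d1 d10 H1] := second_difference x h k hf e'0.
  have [d2 d20 H2] := second_difference x k h hf e'0.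
  pose t := Num.min d1 d2 / 2.
  have m0 : 0 < Num.min d1 d2 by rewrite lt_min d10.
  have t0 : 0 < t by rewrite divr_gt0.
  have tm : t < Num.min d1 d2 by rewrite /t ltr_pdivrMr // mulr_natr mulr2n ltrDl.
  have td1 : t < d1 by apply: lt_le_trans tm _; rewrite ge_min lexx.
  have td2 : t < d2 by apply: lt_le_trans tm _; rewrite ge_min lexx orbT.
  have := H1 t t0 td1; have := H2 t t0 td2; rewrite -/a -/b -/S [enorm k + _]addrC -/S.
  rewrite [x + t *: h + t *: k]addrAC.
  set X := f _ - f _ - f _ + _; set Y := f _ - f _ - f _ + _.
  have -> : X = Y by rewrite /X /Y; ring.
  rewrite !ler_norml => /andP[q1 q2] /andP[q3 q4].
  have t2 : 0 < t ^+ 2 by rewrite exprn_gt0.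
  have eS : 4 * e' * S ^+ 2 <= e.
    have -> : 4 * e' * S ^+ 2 = e * (S ^+ 2 / (S ^+ 2 + 1)) by rewrite /e'; field; rewrite gt_eqF.
    by rewrite ler_piMr ?(ltW e0) // ler_pdivrMr // mul1r lerDl.
  have h4 := ler_wpM2l (ltW t2) eS.
  by apply/andP; split; rewrite -(ler_pM2l t2); lra.
apply/matrixP => i j; rewrite mxE.
have ej (A : 'M[R]_d) a b : dotp ('e_a *m A) 'e_b = A a b.
  rewrite -rowE /dotp (bigD1 b) //= big1 ?addr0 => [|z zb]; first by rewrite !mxE !eqxx mulr1.
  by rewrite !mxE (negPf zb) andbF mulr0.
by rewrite -!ej key.
Qed.

End AlongLines.

(** * Finite-sum objectives and Borel measurability *)

Lemma mulmx_hess {R : realType} {d : nat} (f : 'rV[R]_d -> R) x v :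
  differentiable (grad f) x -> v *m hess f x = 'D_v (grad f) x.
Proof. by move=> dg; rewrite deriveEjacobian. Qed.

Lemma countable_bigcup_measurable d (T : measurableType d) (I : countType) (P : set I)
  (F : I -> set T) : (forall i, measurable (F i)) -> measurable (\bigcup_(i in P) F i).
Proof.
move=> mF; rewrite bigcup_mkcond; apply: countable_bigcupT_measurable => [|i].
  exact: countableP.
by case: ifP.
Qed.

Section ObjectiveAverage.
Context {R : realType} {N d : nat}.
Variable S : problem R N d.
Hypothesis hf : forall i, twice_differentiable (fcomp S i).

Lemma objectiveE : objective S = N%:R^-1 \*: (\sum_(i < N) fcomp S i).
Proof. by apply/funext => x; rewrite /objective /= fct_sumE. Qed.

Lemma differentiable_objective x : differentiable (objective S) x.
Proof.
rewrite objectiveE; apply: differentiableZ; apply: differentiable_sum => i.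
exact: (hf i).1.
Qed.

Lemma grad_objective x : grad (objective S) x = N%:R^-1 *: \sum_i grad (fcomp S i) x.
Proof.
apply/rowP => j; rewrite !mxE summxE objectiveE.
have dv i : derivable (fcomp S i) x 'e_j by apply: diff_derivable; exact: (hf i).1.
rewrite deriveZ ?derive_sum //; last by apply: derivable_sum.
by congr (_ * _); apply: eq_bigr => i _; rewrite mxE.
Qed.

Lemma grad_objectiveE : grad (objective S) = N%:R^-1 \*: (\sum_(i < N) grad (fcomp S i)).
Proof. by apply/funext => x; rewrite grad_objective /= fct_sumE. Qed.

Lemma twice_differentiable_objective : twice_differentiable (objective S).
Proof.
split=> x; first exact: differentiable_objective.
rewrite grad_objectiveE; apply: differentiableZ; apply: differentiable_sum => i.
exact: (hf i).2.
Qed.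

Lemma hess_objective x : hess (objective S) x = N%:R^-1 *: \sum_i hess (fcomp S i) x.
Proof.
apply/row_matrixP => a; rewrite !rowE -scalemxAr mulmx_sumr.
have dg : differentiable (grad (objective S)) x by case: twice_differentiable_objective.
transitivity ('D_('e_a) (grad (objective S)) x); first exact: mulmx_hess.
have dv i : derivable (grad (fcomp S i)) x 'e_a by apply: diff_derivable; exact: (hf i).2.
rewrite grad_objectiveE deriveZ ?derive_sum //; last by apply: derivable_sum.
by congr (_ *: _); apply: eq_bigr => i _; rewrite (mulmx_hess _ ((hf i).2 x)).
Qed.

End ObjectiveAverage.

(** * Borel measurability of matrix-valued maps *)

Section MeasurabilityTools.
Context {R : realType}.

Lemma measurable_fun_opens d (T : measurableType d) (F : T -> R) :
  (forall U : set R, open U -> measurable (F @^-1` U)) -> measurable_fun setT F.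
Proof.
move=> h; apply: (measurability _ (RGenOpens.measurableE R)).
by move=> _ [_ [a [b ->] <-]]; rewrite setTI; apply: h; exact: interval_open.
Qed.

Lemma borel_fun_measurable n (F : 'rV[R]_n -> R) :
  borel_fun F -> measurable_fun setT (F : g_sigma_algebraType (@open 'rV[R]_n) -> R).
Proof. by move=> h; apply: measurable_fun_opens => U oU; exact: h. Qed.

Lemma continuous_borel_measurable n (F : 'rV[R]_n -> R) :
  continuous F -> measurable_fun setT (F : g_sigma_algebraType (@open 'rV[R]_n) -> R).
Proof.
move=> cF; apply: measurable_fun_opens => U oU; apply: sub_sigma_algebra.
by apply: open_comp => // x _; exact: cF.
Qed.

(** Second countability with an explicit base of rational boxes; it reduces measurability of a
    matrix-valued map to that of its entries. *)
Lemma open_rational_balls m n (U : set 'M[R]_(m, n)) : open U ->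
  U = \bigcup_(p in [set p : 'M[rat]_(m, n) * nat |
         [set A : 'M[R]_(m, n) | forall i j, `|A i j - ratr (p.1 i j)| < p.2.+1%:R^-1] `<=` U])
       [set A | forall i j, `|A i j - ratr (p.1 i j)| < p.2.+1%:R^-1].
Proof.
move=> oU; apply/seteqP; split => A; last by case=> p /= hp hA; exact: hp.
move=> UA; have /nbhs_ballP[e /= e0 he] : nbhs A U by exact: open_nbhs_nbhs.
(* A box of radius [1/(k+1)] that contains [A] lies within distance [2/(k+1)] of [A]. *)
have [k hk] : exists k : nat, 2 * k.+1%:R^-1 < e.
  have /cvgrPdist_lt/(_ (e / 2)) := @cvg_harmonic R.
  rewrite divr_gt0 // => /(_ isT)[k _ /(_ k (leqnn k))]/=.
  rewrite sub0r normrN gtr0_norm ?invr_gt0 // => h; exists k.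
  by rewrite mulrC -ltr_pdivlMr.
have k0 : 0 < k.+1%:R^-1 :> R by rewrite invr_gt0.
have hq i j : exists q : rat, `|A i j - ratr q| < k.+1%:R^-1.
  move: k.+1%:R^-1 k0 => r r0.
  have [q] := @rat_in_itvoo R (A i j - r) (A i j + r) ltac:(lra).
  rewrite in_itv /= => /andP[q1 q2]; exists q; rewrite ltr_norml; apply/andP; split; lra.
pose Q : 'M[rat]_(m, n) := \matrix_(i, j) projT1 (cid (hq i j)).
have hQ i j : `|A i j - ratr (Q i j)| < k.+1%:R^-1 by rewrite mxE; case: cid.
exists (Q, k) => //= B hB; apply: he; rewrite -ball_normE /=.
rewrite [`|_|]mx_normrE; apply: bigmax_lt => // -[i j] _ /=; rewrite !mxE.
rewrite -(subrKA (ratr (Q i j))) (le_lt_trans (ler_normD _ _)) //.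
apply: lt_trans hk; rewrite mulr2n mulrDl mul1r; apply: ltrD => //.
by rewrite distrC.
Qed.

Lemma measurable_mx d (T : measurableType d) m n (X : T -> 'M[R]_(m, n)) :
  (forall i j, measurable_fun setT (fun w => X w i j)) ->
  forall U, open U -> measurable (X @^-1` U).
Proof.
move=> mX U oU; rewrite (open_rational_balls oU) preimage_bigcup.
apply: countable_bigcup_measurable => p.
have -> : X @^-1` [set A | forall i j, `|A i j - ratr (p.1 i j)| < p.2.+1%:R^-1] =
    \bigcap_(ij in [set: 'I_m * 'I_n]) ((fun w => `|X w ij.1 ij.2 - ratr (p.1 ij.1 ij.2)|) @^-1` `]-oo, p.2.+1%:R^-1[%classic).
  apply/seteqP; split => w /= hw; first by move=> [i j] _ /=; rewrite in_itv /= hw.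
  by move=> i j; have := hw (i, j) I; rewrite /= in_itv.
apply: fin_bigcap_measurable => // -[i j] _ /=.
rewrite -[X in measurable X]setTI; apply: measurableT_comp => //.
by apply: measurable_funB.
Qed.

Lemma measurable_borel_comp d (T : measurableType d) n (X : T -> 'rV[R]_n) :
  (forall U, open U -> measurable (X @^-1` U)) ->
  measurable_fun setT (X : T -> g_sigma_algebraType (@open 'rV[R]_n)).
Proof.
move=> h; apply: (@measurability _ _ T (g_sigma_algebraType (@open 'rV[R]_n)) setT X (@open 'rV[R]_n)) => //.
by move=> _ [U oU <-]; rewrite setTI; exact: h.
Qed.

Lemma continuous_measurable_comp d (T : measurableType d) m n (X : T -> 'M[R]_(m, n))
   (F : 'M[R]_(m, n) -> R) :
  (forall U, open U -> measurable (X @^-1` U)) -> continuous F ->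
  measurable_fun setT (fun w => F (X w)).
Proof.
move=> h cF; apply: measurable_fun_opens => U oU; apply: (h (F @^-1` U)).
by apply: open_comp => // x _; exact: cF.
Qed.

Lemma measurable_sumr d (T : measurableType d) I (r : seq I) (F : I -> T -> R) :
  (forall i, measurable_fun setT (F i)) -> measurable_fun setT (fun w => \sum_(i <- r) F i w).
Proof. by move=> mF; exact: measurable_sum. Qed.

(* A function that is given by countably many measurable pieces, selected by
   a measurable key. *)
Lemma measurable_fun_key d (T : measurableType d) d' (T' : measurableType d') (I : countType) (key : T -> I)
  (F : I -> T -> T') :
  (forall i, measurable [set w | key w = i]) -> (forall i, measurable_fun setT (F i)) ->
  measurable_fun setT (fun w => F (key w) w).
Proof.
move=> mk mF _ A mA; rewrite setTI.
have -> : (fun w => F (key w) w) @^-1` A =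
    \bigcup_(i in [set: I]) ([set w | key w = i] `&` F i @^-1` A).
  apply/seteqP; split => [w wA|w [i _ [/= <-]]//].
  by exists (key w).
apply: countable_bigcup_measurable => i.
by apply: measurableI => //; rewrite -[X in measurable X]setTI; exact: mF.
Qed.

Lemma continuous_grad_coord n (f : 'rV[R]_n -> R) j : twice_differentiable f ->
  continuous (fun x => grad f x 0 j).
Proof.
move=> [_ dg] x; apply: (@continuous_comp _ _ _ (grad f) (fun y : 'rV[R]_n => y 0 j)); last exact: coord_continuous.
exact: differentiable_continuous.
Qed.

(** Twice differentiability does not make the Hessian continuous. Its entries are nevertheless
    pointwise limits of difference quotients of the gradient, which are continuous. *)
Lemma measurable_hess_coord n (f : 'rV[R]_n -> R) i j : twice_differentiable f ->
  measurable_fun setT ((fun x => hess f x i j) : g_sigma_algebraType (@open 'rV[R]_n) -> R).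
Proof.
move=> hf.
pose q (k : nat) (x : 'rV[R]_n) := k.+1%:R * (grad f (x + k.+1%:R^-1 *: 'e_i) 0 j - grad f x 0 j).
have cq k : continuous (q k).
  have -> : q k = cst k.+1%:R \* ((fun y => grad f y 0 j) \o (id \+ cst (k.+1%:R^-1 *: 'e_i))
      \- (fun y => grad f y 0 j)) by [].
  move=> x; apply: continuousM; first exact: cst_continuous.
  apply: continuousB; last exact: continuous_grad_coord.
  apply: continuous_comp; last exact: continuous_grad_coord.
  by apply: continuousD; [exact: cvg_id|exact: cst_continuous].
apply: (@measurable_fun_cvg _ (g_sigma_algebraType (@open 'rV[R]_n)) R setT (q : nat -> g_sigma_algebraType _ -> R)).
  by move=> k; apply: continuous_borel_measurable.
move=> x _; apply/cvgrPdist_le => e e0.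
have [del del0 H] := differentiable_grad_bound (hf.2 x) e0.
have /cvgrPdist_lt/(_ del del0)[k0 _ hk0] := @cvg_harmonic R.
exists k0 => // k /hk0 /=; rewrite sub0r normrN gtr0_norm ?invr_gt0 // => hk.
have ne : enorm ('e_i : 'rV[R]_n) = 1.
  apply/eqP; rewrite -(eqrXn2 (n := 2)) ?enorm_ge0 // enorm_sqr expr1n /dotp.
  rewrite (bigD1 i) //= big1 => [|z zi]; first by rewrite !mxE !eqxx mulr1 addr0.
  by rewrite !mxE (negPf zi) andbF mulr0.
have ny : enorm (k.+1%:R^-1 *: 'e_i : 'rV[R]_n) = k.+1%:R^-1.
  by rewrite enormZ ne mulr1 gtr0_norm // invr_gt0.
have := H (k.+1%:R^-1 *: 'e_i); rewrite ny => /(_ hk) h.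
have := le_trans (normr_coord_le_enorm _ j) h.
have coordB (A B C : 'rV[R]_n) (r : R) : (A - B - r *: C) 0 j = A 0 j - B 0 j - r * C 0 j.
  by rewrite !mxE.
rewrite -scalemxAl -rowE coordB [row _ _ _ _]mxE /q => h2.
have kp : 0 < k.+1%:R :> R by [].
move: (grad f _ 0 j - _) h2 => D h2.
have -> : hess f x i j - k.+1%:R * D = - (k.+1%:R * (D - k.+1%:R^-1 * hess f x i j)).
  by rewrite mulrBr mulrA mulfV ?gt_eqF // mul1r opprB.
rewrite normrN normrM (gtr0_norm kp) -(ler_pdivlMl _ _ kp) [leRHS]mulrC; exact: h2.
Qed.

End MeasurabilityTools.

(** * Measurability of the iterates *)

Section BatchSize.
Context {R : realType}.
Implicit Type b : R.

Lemma batch_size_gt0 b : (0 < batch_size b)%N.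
Proof. by rewrite absz_gt0 gt_eqF // (lt_le_trans (y := 1)) // le_max lexx. Qed.

Lemma batch_size_le b m : (0 < m)%N -> (batch_size b <= m)%N = (b <= m%:R).
Proof.
move=> m0; rewrite -lez_nat gez0_abs; last first.
  by rewrite le_max ler01.
rewrite ge_max ceil_le_int lez_nat m0 /=; congr (_ <= _).
Qed.

Lemma batch_size_ge b : b <= (batch_size b)%:R.
Proof. by rewrite -batch_size_le // batch_size_gt0. Qed.

Lemma batch_size_lt b : (batch_size b)%:R <= 2 + Num.max 0 b.
Proof.
have [b1|b1] := leP b 1.
  have : (batch_size b <= 1)%N by rewrite batch_size_le.
  rewrite -(ler_nat R) => h; apply: le_trans h _.
  by rewrite -[leLHS]addr0 lerD ?le_max ?lexx // ler_nat.
rewrite leNgt; apply/negP => h.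
have m1 : (0 < (batch_size b).-1)%N.
  have : 2 < (batch_size b)%:R :> R.
    by apply: le_lt_trans h; rewrite lerDl le_max lexx.
  by rewrite ltr_nat; case: (batch_size b) => [|[]].
have : (batch_size b <= (batch_size b).-1)%N.
  rewrite batch_size_le //.
  have e : (batch_size b)%:R = (batch_size b).-1%:R + 1 :> R.
    by rewrite natr1 prednK // batch_size_gt0.
  have : b <= Num.max 0 b by rewrite le_max lexx orbT.
  move: h; rewrite e; lra.
by rewrite leqNgt ltn_predL batch_size_gt0.
Qed.

End BatchSize.

Section MeasurableMatrices.
Context {R : realType} {d : measure_display} {T : measurableType d}.

Lemma measurable_le_set (f g : T -> R) : measurable_fun setT f -> measurable_fun setT g ->
  measurable [set w | f w <= g w].
Proof.
move=> mf mg; have := measurable_fun_ler mf mg => /(_ measurableT [set true]).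
by rewrite setTI; apply.
Qed.

Lemma measurable_mulmx_coord m n p (A : T -> 'M[R]_(m, n)) (B : T -> 'M[R]_(n, p)) :
  (forall i j, measurable_fun setT (fun w => A w i j)) ->
  (forall i j, measurable_fun setT (fun w => B w i j)) ->
  forall i j, measurable_fun setT (fun w => (A w *m B w) i j).
Proof.
move=> mA mB i j; under eq_fun do rewrite mxE.
by apply: measurable_sumr => k; apply: measurable_funM.
Qed.

Lemma measurable_dotp n (u v : T -> 'rV[R]_n) :
  (forall i j, measurable_fun setT (fun w => u w i j)) ->
  (forall i j, measurable_fun setT (fun w => v w i j)) ->
  measurable_fun setT (fun w => dotp (u w) (v w)).
Proof. by move=> mu mv; apply: measurable_sumr => j; apply: measurable_funM. Qed.

Lemma measurable_enorm n (u : T -> 'rV[R]_n) :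
  (forall i j, measurable_fun setT (fun w => u w i j)) ->
  measurable_fun setT (fun w => enorm (u w)).
Proof.
move=> mu; apply: (@measurableT_comp _ _ _ _ _ _ (@Num.sqrt R)).
  by apply: continuous_measurable_fun; exact: sqrt_continuous.
by apply: measurable_sumr => j; apply: measurable_funX.
Qed.

Lemma measurable_qform n (A : T -> 'M[R]_n) (u : T -> 'rV[R]_n) :
  (forall i j, measurable_fun setT (fun w => A w i j)) ->
  (forall i j, measurable_fun setT (fun w => u w i j)) ->
  measurable_fun setT (fun w => qform (A w) (u w)).
Proof.
move=> mA mu; under eq_fun do rewrite qform_dotp.
by apply: measurable_dotp => //; apply: measurable_mulmx_coord.
Qed.

Lemma measurable_mxtrace_exp n (A : T -> 'M[R]_n) p :
  (forall i j, measurable_fun setT (fun w => A w i j)) ->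
  measurable_fun setT (fun w => \tr (A w ^+ p)).
Proof.
move=> mA.
suff mE i j : measurable_fun setT (fun w => (A w ^+ p) i j) by exact: measurable_sumr.
elim: p i j => [|p IH] i j.
  by under eq_fun do rewrite expr0; exact: measurable_cst.
by under eq_fun do rewrite exprS -mulmxE; apply: measurable_mulmx_coord.
Qed.

(** The number of summands is random. The list of drawn indices serves as a key in a countable type;
    once it is fixed, a finite sum of fixed component functions remains. *)
Lemma measurable_sampled_mean n m m' N (x : T -> 'rV[R]_n) (F : 'I_N -> 'rV[R]_n -> 'M[R]_(m, m'))
  (sz : 'rV[R]_n -> nat) (idx : nat -> T -> 'I_N) :
  (forall U, open U -> measurable (x @^-1` U)) ->
  (forall k, <<s @open 'rV[R]_n >> [set y | sz y = k]) ->
  (forall a i j, measurable_fun setT ((fun y => F a y i j) : g_sigma_algebraType (@open 'rV[R]_n) -> R)) ->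
  (forall k a, measurable [set w | idx k w = a]) ->
  forall i j, measurable_fun setT (fun w =>
    ((sz (x w))%:R^-1 *: \sum_(k < sz (x w)) F (idx k w) (x w)) i j).
Proof.
move=> mx msz mF midx i j.
have mxB := measurable_borel_comp mx.
pose key w := mkseq (fun k => idx k w) (sz (x w)).
pose Phi (s : seq 'I_N) w := ((size s)%:R^-1 *: \sum_(a <- s) F a (x w)) i j.
have -> : (fun w => ((sz (x w))%:R^-1 *: \sum_(k < sz (x w)) F (idx k w) (x w)) i j) =
   (fun w => Phi (key w) w).
  by apply/funext => w; rewrite /Phi /key size_mkseq big_map -(big_mkord xpredT (fun k => F (idx k w) (x w))) /index_iota subn0.
apply: measurable_fun_key => s.
  have -> : [set w | key w = s] = (x @^-1` [set y | sz y = size s]) `&`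
      \bigcap_(k in [set k | (k < size s)%N]) [set w | Some (idx k w) = onth s k].
    apply/seteqP; split => w /=.
      move=> <-; rewrite size_mkseq; split => // k /= ks.
      by rewrite onthE (nth_map (idx 0%N w)) ?size_mkseq // nth_mkseq.
    move=> [e h]; apply: (@eq_from_nth _ (idx 0%N w)); rewrite size_mkseq // => k ks.
    by rewrite nth_mkseq //; apply/esym/onth_nth; rewrite -h // -e.
  apply: measurableI.
    by rewrite -[X in measurable X]setTI; apply: mxB => //; exact: msz.
  apply: bigcap_measurableType => k ks.
  case: (onth s k) => [a|].
    by have := midx k a; congr (measurable _); apply/seteqP; split => w /= => [->//|[]].
  by have := @measurable0 _ T; congr (measurable _); apply/seteqP; split.
have -> : Phi s = (fun w => (size s)%:R^-1 * \sum_(a <- s) F a (x w) i j).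
  by apply/funext => w; rewrite /Phi mxE summxE.
apply: measurable_funM; first exact: measurable_cst.
apply: measurable_sumr => a.
exact: (measurableT_comp (mF a i j) mxB).
Qed.

End MeasurableMatrices.

Lemma measurable_size_eq {d : measure_display} {T : measurableType d} (sz : T -> nat) :
  (forall x, (0 < sz x)%N) ->
  (forall m, (0 < m)%N -> measurable [set x | (sz x <= m)%N]) ->
  forall m, measurable [set x | sz x = m].
Proof.
move=> sz0 msz [|[|m]].
- have -> : [set x | sz x = 0%N] = set0 by apply/seteqP; split => x //= h; have := sz0 x; rewrite h.
  exact: measurable0.
- have := msz 1%N isT; congr (measurable _); apply/seteqP; split => x /= h; last by rewrite h.
  by apply/eqP; rewrite eqn_leq h sz0.
- have -> : [set x | sz x = m.+2] = [set x | (sz x <= m.+2)%N] `\` [set x | (sz x <= m.+1)%N].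
    apply/seteqP; split => x /=; first by move=> ->; rewrite leqnn ltnn.
    by case=> h /negP; rewrite -ltnNge => h'; apply/eqP; rewrite eqn_leq h h'.
  by apply: measurableD; exact: msz.
Qed.

Section ProcessMeasurability.
Context {R : realType} {N d : nat} {dO : measure_display} {Omega : measurableType dO}.
Variables (S : problem R N d) (O : inputs R N d Omega).
Hypothesis eg_gt0 : 0 < epsg S.
Hypothesis hf : forall i, twice_differentiable (fcomp S i).
Hypotheses (hGm : borel_fun (Gbd S)) (hKm : borel_fun (Kbd S)).
Hypothesis hmeas : measurable_inputs O.

Local Notation borelV := (g_sigma_algebraType (@open 'rV[R]_d)).

Lemma measurable_grad_coord (f : 'rV[R]_d -> R) i j : twice_differentiable f ->
  measurable_fun setT ((fun x => grad f x i j) : borelV -> R).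
Proof.
move=> h; rewrite ord1; apply: continuous_borel_measurable; exact: continuous_grad_coord.
Qed.

Lemma measurable_max_grad :
  measurable_fun setT ((fun x => Num.max (epsg S) (enorm (grad (objective S) x))) : borelV -> R).
Proof.
apply: measurable_maxr; first exact: measurable_cst.
apply: measurable_enorm => i j; apply: measurable_grad_coord.
exact: twice_differentiable_objective.
Qed.

Lemma measurable_size_g m : measurable ([set x | size_g S x = m] : set borelV).
Proof.
apply: (@measurable_size_eq _ borelV (size_g S)) => [x|{}m m0]; first exact: batch_size_gt0.
have -> : [set x | (size_g S x <= m)%N] = [set x : borelV | 256 * Gbd S x ^+ 2 * ln (xi S)^-1
     <= m%:R * Num.max (epsg S) (enorm (grad (objective S) x)) ^+ 2].
  apply/funext => x; apply/propext => /=; rewrite batch_size_le //.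
  set mx := Num.max _ _; have mx0 : 0 < mx ^+ 2 by rewrite exprn_gt0 // lt_max eg_gt0.
  rewrite expr_div_n mulrA.
  by rewrite mulrAC ler_pdivrMr.
apply: measurable_le_set; apply: measurable_funM => //; try exact: measurable_cst.
  apply: measurable_funM; first exact: measurable_cst.
  by apply: measurable_funX; exact: borel_fun_measurable.
by apply: measurable_funX; exact: measurable_max_grad.
Qed.

Lemma measurable_size_H m : measurable ([set x | size_H S x = m] : set borelV).
Proof.
apply: (@measurable_size_eq _ borelV (size_H S)) => [x|{}m m0]; first exact: batch_size_gt0.
have -> : [set x | (size_H S x <= m)%N] =
    [set x : borelV | 484 * (Kbd S x * (epsH S)^-1) ^+ 2 * ln (2 * d%:R / xi S) <= m%:R].
  by apply/seteqP; split => x /=; rewrite batch_size_le.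
apply: measurable_le_set; last exact: measurable_cst.
apply: measurable_funM; last exact: measurable_cst.
apply: measurable_funM; first exact: measurable_cst.
apply: measurable_funX; apply: measurable_funM; last exact: measurable_cst.
exact: borel_fun_measurable.
Qed.

Definition open_measurable_map (T : topologicalType) (X : Omega -> T) :=
  forall U, open U -> measurable (X @^-1` U).

Lemma open_measurable_coord m n (X : Omega -> 'M[R]_(m, n)) : open_measurable_map X ->
  forall i j, measurable_fun setT (fun w => X w i j).
Proof.
by move=> h i j; apply: (continuous_measurable_comp (F := fun A => A i j) h); exact: coord_continuous.
Qed.

Lemma measurable_gk_coord k : open_measurable_map (xk S O k) ->
  forall i j, measurable_fun setT (fun w => gk S O k w i j).
Proof.
case: hmeas => mg _ _ _ mx; apply: (measurable_sampled_mean (sz := size_g S)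
   (F := fun a y => grad (fcomp S a) y) (idx := idxg O k) mx).
- exact: measurable_size_g.
- by move=> a i j; exact: measurable_grad_coord.
- exact: mg.
Qed.

Lemma measurable_Hk_coord k : open_measurable_map (xk S O k) ->
  forall i j, measurable_fun setT (fun w => Hk S O k w i j).
Proof.
case: hmeas => _ mg _ _ mx; apply: (measurable_sampled_mean (sz := size_H S)
   (F := fun a y => hess (fcomp S a) y) (idx := idxH O k) mx).
- exact: measurable_size_H.
- by move=> a i j; exact: measurable_hess_coord.
- exact: mg.
Qed.

Lemma measurable_phat k : open_measurable_map (phat O k).
Proof. by case: hmeas => _ _ _ mp U oU; apply: (mp k); exists U. Qed.

Lemma measurable_sgn k : measurable_fun setT (sgn O k).
Proof.
case: hmeas => _ _ ms _; apply: (measurable_fun_bool true).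
by rewrite setTI; exact: (ms k true).
Qed.

Lemma measurable_lamk k : open_measurable_map (xk S O k) ->
  measurable_fun setT (lamk S O k).
Proof.
move=> mx; apply: measurable_qform; first exact: measurable_Hk_coord.
exact/open_measurable_coord/measurable_phat.
Qed.

Lemma measurable_xk k : open_measurable_map (xk S O k).
Proof.
elim: k => [|k IH].
  by apply: measurable_mx => i j; exact: measurable_cst.
apply: measurable_mx => i j.
have mg := measurable_gk_coord IH; have mlam := measurable_lamk IH.
have mp := open_measurable_coord (measurable_phat k).
have mxc := open_measurable_coord IH.
have -> : (fun w => xk S O k.+1 w i j) = (fun w =>
   if epsg S < enorm (gk S O k w) then xk S O k w i j - (Lg S)^-1 * gk S O k w i j
   else if lamk S O k w < - epsH S then
     xk S O k w i j + (if sgn O k w then - (2 * epsH S / Mh S) else 2 * epsH S / Mh S) * phat O k w i j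
   else xk S O k w i j).
  apply/funext => w /=; rewrite /next_iterate -/(gk S O k w) -/(Hk S O k w) -/(lamk S O k w).
  case: ifP => _; first by rewrite !mxE.
  case: ifP => _ //; rewrite !mxE; congr (_ + _ * _).
  by case: (sgn O k w); rewrite ?expr1 ?expr0 ?mulr1 // mulrN1.
apply: measurable_fun_ifT.
- by apply: measurable_fun_ltr; [exact: measurable_cst|exact: measurable_enorm].
- by apply: measurable_funB => //; apply: measurable_funM => //; exact: measurable_cst.
- apply: measurable_fun_ifT => //.
    by apply: measurable_fun_ltr => //; exact: measurable_cst.
  apply: measurable_funD => //; apply: measurable_funM => //.
  by apply: measurable_fun_ifT; [exact: measurable_sgn|exact: measurable_cst|exact: measurable_cst].
Qed.

Lemma measurable_gk k : open_measurable_map (gk S O k).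
Proof. exact/measurable_mx/measurable_gk_coord/measurable_xk. Qed.

Lemma measurable_Hk k : open_measurable_map (Hk S O k).
Proof. exact/measurable_mx/measurable_Hk_coord/measurable_xk. Qed.

Lemma before_draw_measurable k : before_draw S O k `<=` measurable.
Proof.
move=> A [|].
  move=> [i _ [[[[|]|]|]|]] [U oU <-].
  - exact: measurable_xk.
  - exact: measurable_gk.
  - exact: measurable_Hk.
  - exact: measurable_phat.
  - rewrite -[X in measurable X]setTI; apply: (measurable_lamk (measurable_xk i)) => //.
    exact: open_measurable.
by move=> [i _ [b _ <-]]; case: hmeas => _ _ ms _; exact: ms.
Qed.

End ProcessMeasurability.

(** * Accuracy of the sampled oracles *)

Section UnionBounds.
Local Open Scope ereal_scope.
Context {R : realType} {d : measure_display} {T : measurableType d}.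

Lemma measure_bigsetU_le (mu : {measure set T -> \bar R}) (I : Type) (s : seq I) (F : I -> set T) :
  (forall i, measurable (F i)) ->
  mu (\big[setU/set0]_(i <- s) F i) <= \sum_(i <- s) mu (F i).
Proof.
move=> mF; elim: s => [|i s IH]; first by rewrite !big_nil measure0.
rewrite !big_cons; apply: (@le_trans _ _ (mu (F i) + mu (\big[setU/set0]_(j <- s) F j))).
  by apply: measureU2 => //; exact: bigsetU_measurable.
exact: leeD2l.
Qed.

(* A union bound over the values of a batch that is uniform and independent of
   the events [A m s]; the batch size is itself random. *)
Lemma sampling_bound (P : probability T R) (N : nat) (sz : T -> nat)
  (A I : forall m, {ffun 'I_m -> 'I_N} -> set T) (q : R) :
  (0 < N)%N -> (0 <= q)%R ->
  (forall m, measurable [set w | sz w = m]) ->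
  (forall m s, measurable (A m s)) -> (forall m s, measurable (I m s)) ->
  (forall m s, P (A m s `&` I m s) = P (A m s) * (N%:R ^- m)%:E) ->
  (forall m w, (\sum_s \1_(A m s) w <= N%:R ^+ m * q * \1_[set w | sz w = m] w)%R) ->
  P (\bigcup_m \big[setU/set0]_s (A m s `&` I m s)) <= q%:E.
Proof.
move=> N0 q0 msz mA mI PAI hA.
have mE m : measurable (\big[setU/set0]_s (A m s `&` I m s)).
  by apply: bigsetU_measurable => s _; exact: measurableI.
(* Double counting: the sum of the probabilities is the integral of the number of bad samples, which
   is at most [N^m q] where the batch has length [m] and zero elsewhere. *)
have sumA m : \sum_s P (A m s) <= (N%:R ^+ m * q)%:E * P [set w | sz w = m].
  have -> : \sum_s P (A m s) = \int[P]_w (\sum_s (\1_(A m s) w)%:E).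
    rewrite ge0_integral_sum //.
    - by apply: eq_bigr => s _; rewrite integral_indic // setIT.
    - by move=> s; apply/measurable_EFinP; exact: measurable_indic.
  have -> : (N%:R ^+ m * q)%:E * P [set w | sz w = m] =
      \int[P]_w ((N%:R ^+ m * q)%:E * (\1_[set w | sz w = m] w)%:E).
    rewrite ge0_integralZl //.
    - by rewrite integral_indic // setIT.
    - by apply/measurable_EFinP; exact: measurable_indic.
    - by rewrite lee_fin mulr_ge0 // exprn_ge0.
  apply: ge0_le_integral => //.
  - by move=> w _; apply: sume_ge0.
  - by apply: emeasurable_sum => s; apply/measurable_EFinP; exact: measurable_indic.
  - by apply: measurable_funeM; apply/measurable_EFinP; exact: measurable_indic.
  - by move=> w _; rewrite sumEFin -EFinM lee_fin; exact: hA.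
have PE m : P (\big[setU/set0]_s (A m s `&` I m s)) <= q%:E * P [set w | sz w = m].
  apply: le_trans (measure_bigsetU_le _ _ _) _; first by move=> s; exact: measurableI.
  rewrite (eq_bigr (fun s => P (A m s) * (N%:R ^- m)%:E)); last by move=> s _; exact: PAI.
  rewrite -ge0_sume_distrl //.
  apply: (@le_trans _ _ ((N%:R ^+ m * q)%:E * P [set w | sz w = m] * (N%:R ^- m)%:E)).
    by apply: lee_wpmul2r; [rewrite lee_fin invr_ge0 exprn_ge0|exact: sumA].
  rewrite muleAC -EFinM mulrAC mulfV ?mul1r //.
  by rewrite expf_neq0 // pnatr_eq0 -lt0n.
apply: (@le_trans _ _ (\sum_(m <oo) P (\big[setU/set0]_s (A m s `&` I m s)))).
  by apply: measure_sigma_subadditive => //; exact: bigcupT_measurable.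
apply: (@le_trans _ _ (\sum_(m <oo) q%:E * P [set w | sz w = m])).
  by apply: lee_nneseries => // n _; exact: PE.
(* The lengths partition the sample space, so the bounds for the single lengths add up to [q]. *)
have e1 : \sum_(m <oo) P [set w | sz w = m] = 1.
  have cover : \bigcup_n [set w | sz w = n] = setT.
    by apply/seteqP; split => // w _; exists (sz w).
  rewrite -(probability_setT P) -cover; apply/esym; apply: measure_semi_bigcup => //.
    by apply/trivIsetP => i j _ _ ij; apply/seteqP; split => w //= -[h1 h2]; move: ij; rewrite -h1 -h2 eqxx.
  by rewrite cover; exact: measurableT.
by rewrite nneseriesZl // e1 mule1.
Qed.

End UnionBounds.

Section BadOracles.
Context {R : realType} {N d : nat} {dO : measure_display} {Omega : measurableType dO}.
Variables (P : probability Omega R) (S : problem R N d) (O : inputs R N d Omega).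
Hypotheses (N_gt0 : (0 < N)%N) (d_gt0 : (0 < d)%N).
Hypotheses (eg_gt0 : 0 < epsg S) (eH_gt0 : 0 < epsH S).
Hypothesis hf : forall i, twice_differentiable (fcomp S i).
Hypothesis hG : forall i x, enorm (grad (fcomp S i) x) <= Gbd S x.
Hypothesis hK : forall i x, specnorm (hess (fcomp S i) x) <= Kbd S x.
Hypotheses (hGm : borel_fun (Gbd S)) (hKm : borel_fun (Kbd S)).
Hypothesis hmeas : measurable_inputs O.
Hypothesis hsamp : uniform_sampling P S O.
Hypothesis xi_range : 0 < xi S <= 1 / 2.

Let xi01 : 0 < xi S < 1.
Proof. by case/andP: xi_range => -> /le_lt_trans-> //; lra. Qed.

Local Notation borelV := (g_sigma_algebraType (@open 'rV[R]_d)).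
Local Notation max_grad x := (Num.max (epsg S) (enorm (grad (objective S) x))).

Lemma sample_sum_coord m m1 m2 (A : 'I_N -> 'M[R]_(m1, m2)) (s : {ffun 'I_m -> 'I_N}) i j :
  sample_sum (deviation A) s i j = \sum_k (A (s k) i j - N%:R^-1 * \sum_a A a i j).
Proof.
by rewrite /sample_sum summxE; apply: eq_bigr => k _; rewrite !mxE summxE.
Qed.

Lemma trmx_sample_sum m n (A : 'I_N -> 'M[R]_n) (s : {ffun 'I_m -> 'I_N}) :
  (forall a, (A a)^T = A a) -> (sample_sum (deviation A) s)^T = sample_sum (deviation A) s.
Proof.
move=> sA; have sym a i j : A a i j = A a j i by rewrite -[in LHS]sA mxE.
apply/matrixP => i j; rewrite mxE !sample_sum_coord; apply: eq_bigr => k _.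
by rewrite sym; congr (_ - _ * _); apply: eq_bigr => a _; exact: sym.
Qed.

Lemma measurable_sample_sum m m1 m2 (F : 'I_N -> 'rV[R]_d -> 'M[R]_(m1, m2)) (s : {ffun 'I_m -> 'I_N}) :
  (forall a i j, measurable_fun setT ((fun y => F a y i j) : borelV -> R)) ->
  forall i j, measurable_fun setT ((fun y => sample_sum (deviation (F ^~ y)) s i j) : borelV -> R).
Proof.
move=> mF i j; under eq_fun do rewrite sample_sum_coord.
apply: measurable_sumr => k; apply: measurable_funB => //.
apply: measurable_funM; first exact: measurable_cst.
by apply: measurable_sumr => a.
Qed.

Lemma xk_preimage_past k (B : set 'rV[R]_d) : <<s @open 'rV[R]_d >> B ->
  <<s before_sampling S O k >> (xk S O k @^-1` B).
Proof.
move=> mB; have := @measurable_borel_comp R _ (g_sigma_algebraType (before_sampling S O k)) d (xk S O k).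
move=> /(_ _)/wrap[|h]; last by have := h measurableT B mB; rewrite setTI.
by move=> U oU; apply: sub_sigma_algebra; left; exists k => //=; exists U.
Qed.

Lemma xk_preimage_measurable k (B : set 'rV[R]_d) : <<s @open 'rV[R]_d >> B ->
  measurable (xk S O k @^-1` B).
Proof.
move=> mB; have := measurable_borel_comp (measurable_xk eg_gt0 hf hGm hKm hmeas k).
by move=> /(_ measurableT B mB); rewrite setTI.
Qed.

Lemma sampling_g k m (s : 'I_m -> 'I_N) (A : set Omega) : <<s before_sampling S O k >> A ->
  P (A `&` [set w | forall j : 'I_m, idxg O k j w = s j]) = (P A * (N%:R ^- m)%:E)%E.
Proof.
move=> /(@hsamp k m 0%N s (fun=> Ordinal N_gt0)); rewrite addn0 => <-.
by congr (P (_ `&` _)); apply/seteqP; split => w /= => [h|[]//]; split => // -[].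
Qed.

Lemma sampling_H k m (s : 'I_m -> 'I_N) (A : set Omega) : <<s before_sampling S O k >> A ->
  P (A `&` [set w | forall j : 'I_m, idxH O k j w = s j]) = (P A * (N%:R ^- m)%:E)%E.
Proof.
move=> /(@hsamp k 0%N m (fun=> Ordinal N_gt0) s); rewrite add0n => <-.
by congr (P (_ `&` _)); apply/seteqP; split => w /= => [h|[]//]; split => // -[].
Qed.

(** For a fixed iterate the bad index lists are counted by [vector_sample_tail]; independence of the
    batch from the past turns this count into a probability. *)
Lemma prob_bad_grad k : exists E : set Omega, [/\ measurable E,
  (P E <= (2 * expR (- (4 * ln (xi S)^-1)))%:E)%E &
  [set w | max_grad (xk S O k w) / 4 < enorm (gk S O k w - grad (objective S) (xk S O k w))] `<=` E].
Proof.
pose q : R := 2 * expR (- (4 * ln (xi S)^-1)).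
(* The iterates at which the list [s] would be a bad batch. No drawn index occurs in it, so [A m s]
   is an event of the past. *)
pose B m (s : {ffun 'I_m -> 'I_N}) : set 'rV[R]_d := [set x | size_g S x = m /\
  m%:R * (4^-1 * max_grad x) <= enorm (sample_sum (deviation (fun a => grad (fcomp S a) x)) s)].
pose A m s := xk S O k @^-1` B m s.
pose I m (s : {ffun 'I_m -> 'I_N}) := [set w | forall j : 'I_m, idxg O k j w = s j].
have mB m s : <<s @open 'rV[R]_d >> (B m s).
  have h1 := measurable_size_g eg_gt0 hf hGm m.
  have h2 : measurable ([set x | m%:R * (4^-1 * max_grad x) <=
      enorm (sample_sum (deviation (fun a => grad (fcomp S a) x)) s)] : set borelV).
    apply: measurable_le_set.
      apply: measurable_funM; first exact: measurable_cst.
      apply: measurable_funM; first exact: measurable_cst.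
      exact: measurable_max_grad.
    apply: measurable_enorm; apply: (measurable_sample_sum (F := fun a => grad (fcomp S a))).
    by move=> a i j; exact: measurable_grad_coord.
  exact: (measurableI _ _ h1 h2).
have mI m s : measurable (I m s).
  have -> : I m s = \bigcap_(j in [set: 'I_m]) [set w | idxg O k j w = s j].
    by apply/seteqP; split => w /= h j; [move=> _|]; exact: h.
  by apply: fin_bigcap_measurable => // j _; case: hmeas => + _ _ _; apply.
exists (\bigcup_m \big[setU/set0]_s (A m s `&` I m s)); split.
- apply: bigcupT_measurable => m; apply: bigsetU_measurable => s _; apply: measurableI => //.
  exact: xk_preimage_measurable.
- have q0 : 0 <= q by rewrite /q mulr_ge0 ?expR_ge0.
  apply: (sampling_bound (q := q) (sz := fun w => size_g S (xk S O k w)) N_gt0 q0).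
  + by move=> m; apply: (@xk_preimage_measurable k [set x | size_g S x = m]); exact: measurable_size_g.
  + by move=> m s; exact: xk_preimage_measurable.
  + exact: mI.
  + by move=> m s; apply: sampling_g; exact: xk_preimage_past.
  + move=> m w; set x := xk S O k w.
    have [szm|szm] := eqVneq (size_g S x) m; last first.
      rewrite big1 ?mulr_ge0 ?exprn_ge0 ?expR_ge0 // => s _; rewrite indicE memNset //.
      by case=> h _; rewrite h eqxx in szm.
    rewrite [\1_[set _ | _] w]indicE mem_set // mulr1.
    have m0 : (0 < m)%N by rewrite -szm batch_size_gt0.
    have mx0 : 0 < max_grad x by rewrite lt_max eg_gt0.
    have l0 : 0 < ln (xi S)^-1 by rewrite ln_gt0 // invf_gt1 //; case/andP: xi01.
    have G0 : 0 <= Gbd S x by apply: le_trans (hG (Ordinal N_gt0) x); exact: enorm_ge0.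
    have msz : 256 * (Gbd S x / max_grad x) ^+ 2 * ln (xi S)^-1 <= m%:R.
      by rewrite -szm; exact: batch_size_ge.
    have := @vector_sample_tail R N m d N_gt0 m0 256 (Gbd S x) (max_grad x) (ln (xi S)^-1)
      ltac:(by rewrite ltr0n) G0 mx0 l0 msz (fun a => grad (fcomp S a) x) 4^-1 ltac:(by rewrite invr_ge0) (fun i => hG i x).
    (* Origin of the exponent: the constant 256 of the sample size with the relative accuracy [1/4]
       gives [xi^4]. *)
    have -> : (4^-1 : R) ^+ 2 * 256 / 4 * ln (xi S)^-1 = 4 * ln (xi S)^-1 by field.
    apply: le_trans; apply: ler_sum => s _; rewrite indicE.
    by case: (boolP (_ \in _)) => // /set_mem[_ ->].
move=> w /= hw; pose m := size_g S (xk S O k w).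
have m0 : (0 < m)%N by exact: batch_size_gt0.
pose s : {ffun 'I_m -> 'I_N} := [ffun j : 'I_m => idxg O k j w].
exists m => //; rewrite (bigD1 s) //=; left; split; last by move=> j; rewrite ffunE.
split=> //; move: hw.
have -> : gk S O k w - grad (objective S) (xk S O k w) =
   m%:R^-1 *: sample_sum (deviation (fun a => grad (fcomp S a) (xk S O k w))) s.
  transitivity (m%:R^-1 *: (\sum_(j < m) grad (fcomp S (s j)) (xk S O k w)) -
      N%:R^-1 *: \sum_i grad (fcomp S i) (xk S O k w)); last exact: sample_mean_deviation.
  have e0 : \sum_(j < m) grad (fcomp S (s j)) (xk S O k w) =
      \sum_(j < m) grad (fcomp S (idxg O k j w)) (xk S O k w).
    by apply: eq_bigr => j _; rewrite ffunE.
  rewrite e0; exact: (congr2 (fun a b => a - b) (erefl (gk S O k w)) (grad_objective hf _)).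
rewrite enormZ gtr0_norm ?invr_gt0 ?ltr0n // => /ltW.
by rewrite ler_pdivlMl ?ltr0n // [_ / 4]mulrC.
Qed.

Lemma prob_bad_hess k : exists E : set Omega, [/\ measurable E,
  (P E <= (2 * d%:R * expR (- (484 / 81 * ln (2 * d%:R / xi S))))%:E)%E &
  [set w | 2 / 9 * epsH S < specnorm (Hk S O k w - hess (objective S) (xk S O k w))] `<=` E].
Proof.
pose q : R := 2 * d%:R * expR (- (484 / 81 * ln (2 * d%:R / xi S))).
(* Countably many trace inequalities, implied by a large spectral norm, replace
   an event stated with the supremum [specnorm]: their measurability is clear. *)
pose B m (s : {ffun 'I_m -> 'I_N}) : set 'rV[R]_d := [set x | size_H S x = m /\
  forall p, (m%:R * (2 / 9 * epsH S)) ^+ (p + p) <=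
    \tr (sample_sum (deviation (fun a => hess (fcomp S a) x)) s ^+ (p + p))].
pose A m s := xk S O k @^-1` B m s.
pose I m (s : {ffun 'I_m -> 'I_N}) := [set w | forall j : 'I_m, idxH O k j w = s j].
have mB m s : <<s @open 'rV[R]_d >> (B m s).
  have h1 := measurable_size_H hKm m.
  have h2 : measurable (\bigcap_p [set x | (m%:R * (2 / 9 * epsH S)) ^+ (p + p) <=
    \tr (sample_sum (deviation (fun a => hess (fcomp S a) x)) s ^+ (p + p))] : set borelV).
    apply: bigcapT_measurable => p; apply: measurable_le_set; first exact: measurable_cst.
    apply: measurable_mxtrace_exp; apply: (measurable_sample_sum (F := fun a => hess (fcomp S a))).
    by move=> a i j; exact: measurable_hess_coord.
  have -> : B m s = [set x | size_H S x = m] `&` \bigcap_p [set x | (m%:R * (2 / 9 * epsH S)) ^+ (p + p) <=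
    \tr (sample_sum (deviation (fun a => hess (fcomp S a) x)) s ^+ (p + p))].
    by apply/seteqP; split => x [e h]; split => // p; [move=> _; exact: h|exact: (h p Logic.I)].
  exact: (measurableI _ _ h1 h2).
have mI m s : measurable (I m s).
  have -> : I m s = \bigcap_(j in [set: 'I_m]) [set w | idxH O k j w = s j].
    by apply/seteqP; split => w /= h j; [move=> _|]; exact: h.
  by apply: fin_bigcap_measurable => // j _; case: hmeas => _ + _ _; apply.
exists (\bigcup_m \big[setU/set0]_s (A m s `&` I m s)); split.
- apply: bigcupT_measurable => m; apply: bigsetU_measurable => s _; apply: measurableI => //.
  exact: xk_preimage_measurable.
- have q0 : 0 <= q by rewrite /q mulr_ge0 ?expR_ge0 // mulr_ge0.
  apply: (sampling_bound (q := q) (sz := fun w => size_H S (xk S O k w)) N_gt0 q0).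
  + by move=> m; apply: (@xk_preimage_measurable k [set x | size_H S x = m]); exact: measurable_size_H.
  + by move=> m s; exact: xk_preimage_measurable.
  + exact: mI.
  + by move=> m s; apply: sampling_H; exact: xk_preimage_past.
  + move=> m w; set x := xk S O k w.
    have [szm|szm] := eqVneq (size_H S x) m; last first.
      rewrite big1 ?mulr_ge0 ?exprn_ge0 ?expR_ge0 // => s _; rewrite indicE memNset //.
      by case=> h _; rewrite h eqxx in szm.
    rewrite [\1_[set _ | _] w]indicE mem_set // mulr1.
    have m0 : (0 < m)%N by rewrite -szm batch_size_gt0.
    have l0 : 0 < ln (2 * d%:R / xi S).
      case/andP: xi01 => x0 x1; rewrite ln_gt0 // ltr_pdivlMr // mul1r.
      apply: lt_le_trans x1 _; have : 1 <= d%:R :> R by rewrite ler1n.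
      by lra.
    have K0 : 0 <= Kbd S x by apply: le_trans (hK (Ordinal N_gt0) x); exact: specnorm_ge0.
    have msz : 484 * (Kbd S x / epsH S) ^+ 2 * ln (2 * d%:R / xi S) <= m%:R.
      by rewrite -szm; exact: batch_size_ge.
    have := @matrix_sample_tail R N m d N_gt0 m0 484 (Kbd S x) (epsH S) (ln (2 * d%:R / xi S))
      ltac:(by rewrite ltr0n) K0 eH_gt0 l0 msz (fun a => hess (fcomp S a) x) (2 / 9)
      ltac:(by rewrite divr_ge0) (fun i => hess_sym x (hf i)) (fun i => hK i x).
    (* Accuracy [2/9] with the constant 484 gives an exponent slightly below 6; only 5 will be
       used. *)
    have -> : (2 / 9 : R) ^+ 2 * 484 / 4 = 484 / 81 by field.
    apply: le_trans; apply: ler_sum => s _; rewrite indicE.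
    case: (boolP (_ \in _)) => // /set_mem[_ h].
    by case: asboolP.
move=> w /= hw; pose m := size_H S (xk S O k w).
have m0 : (0 < m)%N by exact: batch_size_gt0.
pose s : {ffun 'I_m -> 'I_N} := [ffun j : 'I_m => idxH O k j w].
exists m => //; rewrite (bigD1 s) //=; left; split; last by move=> j; rewrite ffunE.
split=> //; move: hw.
have -> : Hk S O k w - hess (objective S) (xk S O k w) =
   m%:R^-1 *: sample_sum (deviation (fun a => hess (fcomp S a) (xk S O k w))) s.
  transitivity (m%:R^-1 *: (\sum_(j < m) hess (fcomp S (s j)) (xk S O k w)) -
      N%:R^-1 *: \sum_i hess (fcomp S i) (xk S O k w)); last exact: sample_mean_deviation.
  have e0 : \sum_(j < m) hess (fcomp S (s j)) (xk S O k w) =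
      \sum_(j < m) hess (fcomp S (idxH O k j w)) (xk S O k w).
    by apply: eq_bigr => j _; rewrite ffunE.
  rewrite e0; exact: (congr2 (fun a b => a - b) (erefl (Hk S O k w)) (hess_objective hf _)).
apply: specnorm_gt_trace => //; first by rewrite mulr_ge0 ?divr_ge0 // ltW.
by apply: trmx_sample_sum => a; exact: hess_sym.
Qed.

Lemma prob_bad_oracle k : exists E : set Omega, [/\ measurable E,
  (P E <= (xi S / 2)%:E)%E & forall w, ~ E w ->
    enorm (gk S O k w - grad (objective S) (xk S O k w)) <= max_grad (xk S O k w) / 4 /\
    specnorm (Hk S O k w - hess (objective S) (xk S O k w)) <= 2 / 9 * epsH S].
Proof.
have [Eg [mEg PEg hEg]] := prob_bad_grad k.
have [Eh [mEh PEh hEh]] := prob_bad_hess k.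
have /andP[x0 x1] := xi_range.
exists (Eg `|` Eh); split; first exact: measurableU.
  apply: le_trans (measureU2 P mEg mEh) _.
  apply: le_trans (leeD PEg PEh) _; rewrite -EFinD lee_fin.
  have -> : expR (- (4 * ln (xi S)^-1)) = xi S ^+ 4.
    rewrite lnV // mulrN opprK (_ : 4 * ln (xi S) = ln (xi S ^+ 4)); last by rewrite lnXn // mulr_natl.
    by rewrite lnK // posrE exprn_gt0.
  have d1 : 1 <= d%:R :> R by rewrite ler1n.
  have d0 : 0 < 2 * d%:R :> R by lra.
  (* With [y <= 1/4] and [xi <= 1/2] the total is at most [2 xi^4 + 2 d y^5 = 2 xi^4 + xi y^4 <= xi
     (1/4 + 1/256)], below [xi / 2]. *)
  pose y := xi S / (2 * d%:R).
  have y0 : 0 < y by rewrite divr_gt0.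
  have y4 : y <= 1 / 4 by rewrite ler_pdivrMr //; lra.
  have : expR (- (484 / 81 * ln (2 * d%:R / xi S))) <= y ^+ 5.
    have -> : 2 * d%:R / xi S = y^-1 by rewrite /y [RHS]invf_div.
    have ln0 : ln y <= 0 by rewrite ln_le0 //; lra.
    have -> : y ^+ 5 = expR (5 * ln y).
      rewrite (_ : 5 * ln y = ln (y ^+ 5)); last by rewrite lnXn // mulr_natl.
      by rewrite lnK // posrE exprn_gt0.
    by rewrite ler_expR lnV //; lra.
  move=> /(ler_wpM2l (ltW d0)) h; apply: le_trans (lerD (lexx _) h) _.
  have -> : 2 * d%:R * y ^+ 5 = xi S * y ^+ 4 by rewrite /y; field; rewrite gt_eqF //; lra.
  have h1 : xi S * y ^+ 4 <= xi S * (1 / 4) ^+ 4.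
    by rewrite ler_wpM2l ?(ltW x0) // lerXn2r // nnegrE ltW.
  have h2 : xi S * xi S ^+ 3 <= xi S * (1 / 2) ^+ 3.
    by rewrite ler_wpM2l ?(ltW x0) // lerXn2r // nnegrE ltW.
  by rewrite (exprS _ 3); lra.
move=> w /not_orP[ng nh]; split; rewrite leNgt; apply/negP => h.
- by apply: ng; exact: hEg.
- by apply: nh; exact: hEh.
Qed.

End BadOracles.

(** * The supermartingale of the signs *)

Section FairStep.
Local Open Scope ereal_scope.
Context {R : realType} {d : measure_display} {T : measurableType d}.
Variables (P : probability T R) (G : set (set T)).
Hypothesis G_measurable : G `<=` measurable.

Local Notation TG := (g_sigma_algebraType G).

(** A sub-sigma-algebra is treated as a second measurable structure on the same points, with the
    identity as the map between the two. *)
Lemma measurable_id_sub : measurable_fun setT (id : T -> TG).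
Proof.
apply: (@measurability _ _ T TG setT id G) => //.
by move=> _ [A GA <-]; rewrite setTI; exact: G_measurable.
Qed.

Lemma measurable_sub d' (T' : measurableType d') (F : T -> T') :
  measurable_fun setT (F : TG -> T') -> measurable_fun setT F.
Proof. by move=> mF; exact: (measurableT_comp mF measurable_id_sub). Qed.

(* Both sides are integrals over the sub-sigma-algebra generated by [G], on
   which the two measures agree. *)
Lemma integral_half (D : set T) (mD : measurable D) (F : T -> R) :
  (forall A, <<s G >> A -> P (A `&` D) = P A * (2^-1)%:E) ->
  measurable_fun setT (F : TG -> R) -> (forall w, 0 <= F w)%R ->
  \int[mrestr P mD]_w (F w)%:E = (2^-1)%:E * \int[P]_w (F w)%:E.
Proof.
move=> fair mF F0.
pose phi : T -> TG := id.
have mphi : measurable_fun setT phi := measurable_id_sub.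
have mFE : measurable_fun setT (fun w : TG => (F w)%:E) by apply/measurable_EFinP.
have push (mu : {measure set T -> \bar R}) :
    \int[pushforward mu phi]_y (F y)%:E = \int[mu]_w (F w)%:E.
  rewrite (ge0_integral_pushforward mphi) //.
  by move=> y _; rewrite lee_fin.
rewrite -!push.
pose nu (mu : {measure set T -> \bar R}) : {measure set TG -> \bar R} :=
  measure_function_pushforward__canonical__measure_function_Measure mu mphi.
have h2 : (0 <= 2^-1 :> R)%R by rewrite invr_ge0.
pose k : {nonneg R} := NngNum h2.
transitivity (\int[mscale k (nu P)]_y (F y)%:E).
  apply: (@eq_measure_integral _ _ _ setT (mscale k (nu P)) (nu (mrestr P mD))) => A mA _.
  rewrite /mscale /= /pushforward /mrestr.
  by rewrite [LHS](fair A mA) muleC.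
by rewrite ge0_integral_mscale // => y _; rewrite lee_fin.
Qed.

(** The integral is split along the sign. On each half the integrand is a function of the past, and
    [integral_half] evaluates it as one half of the unrestricted integral. *)
Lemma fair_step (sg : T -> bool) (F1 F2 F : T -> R) :
  (forall b, measurable [set w | sg w = b]) ->
  (forall A b, <<s G >> A -> P (A `&` [set w | sg w = b]) = P A * (2^-1)%:E) ->
  measurable_fun setT (F1 : TG -> R) -> measurable_fun setT (F2 : TG -> R) ->
  measurable_fun setT (F : TG -> R) ->
  (forall w, 0 <= F1 w)%R -> (forall w, 0 <= F2 w)%R ->
  (forall w, F1 w + F2 w <= 2 * F w)%R ->
  \int[P]_w (if sg w then F1 w else F2 w)%:E <= \int[P]_w (F w)%:E.
Proof.
move=> msg fair mF1 mF2 mF F10 F20 hF.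
have F0 w : (0 <= F w)%R by have := hF w; have := F10 w; have := F20 w; lra.
have mF1' := measurable_sub mF1; have mF2' := measurable_sub mF2; have mF' := measurable_sub mF.
pose W w := (if sg w then F1 w else F2 w).
have mW : measurable_fun setT W.
  apply: measurable_fun_ifT => //; apply: (measurable_fun_bool true).
  by rewrite setTI; exact: (msg true).
have W0 w : (0 <= W w)%R by rewrite /W; case: ifP.
have mE (H : T -> R) : measurable_fun setT H -> measurable_fun setT (fun w => (H w)%:E).
  by move=> mH; apply/measurable_EFinP.
have halfE b (H : T -> R) : measurable_fun setT H -> (forall w, 0 <= H w)%R ->
    (forall w, sg w = b -> W w = H w) ->
    \int[mrestr P (msg b)]_w (W w)%:E = \int[mrestr P (msg b)]_w (H w)%:E.
  move=> mH H0 WH; apply: ge0_ae_eq_integral => //; try exact: mE.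
  - by move=> w _; rewrite lee_fin.
  - by move=> w _; rewrite lee_fin.
  exists (~` [set w | sg w = b]); split; first exact: measurableC.
    by rewrite /= /mrestr setICl measure0.
  by move=> w /= nW sgw; apply: nW => _; rewrite WH.
(* [P] is the sum of its restrictions to the two values of the sign. *)
have -> : \int[P]_w (W w)%:E =
    \int[measure_add (mrestr P (msg true)) (mrestr P (msg false))]_w (W w)%:E.
  apply: eq_measure_integral => A mA _.
  transitivity (P (A `&` [set w | sg w = true]) + P (A `&` [set w | sg w = false])); last exact/esym/measure_addE.
  rewrite -measureU //; try exact: measurableI.
    rewrite -setIUr; congr (P _); apply/seteqP; split => w /=; last by case.
    by move=> Aw; split => //; case: (sg w); [left|right].
  by apply/seteqP; split => w //= [[_ ->] [_]].
rewrite ge0_integral_measure_add //; first last.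
- exact: mE.
- by move=> w _; rewrite lee_fin.
rewrite (halfE true F1) //; last by move=> w sgw; rewrite /W sgw.
rewrite (halfE false F2) //; last by move=> w sgw; rewrite /W sgw.
rewrite !integral_half //; try by move=> A GA; exact: fair.
rewrite -ge0_muleDr; try by apply: integral_ge0 => w _; rewrite lee_fin.
rewrite -ge0_integralD //; try exact: mE; try by move=> w _; rewrite lee_fin.
rewrite -ge0_integralZl //; first last.
- by move=> w _; rewrite -EFinD lee_fin addr_ge0.
- by apply: emeasurable_funD; exact: mE.
apply: ge0_le_integral => //.
- by move=> w _; rewrite -EFinD -EFinM lee_fin mulr_ge0 ?addr_ge0.
- by apply: measurable_funeM; apply: emeasurable_funD; exact: mE.
- exact: mE.
- by move=> w _; rewrite -EFinD -EFinM lee_fin; have := hF w; lra.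
Qed.

End FairStep.

Lemma markov_real {R : realType} {d : measure_display} {T : measurableType d}
  (P : probability T R) (W : T -> R) (a : R) : 0 < a -> measurable_fun setT W ->
  (forall w, 0 <= W w) -> (\int[P]_w (W w)%:E <= 1)%E ->
  (P [set w | (a <= W w)%R] <= (a^-1)%:E)%E.
Proof.
move=> a0 mW W0 iW.
have mA : measurable [set w | (a <= W w)%R] by apply: measurable_le_set => //; exact: measurable_cst.
have : (a%:E * P [set w | (a <= W w)%R] <= 1)%E.
  apply: le_trans iW; rewrite -[X in P X]setIT -integral_indic //.
  rewrite -ge0_integralZl //; first last.
  - exact: ltW.
  - by apply/measurable_EFinP; exact: measurable_indic.
  apply: ge0_le_integral => //.
  - by move=> w _; rewrite mule_ge0 // lee_fin ltW.
  - by apply: measurable_funeM; apply/measurable_EFinP; exact: measurable_indic.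
  - by apply/measurable_EFinP.
  move=> w _; rewrite -EFinM lee_fin indicE.
  by case: (boolP (w \in _)) => [/set_mem/=|_]; rewrite ?mulr1 ?mulr0.
by move=> h; rewrite -[X in (_ <= X)%E]mule1 lee_pdivlMl.
Qed.

Section SignSupermartingale.
Context {R : realType} {N d : nat} {dO : measure_display} {Omega : measurableType dO}.
Variables (P : probability Omega R) (S : problem R N d) (O : inputs R N d Omega).
Hypothesis eg_gt0 : 0 < epsg S.
Hypothesis hf : forall i, twice_differentiable (fcomp S i).
Hypotheses (hGm : borel_fun (Gbd S)) (hKm : borel_fun (Kbd S)).
Hypothesis hmeas : measurable_inputs O.
Hypothesis hsgn : fair_signs P S O.
Variable lam : R.
Implicit Types (k i : nat) (w : Omega).

(** Defined at every iteration, also past termination, so that [nc_exp] is a process over a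
    deterministic horizon. *)
Definition nc_step i w : bool := (enorm (gk S O i w) <= epsg S) && (lamk S O i w < - epsH S).

Definition nc_incr i w : R := if nc_step i w
  then lam * (2 * epsH S / Mh S * dotp (grad (objective S) (xk S O i w)) (phat O i w)) else 0.

(** The compensator is the actual squared increment, known before the draw, rather than the bound
    [c^2]. The supermartingale property therefore holds on all paths, accurate or not. *)
Definition nc_exp k w : R :=
  expR (\sum_(i < k) ((-1) ^+ sgn O i w * nc_incr i w - nc_incr i w ^+ 2 / 2)).

Local Notation past k := (g_sigma_algebraType (before_draw S O k)).

(** The case [i = k] is the essential one: the size of the increment is known before the draw of its
    sign. *)
Lemma measurable_nc_incr_past k i : (i <= k)%N ->
  measurable_fun setT (nc_incr i : past k -> R).
Proof.
move=> ik.
have obs (T : topologicalType) (X : Omega -> T) : observations X `<=` before_draw S O k ->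
    forall U, open U -> measurable ((X : past k -> T) @^-1` U).
  by move=> h U oU; apply: sub_sigma_algebra; apply: h; exists U.
have ox : forall U, open U -> measurable ((xk S O i : past k -> _) @^-1` U).
  by apply: obs => A HA; left; exists i => //; do 4 left.
have og : forall U, open U -> measurable ((gk S O i : past k -> _) @^-1` U).
  by apply: obs => A HA; left; exists i => //; do 3 left; right.
have op : forall U, open U -> measurable ((phat O i : past k -> _) @^-1` U).
  by apply: obs => A HA; left; exists i => //; left; right.
have ol : forall U, open U -> measurable ((lamk S O i : past k -> _) @^-1` U).
  by apply: obs => A HA; left; exists i => //; right.
have coord m n (X : past k -> 'M[R]_(m, n)) (h : forall U, open U -> measurable (X @^-1` U)) :
    forall a b, measurable_fun [set: past k] (fun w : past k => X w a b).
  move=> a b; exact (@open_measurable_coord R _ (past k) m n X h a b).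
apply: measurable_fun_ifT; last exact: measurable_cst.
  apply: measurable_and.
    by apply: measurable_fun_ler; [apply: measurable_enorm; exact: coord|exact: measurable_cst].
  by apply: measurable_fun_ltr; [exact: measurable_fun_opens|exact: measurable_cst].
apply: measurable_funM; first exact: measurable_cst.
apply: measurable_funM; first exact: measurable_cst.
apply: measurable_dotp; last exact: coord.
move=> a b; have mxB := measurable_borel_comp ox.
have := measurable_grad_coord a b (twice_differentiable_objective hf) => mg.
exact: (measurableT_comp mg mxB).
Qed.

Lemma measurable_nc_exp_past k : measurable_fun setT (nc_exp k : past k -> R).
Proof.
apply: (@measurableT_comp _ _ _ _ _ _ expR); first exact: measurable_expR.
apply: measurable_sumr => i.
have mi := measurable_nc_incr_past (ltnW (ltn_ord i)).
apply: measurable_funB; last first.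
  by apply: measurable_funM; [exact: measurable_funX|exact: measurable_cst].
apply: measurable_funM => //.
have -> : (fun w : past k => (-1) ^+ sgn O i w) = (fun w => if sgn O i w then -1 else 1 : R).
  by apply/funext => w; case: (sgn O i w); rewrite ?expr1 ?expr0.
apply: measurable_fun_ifT; try exact: measurable_cst.
apply: (measurable_fun_bool true); rewrite setTI; apply: sub_sigma_algebra; right.
by exists i => //=; exists true.
Qed.

Lemma integral_nc_exp k : (\int[P]_w (nc_exp k w)%:E <= 1)%E.
Proof.
elim: k => [|k IH].
  have -> : (fun w => (nc_exp 0 w)%:E) = cst 1%E.
    by apply/funext => w; rewrite /nc_exp big_ord0 expR0.
  by rewrite integral_cst // mul1e probability_le1.
apply: le_trans IH.
(* The two values after the draw; [sgn = true] stands for the sign [-1]. Their mean is at most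
   [nc_exp k] because [cosh y <= exp (y^2 / 2)]. *)
pose F1 w := nc_exp k w * expR (- nc_incr k w - nc_incr k w ^+ 2 / 2).
pose F2 w := nc_exp k w * expR (nc_incr k w - nc_incr k w ^+ 2 / 2).
have -> : (fun w => (nc_exp k.+1 w)%:E) = (fun w => (if sgn O k w then F1 w else F2 w)%:E).
  apply/funext => w; rewrite /nc_exp big_ord_recr expRD /F1 /F2 /=.
  by case: (sgn O k w); rewrite ?expr1 ?expr0 ?mulN1r ?mul1r.
have mi := measurable_nc_incr_past (leqnn k).
have mi2 : measurable_fun setT ((fun w => nc_incr k w ^+ 2 / 2) : past k -> R).
  by apply: measurable_funM; [exact: measurable_funX|exact: measurable_cst].
apply: (@fair_step R _ Omega P (before_draw S O k)).
- exact: before_draw_measurable.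
- by move=> b; case: hmeas => _ _ + _; apply.
- by move=> A b HA; exact: hsgn.
- apply: measurable_funM; first exact: measurable_nc_exp_past.
  apply: (@measurableT_comp _ _ _ _ _ _ expR); first exact: measurable_expR.
  by apply: measurable_funB => //; exact: measurable_funN.
- apply: measurable_funM; first exact: measurable_nc_exp_past.
  apply: (@measurableT_comp _ _ _ _ _ _ expR); first exact: measurable_expR.
  by apply: measurable_funB.
- exact: measurable_nc_exp_past.
- by move=> w; rewrite mulr_ge0 ?expR_ge0.
- by move=> w; rewrite mulr_ge0 ?expR_ge0.
- move=> w; rewrite /F1 /F2 -mulrDr [leRHS]mulrC ler_wpM2l ?expR_ge0 //.
  set y := nc_incr k w; rewrite !expRD -mulrDl addrC.
  apply: (@le_trans _ _ (2 * expR (y ^+ 2 / 2) * expR (- (y ^+ 2 / 2)))).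
    by rewrite ler_wpM2r ?expR_ge0 // expRD_expRN_le.
  by rewrite -mulrA -expRD subrr expR0 mulr1.
Qed.

Lemma measurable_nc_exp k : measurable_fun setT (nc_exp k).
Proof.
apply: (measurable_sub (G := before_draw S O k)); last exact: measurable_nc_exp_past.
exact: before_draw_measurable.
Qed.

Lemma prob_nc_exp k a : 0 < a -> (P [set w | (a <= nc_exp k w)%R] <= (a^-1)%:E)%E.
Proof.
move=> a0; apply: markov_real => //; first exact: measurable_nc_exp.
  by move=> w; exact: expR_ge0.
exact: integral_nc_exp.
Qed.

End SignSupermartingale.

(** * Descent along a run *)

Section PathAnalysis.
Context {R : realType} {N d : nat} {dO : measure_display} {Omega : measurableType dO}.
Variables (S : problem R N d) (O : inputs R N d Omega) (D : set 'rV[R]_d) (dlL : R).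
Hypothesis d_gt0 : (0 < d)%N.
Hypotheses (L_gt0 : 0 < Lg S) (M_gt0 : 0 < Mh S).
Hypotheses (eg_gt0 : 0 < epsg S) (eH_gt0 : 0 < epsH S).
Hypothesis hdelta : 0 < delta S <= 1 / 2.
Hypothesis hf : forall i, twice_differentiable (fcomp S i).
Hypothesis hHess : hessian_lipschitz (Mh S) (objective S).
Hypothesis hbelow : forall x, fbar S <= objective S x.
Hypothesis hD : points_of_interest S O D.
Hypothesis hgrad : gradient_lipschitz_on D (Lg S) (objective S).
Hypothesis heig : eigenvector_oracle S O dlL.
Variable w : Omega.

Local Notation x i := (xk S O i w).
Local Notation g i := (gk S O i w).
Local Notation f := (objective S).
Local Notation nabla i := (grad (objective S) (xk S O i w)).
Local Notation hessf i := (hess (objective S) (xk S O i w)).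

Definition accurate i : Prop :=
  enorm (g i - nabla i) <= Num.max (epsg S) (enorm (nabla i)) / 4 /\
  specnorm (Hk S O i w - hessf i) <= 2 / 9 * epsH S.

(** If [|grad f|] exceeds [epsg], the relative error gives [|grad f| <= 4/3 |g|] and an error of at
    most [|g| / 3]; otherwise the error is at most [epsg / 4]. *)
Lemma accurate_grad i : accurate i ->
  (epsg S < enorm (g i) -> enorm (g i - nabla i) <= enorm (g i) / 3) /\
  (enorm (g i) <= epsg S -> enorm (nabla i) <= 4 / 3 * epsg S).
Proof.
case=> + _; have : enorm (nabla i) <= enorm (g i) + enorm (g i - nabla i).
  rewrite -[X in enorm X <= _](subKr (g i)); exact: enormB.
move: (enorm (nabla i)) (enorm (g i)) (enorm (g i - nabla i)) => F G E.
move=> h1 h2; have [h|h] := leP F (epsg S); [rewrite (max_idPl h) in h2|rewrite (max_idPr (ltW h)) in h2];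
  by split=> h3; move: eg_gt0; lra.
Qed.

Lemma reached_le i k : (i <= k)%N -> reached S O k w -> reached S O i w.
Proof. by move=> ik h j ji; apply: h; exact: leq_trans ji ik. Qed.

Lemma xkS_grad i : epsg S < enorm (g i) -> x i.+1 = x i - (Lg S)^-1 *: g i.
Proof. by move=> h; rewrite /= /next_iterate -/(gk S O i w) h. Qed.

Lemma xkS_nc i : nc_step S O i w ->
  x i.+1 = x i + (2 * epsH S / Mh S * (-1) ^+ sgn O i w) *: phat O i w.
Proof.
move=> /andP[h1 h2]; rewrite /= /next_iterate -/(gk S O i w) ltNge h1 /=.
by rewrite -/(Hk S O i w) -/(lamk S O i w) h2.
Qed.

Lemma grad_descent i : reached S O i.+1 w -> accurate i -> epsg S < enorm (g i) ->
  f (x i.+1) <= f (x i) - epsg S ^+ 2 / (6 * Lg S).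
Proof.
move=> ri ac hg; have [E _] := accurate_grad ac; have {}E := E hg.
have xS := xkS_grad hg.
pose s := - ((Lg S)^-1 *: g i).
have xs : x i.+1 = x i + s by rewrite xS.
have hL t : 0 <= t <= 1 -> enorm (grad f (x i + t *: s) - grad f (x i)) <= Lg S * enorm (t *: s).
  move=> t01; have := hD ri t01; rewrite xs [x i + s]addrC addrK => D1.
  have := hD ri (t := 0); rewrite lexx ler01 scale0r addr0 => /(_ isT) D0.
  by have := hgrad D1 D0; rewrite [x i + _]addrC addrK.
have := taylor_grad_lipschitz (differentiable_objective hf) hL.
rewrite -xs /s dotpNr dotpZr enormN enormZ ger0_norm ?invr_ge0 ?(ltW L_gt0) // exprMn.
(* An error of [|g| / 3] leaves [2/3 |g|^2] of the inner product, and the quadratic term takes away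
   [1/2 |g|^2]; the remaining [1/6] is that of [r1]. *)
have dg : 2 / 3 * enorm (g i) ^+ 2 <= dotp (nabla i) (g i).
  have -> : dotp (nabla i) (g i) = enorm (g i) ^+ 2 - dotp (g i - nabla i) (g i).
    by rewrite dotpDl dotpNl enorm_sqr opprD opprK addrA subrr add0r.
  have := dotp_le_enorm (g i - nabla i) (g i).
  have := ler_wpM2r (enorm_ge0 (g i)) E.
  lra.
have eg2 : epsg S ^+ 2 <= enorm (g i) ^+ 2 by rewrite lerXn2r ?nnegrE ?enorm_ge0 ?ltW.
move: (dotp (nabla i) (g i)) (enorm (g i) ^+ 2) dg eg2 => a.
move: (f (x i.+1)) (f (x i)) => fS f0 G2 dg eg2 h.
have Li : 0 < (Lg S)^-1 by rewrite invr_gt0.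
have e1 : Lg S / 2 * ((Lg S)^-1 ^+ 2 * G2) = (Lg S)^-1 * (G2 / 2) by field; rewrite gt_eqF.
have e2 : epsg S ^+ 2 / (6 * Lg S) = (Lg S)^-1 * (epsg S ^+ 2 / 6) by field; rewrite gt_eqF.
rewrite e1 in h; rewrite e2.
have := ler_wpM2l (ltW Li) (_ : epsg S ^+ 2 / 6 <= a - G2 / 2).
move=> /(_ ltac:(lra)); lra.
Qed.

Lemma nc_descent i : reached S O i w -> accurate i -> nc_step S O i w ->
  f (x i.+1) <= f (x i) - 2 * epsH S ^+ 3 / (9 * Mh S ^+ 2) +
    (-1) ^+ sgn O i w * (2 * epsH S / Mh S * dotp (nabla i) (phat O i w)).
Proof.
move=> ri [_ ac] nc; have [np _ _] := heig ri (proj1 (andP nc)).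
rewrite (xkS_nc nc); set c := 2 * epsH S / Mh S * _.
have := taylor_hess_lipschitz (x i) (c *: phat O i w) (twice_differentiable_objective hf) hHess.
(* The coefficient is [-1 + 2/9]: the stopping threshold, weakened by the Hessian error. *)
have q1 : qform (hessf i) (phat O i w) <= - (7 / 9) * epsH S.
  have := normr_qform_le (Hk S O i w - hessf i) np; rewrite qformB ler_norml => /andP[h _].
  have : lamk S O i w < - epsH S by case/andP: nc.
  rewrite /lamk; move: (qform (Hk S O i w) _) (qform (hessf i) _) h => a b h h'.
  move: ac; set sp := specnorm _ in h *; move=> ac; lra.
have c0 : 0 < 2 * epsH S / Mh S by rewrite divr_gt0 // mulr_gt0.
have cabs : `|c| = 2 * epsH S / Mh S by rewrite /c normrM normrX normrN1 expr1n mulr1 gtr0_norm.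
have c2 : c ^+ 2 = (2 * epsH S / Mh S) ^+ 2 by rewrite /c exprMn sqrr_sign mulr1.
have qs : qform (hessf i) (c *: phat O i w) = c ^+ 2 * qform (hessf i) (phat O i w).
  by rewrite !qform_dotp -scalemxAl dotpZl dotpZr mulrA -expr2.
rewrite qs enormZ np mulr1 cabs c2 dotpZr.
have -> : c * dotp (nabla i) (phat O i w) =
   (-1) ^+ sgn O i w * (2 * epsH S / Mh S * dotp (nabla i) (phat O i w)) by rewrite /c; ring.
move: (_ * (_ * dotp _ _)) (f (x i)) (f _) q1 => dd f0 f1; move: (qform _ _) => q q1.
have k1 : (2 * epsH S / Mh S) ^+ 2 * q / 2 <= (2 * epsH S / Mh S) ^+ 2 * (- (7 / 9) * epsH S) / 2.
  by rewrite ler_wpM2r // ler_wpM2l // sqr_ge0.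
(* In units of [epsH^3 / M^2], curvature contributes [-14/9] and the cubic remainder [12/9]. *)
have k2 : (2 * epsH S / Mh S) ^+ 2 * (- (7 / 9) * epsH S) / 2 + Mh S / 6 * (2 * epsH S / Mh S) ^+ 3
   = - (2 * epsH S ^+ 3 / (9 * Mh S ^+ 2)) by field; rewrite gt_eqF.
lra.
Qed.

Lemma nc_stepE i : reached S O i.+1 w -> nc_step S O i w = (enorm (g i) <= epsg S).
Proof.
move=> ri; rewrite /nc_step; case: (boolP (enorm _ <= _)) => //= hg.
rewrite ltNge; apply/negP => hl; exact: (ri i (ltnSn i)).
Qed.

Definition nc_count k : nat := \sum_(i < k) nc_step S O i w.

Definition nc_drift k : R := \sum_(i < k) (-1) ^+ sgn O i w * nc_incr S O 1 i w.

Lemma nc_count_le k : (nc_count k <= k)%N.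
Proof.
rewrite -[X in (_ <= X)%N](card_ord k) -sum1_card; apply: leq_sum => i _.
by case: (nc_step S O i w).
Qed.

Let r1 := epsg S ^+ 2 / (6 * Lg S).
Let r2 := 2 * epsH S ^+ 3 / (9 * Mh S ^+ 2).
Let c := 8 * epsH S * epsg S / (3 * Mh S).

Lemma path_descent k : reached S O k w -> (forall i, (i < k)%N -> accurate i) ->
  f (x k) <= f (x0 S) - (k - nc_count k)%:R * r1 - (nc_count k)%:R * r2 + nc_drift k.
Proof.
elim: k => [|k IH] rk ak.
  by rewrite /nc_count /nc_drift !big_ord0 subnn !mul0r !subr0 addr0.
have {}IH := IH (reached_le (leqnSn k) rk) (fun i ik => ak i (ltnW ik)).
have -> : nc_count k.+1 = (nc_count k + nc_step S O k w)%N by rewrite /nc_count big_ord_recr.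
have -> : nc_drift k.+1 = nc_drift k + (-1) ^+ sgn O k w * nc_incr S O 1 k w.
  by rewrite /nc_drift big_ord_recr.
have ncl := nc_count_le k.
case: (boolP (nc_step S O k w)) => nc.
  have := nc_descent (reached_le (leqnSn k) rk) (ak k (ltnSn k)) nc.
  rewrite /nc_incr nc mul1r -/r2 addn1 subSS -[X in _ - X * r2]natr1.
  by move: (f (x k.+1)) (f (x k)) IH => a b; lra.
have hg : epsg S < enorm (g k) by rewrite ltNge -(nc_stepE rk).
have := grad_descent rk (ak k (ltnSn k)) hg.
rewrite /nc_incr (negPf nc) mulr0 addr0 addn0 subSn // -/r1 -[(k - _).+1%:R]natr1.
by move: (f (x k.+1)) (f (x k)) IH => a b; lra.
Qed.

Lemma nc_incr_bound i : reached S O i w -> accurate i -> nc_step S O i w ->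
  `|nc_incr S O 1 i w| <= c.
Proof.
move=> ri ac nc; have [np _ _] := heig ri (proj1 (andP nc)).
have [_ hg] := accurate_grad ac; have {}hg := hg (proj1 (andP nc)).
rewrite /nc_incr nc mul1r normrM gtr0_norm; last by rewrite divr_gt0 // mulr_gt0.
have dp : `|dotp (nabla i) (phat O i w)| <= 4 / 3 * epsg S.
  by apply: le_trans (normr_dotp_le _ _) _; rewrite np mulr1.
apply: (@le_trans _ _ (2 * epsH S / Mh S * (4 / 3 * epsg S))).
  by rewrite ler_wpM2l // divr_ge0 ?mulr_ge0 ?ltW.
by apply: eq_ler; rewrite /c; field; rewrite gt_eqF.
Qed.

Lemma nc_drift_le k : reached S O k w -> (forall i, (i < k)%N -> accurate i) ->
  nc_drift k <= (nc_count k)%:R * c.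
Proof.
move=> rk ak; rewrite /nc_count natr_sum mulr_suml; apply: ler_sum => i _.
case: (boolP (nc_step S O i w)) => nc; last by rewrite /nc_incr (negPf nc) mulr0 mul0r.
rewrite mul1r; apply: le_trans (ler_norm _) _; rewrite normrM normrX normrN1 expr1n mul1r.
by apply: nc_incr_bound => //; [exact: reached_le (ltnW (ltn_ord i)) rk|exact: ak].
Qed.

(** On an accurate run each increment is at most [lam * c], so the random compensator may be
    replaced by a multiple of the number of negative curvature steps. *)
Lemma nc_exp_ge k (lam : R) : reached S O k w -> (forall i, (i < k)%N -> accurate i) ->
  expR (lam * nc_drift k - (nc_count k)%:R * (lam ^+ 2 * c ^+ 2 / 2)) <= nc_exp S O lam k w.
Proof.
move=> rk ak; rewrite /nc_exp ler_expR sumrB.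
have incrE i : nc_incr S O lam i w = lam * nc_incr S O 1 i w.
  by rewrite /nc_incr; case: ifP => _; rewrite ?mul1r ?mulr0.
apply: lerB.
  rewrite /nc_drift mulr_sumr; apply: ler_sum => i _.
  by rewrite incrE mulrCA.
rewrite /nc_count natr_sum mulr_suml; apply: ler_sum => i _.
case: (boolP (nc_step S O i w)) => nc; last by rewrite /nc_incr (negPf nc) expr0n mul0r mul0r.
rewrite mul1r incrE exprMn ler_wpM2r // ler_wpM2l ?sqr_ge0 //.
rewrite -[leLHS](real_normK (num_real _)) lerXn2r ?nnegrE //.
  by rewrite /c divr_ge0 ?mulr_ge0 ?ltW.
by apply: nc_incr_bound => //; [exact: reached_le (ltnW (ltn_ord i)) rk|exact: ak].
Qed.

Lemma R_eps_le : R_eps S <= r1 /\ R_eps S <= r2.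
Proof. by rewrite /R_eps !ge_min !lexx orbT. Qed.

Lemma R_eps_gt0 : 0 < R_eps S.
Proof.
by rewrite lt_min !divr_gt0 ?mulr_gt0 ?exprn_gt0.
Qed.

Lemma Cconst_gt0 : 0 < Cconst S.
Proof. by rewrite mulr_gt0 ?ltr0n // divr_gt0 ?mulr_gt0 ?exprn_gt0. Qed.

Lemma Bconst_ge1 : 1 <= Bconst S.
Proof. by rewrite lerDl divr_ge0 ?mulr_ge0 ?ltW. Qed.

Lemma gap_ge0 : 0 <= gap S.
Proof. by rewrite subr_ge0. Qed.

Lemma Kbar_ge_Cconst : Cconst S <= Kbar S.
Proof. by rewrite /Kbar ler_peMr ?(ltW Cconst_gt0) // !le_max lexx !orbT. Qed.

(** Origin of the constant 2304: the left side is the exponent gained per negative curvature step at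
    the optimal rate when the drift eats half of the decrease. *)
Lemma drift_rate_eq : r2 ^+ 2 / (8 * c ^+ 2) = 2 / Cconst S.
Proof.
by rewrite /r2 /c /Cconst; field; rewrite !gt_eqF.
Qed.

(* The minimizer of [lam ^+ 2 * c ^+ 2 / 2 - lam * r2 / 2]. *)
Definition sign_rate : R := r2 / (2 * c ^+ 2).

Lemma iteration_bound T : reached S O T w -> (forall i, (i < T)%N -> accurate i) ->
  nc_exp S O sign_rate T w < (delta S) ^- 2 -> T%:R <= n_iter S.
Proof.
move=> rT aT hexp.
have [Rr1 Rr2] := R_eps_le; have R0 := R_eps_gt0.
have r10 : 0 < r1 by apply: lt_le_trans Rr1.
have r20 : 0 < r2 by apply: lt_le_trans Rr2.
have c0 : 0 < c by rewrite divr_gt0 ?mulr_gt0.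
have C0 := Cconst_gt0; have B1 := Bconst_ge1; have g0 := gap_ge0.
have K0 : 0 <= Kbar S by apply: le_trans (ltW C0) Kbar_ge_Cconst.
have /andP[d0 d1] := hdelta.
have ncT := nc_count_le T; set k2 := nc_count T in ncT.
have Tk : T%:R = (T - k2)%:R + k2%:R :> R by rewrite -natrD subnK.
have desc := path_descent rT aT; rewrite -/k2 in desc.
have {}desc : (T - k2)%:R * r1 + k2%:R * r2 <= gap S + nc_drift T.
  by have := hbelow (x T); rewrite /gap; lra.
have k1R : (T - k2)%:R * R_eps S <= (T - k2)%:R * r1 by rewrite ler_wpM2l.
have k2R : k2%:R * R_eps S <= k2%:R * r2 by rewrite ler_wpM2l.
have BK : 0 <= Bconst S * Kbar S by rewrite mulr_ge0 // (le_trans ler01).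
have [hk|hk] := leP (Cconst S * ln (delta S)^-1) k2%:R.
  (* A larger drift would make the exponent at least [2 k2 / Cconst], hence at least
     [2 ln (1/delta)], against the bound on [nc_exp]. *)
  have drift : nc_drift T < k2%:R * r2 / 2.
    rewrite ltNge; apply/negP => hdr; move: hexp; apply/negP; rewrite -leNgt.
    apply: le_trans (nc_exp_ge sign_rate rT aT); rewrite -/k2.
    have -> : delta S ^- 2 = expR (2 * ln (delta S)^-1).
      rewrite (_ : 2 * ln _ = ln ((delta S)^-1 ^+ 2)); last by rewrite lnXn ?invr_gt0 // mulr_natl.
      by rewrite lnK ?exprVn // posrE invr_gt0 exprn_gt0.
    rewrite ler_expR.
    have s0 : 0 <= sign_rate by rewrite divr_ge0 ?(ltW r20) // mulr_ge0 ?sqr_ge0.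
    have h1 : sign_rate * (k2%:R * r2 / 2) <= sign_rate * nc_drift T by rewrite ler_wpM2l.
    have h2 : sign_rate * (k2%:R * r2 / 2) - k2%:R * (sign_rate ^+ 2 * c ^+ 2 / 2) =
       k2%:R * (2 / Cconst S).
      by rewrite -drift_rate_eq /sign_rate; field; rewrite gt_eqF.
    have h3 : 2 * ln (delta S)^-1 <= k2%:R * (2 / Cconst S).
      rewrite mulrA ler_pdivlMr //; move: hk.
      by move: (ln _) (k2%:R) (Cconst S) => a b e; lra.
    lra.
  have : 0 <= (T - k2)%:R * r1 by rewrite mulr_ge0 // ltW.
  move=> k10; have hT : T%:R * R_eps S <= 2 * gap S by rewrite Tk mulrDl; lra.
  rewrite /n_iter mulrA; apply: le_trans (_ : 2 * gap S / R_eps S <= _); last by rewrite lerDl.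
  by rewrite ler_pdivlMr.
(* Few negative curvature steps: their own decrease is discarded, and the drift pays for at most
   [c / r1] extra gradient steps each. *)
have drift := nc_drift_le rT aT; rewrite -/k2 in drift.
have k2K : k2%:R <= Kbar S.
  apply: le_trans (ltW hk) _; rewrite /Kbar ler_wpM2l ?(ltW C0) //.
  by rewrite le_max lexx.
have k1 : (T - k2)%:R <= gap S / R_eps S + k2%:R * (c / r1).
  have h1 : (T - k2)%:R * r1 <= gap S + k2%:R * c.
    have : 0 <= k2%:R * r2 by rewrite mulr_ge0 // ltW.
    lra.
  have h2 : (T - k2)%:R <= (gap S + k2%:R * c) / r1 by rewrite ler_pdivlMr.
  apply: le_trans h2 _; rewrite mulrDl -mulrA lerD2r ler_wpM2l // lef_pV2 ?posrE //.
(* The exact coefficient is 16, within the 18 of [Bconst]. *)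
have cr : 1 + c / r1 <= Bconst S.
  rewrite /Bconst lerD2l.
  have -> : c / r1 = 16 * epsH S * Lg S / (Mh S * epsg S) by rewrite /c /r1; field; rewrite !gt_eqF.
  rewrite ler_wpM2r ?invr_ge0 ?mulr_ge0 ?(ltW M_gt0) ?(ltW eg_gt0) //.
  by rewrite -!mulrA ler_wpM2r ?mulr_ge0 ?(ltW eH_gt0) ?(ltW L_gt0) // ler_nat.
have cr0 : 0 <= 1 + c / r1 by rewrite addr_ge0 // divr_ge0 ?ltW.
have h3 : k2%:R * (1 + c / r1) <= Kbar S * Bconst S.
  by apply: ler_pM.
have gR : 0 <= gap S / R_eps S by rewrite divr_ge0 // ltW.
rewrite Tk /n_iter [Bconst S * _]mulrC; lra.
Qed.

Lemma approx_sosp_returned i : returns_at S O i w -> accurate i ->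
  approx_sosp f (4 / 3 * epsg S) (4 / 3 * epsH S) (x i).
Proof.
move=> [ri [hg hl]] ac; have [_ h1] := accurate_grad ac.
split; first exact: h1.
have [_ hlam _] := heig ri hg; case: ac => _ hH.
have symf := hess_sym (x i) (twice_differentiable_objective hf).
have symH : (Hk S O i w)^T = Hk S O i w.
  rewrite /Hk /hess_oracle linearZ /= raddf_sum; congr (_ *: _).
  by apply: eq_bigr => j _; exact: hess_sym.
(* The losses are [1] from the stopping test, [1/9] from the eigenvalue and [2/9] from sampling, in
   units of [epsH]. *)
have := lambda_min_perturb d_gt0 symf symH.
rewrite -specnormN opprB; move: hlam; rewrite ler_norml => /andP[_ hlam].
move: (lambda_min (hessf i)) (lambda_min _) (specnorm _) (lamk S O i w) hlam hl hH => a b e l.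
lra.
Qed.

End PathAnalysis.

(** * Number of sample-operations *)

Section RateCoefficients.
Context {R : realType}.
Implicit Types L M Gam G K a : R.

(** Coefficient of the log factor in a bound on [ln (a E^m)]; [1 + a] keeps the logarithm
    nonnegative. *)
Definition log_coef a (m : nat) : R := ln (1 + a) + m%:R.

Definition gap_coef L M Gam : R := Gam * (6 * L + 9 / 2 * M ^+ 2).

Definition BC_coef L M : R := 2304 * (M ^+ 2 + 18 * L * M * (1 + L)).

Definition Kbar_coef L M Gam : R :=
  2 + log_coef (12 * gap_coef L M Gam) 6 + 2 * log_coef (6 * BC_coef L M) 6.

Definition n_iter_coef L M Gam : R :=
  2 * gap_coef L M Gam + BC_coef L M * Kbar_coef L M Gam.

Definition xi_log_coef L M Gam : R := log_coef (6 * n_iter_coef L M Gam) 9.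

Definition size_g_coef L M Gam G : R :=
  2 * Num.sqrt L ^+ 5 + 256 * G ^+ 2 * xi_log_coef L M Gam.

Definition size_H_coef L M Gam K : R :=
  2 * Num.sqrt L ^+ 4 + 484 * K ^+ 2 * xi_log_coef L M Gam.

Definition lanczos_coef L K : R :=
  Num.sqrt L + 2 * log_coef 25 3 * (Num.sqrt K + Num.sqrt L).

(** The witness for the constant hidden by the soft-O: a number of steps, times a cost per step,
    times the price of absorbing lower-order terms into [rate]. *)
Definition ops_coef L M Gam G K : R :=
  2 * n_iter_coef L M Gam
  * (size_g_coef L M Gam G + lanczos_coef L K * size_H_coef L M Gam K)
  * (5 + Num.sqrt L + Num.sqrt L ^+ 3).

Lemma log_coef_ge0 a m : 0 <= a -> 0 <= log_coef a m.
Proof. by move=> a0; rewrite addr_ge0 // ln_ge0 // lerDl. Qed.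

Lemma gap_coef_ge0 L M Gam : 0 <= L -> 0 <= Gam -> 0 <= gap_coef L M Gam.
Proof. by move=> *; rewrite mulr_ge0 // addr_ge0 // mulr_ge0 // sqr_ge0. Qed.

Lemma BC_coef_ge0 L M : 0 <= L -> 0 <= M -> 0 <= BC_coef L M.
Proof.
move=> L0 M0; rewrite mulr_ge0 ?ler0n // addr_ge0 ?sqr_ge0 //.
by rewrite !mulr_ge0 // addr_ge0.
Qed.

Lemma Kbar_coef_ge1 L M Gam : 0 <= L -> 0 <= M -> 0 <= Gam -> 1 <= Kbar_coef L M Gam.
Proof.
move=> L0 M0 G0; rewrite /Kbar_coef.
have h1 : 0 <= log_coef (12 * gap_coef L M Gam) 6 by rewrite log_coef_ge0 // mulr_ge0 // gap_coef_ge0.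
have h2 : 0 <= log_coef (6 * BC_coef L M) 6 by rewrite log_coef_ge0 // mulr_ge0 // BC_coef_ge0.
lra.
Qed.

Lemma n_iter_coef_ge0 L M Gam : 0 <= L -> 0 <= M -> 0 <= Gam -> 0 <= n_iter_coef L M Gam.
Proof.
move=> L0 M0 G0; have g0 := gap_coef_ge0 M L0 G0; have b0 := BC_coef_ge0 L0 M0.
have k0 := le_trans ler01 (Kbar_coef_ge1 L0 M0 G0).
apply: addr_ge0; last exact: mulr_ge0.
by rewrite mulr_ge0.
Qed.

Lemma xi_log_coef_ge0 L M Gam : 0 <= L -> 0 <= M -> 0 <= Gam -> 0 <= xi_log_coef L M Gam.
Proof. move=> *; apply: log_coef_ge0; apply: mulr_ge0; [exact: ler0n|exact: n_iter_coef_ge0]. Qed.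

Lemma size_g_coef_ge0 L M Gam G : 0 <= L -> 0 <= M -> 0 <= Gam -> 0 <= size_g_coef L M Gam G.
Proof.
move=> L0 M0 G0; have c0 := xi_log_coef_ge0 L0 M0 G0.
apply: addr_ge0; first by rewrite mulr_ge0 // exprn_ge0 // sqrtr_ge0.
apply: mulr_ge0 c0; apply: mulr_ge0; [exact: ler0n|exact: sqr_ge0].
Qed.

Lemma size_H_coef_ge0 L M Gam K : 0 <= L -> 0 <= M -> 0 <= Gam -> 0 <= size_H_coef L M Gam K.
Proof.
move=> L0 M0 G0; have c0 := xi_log_coef_ge0 L0 M0 G0.
apply: addr_ge0; first by rewrite mulr_ge0 // exprn_ge0 // sqrtr_ge0.
apply: mulr_ge0 c0; apply: mulr_ge0; [exact: ler0n|exact: sqr_ge0].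
Qed.

Lemma lanczos_coef_ge0 L K : 0 <= lanczos_coef L K.
Proof.
have l0 : 0 <= log_coef (25 : R) 3 by apply: log_coef_ge0; exact: ler0n.
apply: addr_ge0; first exact: sqrtr_ge0.
apply: mulr_ge0; last by rewrite addr_ge0 ?sqrtr_ge0.
by rewrite mulr_ge0.
Qed.

End RateCoefficients.

Section RateBound.
Context {R : realType} {N d : nat}.
Variables (S : problem R N d) (dlL : R).
Hypothesis d_gt0 : (0 < d)%N.
Hypotheses (L_gt0 : 0 < Lg S) (M_gt0 : 0 < Mh S).
Hypotheses (eg_gt0 : 0 < epsg S) (eH_gt0 : 0 < epsH S) (eH_le : epsH S <= Lg S).
Hypothesis hdelta : 0 < delta S <= 1 / 2.
Hypothesis hbelow : forall x, fbar S <= objective S x.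
Hypothesis hn : 1 <= n_iter S.
Hypothesis hdlL : 0 < dlL < 1.

(* In these variables [rate] is the maximum of [u^4], [u^2 v^6], [v^11] and
   [u^-2 v^13], and [n_iter] is at most a constant times [Lam * Q]. Every
   argument of a logarithm is bounded by a power of [E]. *)
Let u := (epsg S)^-1.
Let v := (Num.sqrt (epsH S))^-1.
Let sg := Num.sqrt (Lg S).
Let Lam := log_factor (epsg S) (epsH S) (delta S) dlL d.
Let E := expR Lam.
Let Q := u ^+ 2 + v ^+ 6 + u ^- 2 * v ^+ 8.
Local Notation Gam := (gap S).

Lemma inv_epsg_gt0 : 0 < u. Proof. by rewrite invr_gt0. Qed.
Lemma inv_sqrt_epsH_gt0 : 0 < v. Proof. by rewrite invr_gt0 sqrtr_gt0. Qed.
Lemma sqrt_Lg_gt0 : 0 < sg. Proof. by rewrite sqrtr_gt0. Qed.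

Lemma inv_sqrt_epsH_sqr : v ^+ 2 = (epsH S)^-1.
Proof. by rewrite /v exprVn sqr_sqrtr // ltW. Qed.

(** From [epsH <= L]. It lets constants and lower powers of [v] be raised to higher powers, at the
    price of powers of [sg]. *)
Lemma sqrt_Lg_epsH_ge1 : 1 <= sg * v.
Proof.
rewrite /sg /v; apply: le_trans (_ : Num.sqrt (epsH S) / Num.sqrt (epsH S) <= _).
  by rewrite divff // gt_eqF // sqrtr_gt0.
by rewrite ler_wpM2r ?invr_ge0 ?sqrtr_ge0 // ler_sqrt // ltW.
Qed.

Lemma log_terms_ge0 : [/\ 0 <= ln (delta S)^-1, 0 <= ln dlL^-1 & 0 <= ln d%:R :> R].
Proof.
have /andP[d0 d1] := hdelta; have /andP[l0 l1] := hdlL.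
split; apply: ln_ge0; last by rewrite ler1n.
  by rewrite invf_ge1 //; lra.
by rewrite invf_ge1 // ltW.
Qed.

Lemma log_factor_ge1 : 1 <= Lam.
Proof.
have [h1 h2 h3] := log_terms_ge0; rewrite /Lam /log_factor.
have := normr_ge0 (ln (epsg S)); have := normr_ge0 (ln (epsH S)); lra.
Qed.

Lemma le_expR_Lam x : 0 < x -> ln x <= Lam -> x <= E.
Proof. by move=> x0 h; rewrite -[x]lnK ?posrE // ler_expR. Qed.

Lemma tolerances_le_exp_log : [/\ 1 <= E, Lam <= E, u <= E, u^-1 <= E & v ^+ 2 <= E].
Proof.
have L1 := log_factor_ge1; have LE : Lam <= E by have := expR_ge1Dx Lam; rewrite /E; lra.
have [h1 h2 h3] := log_terms_ge0.
have a1 := ler_norm (ln (epsg S)); have a2 := ler_norm (- ln (epsg S)).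
have a3 := ler_norm (- ln (epsH S)); have a4 := normr_ge0 (ln (epsH S)).
have a5 := normr_ge0 (ln (epsg S)).
rewrite !normrN in a2 a3; split => //; first exact: le_trans LE.
- by apply: le_expR_Lam; rewrite ?inv_epsg_gt0 // /u lnV ?posrE // /Lam /log_factor; lra.
- by rewrite /u invrK; apply: le_expR_Lam => //; rewrite /Lam /log_factor; lra.
by rewrite inv_sqrt_epsH_sqr; apply: le_expR_Lam; rewrite ?invr_gt0 // lnV ?posrE // /Lam /log_factor; lra.
Qed.

Lemma params_le_exp_log : [/\ (delta S)^-1 <= E, dlL^-1 <= E & d%:R <= E].
Proof.
have /andP[d0 d1] := hdelta; have /andP[l0 l1] := hdlL.
have [h1 h2 h3] := log_terms_ge0.
have a4 := normr_ge0 (ln (epsH S)); have a5 := normr_ge0 (ln (epsg S)).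
by split; apply: le_expR_Lam; rewrite ?invr_gt0 ?ltr0n // /Lam /log_factor; lra.
Qed.

Lemma ln_le_log_coef a m (x : R) : 0 <= a -> x <= a * E ^+ m -> ln x <= log_coef a m * Lam.
Proof.
move=> a0 hx; have L1 := log_factor_ge1; have [x0|x0] := leP x 0.
  (* The logarithm is [0] on nonpositive arguments; this covers [gap = 0]. *)
  by rewrite ln0 // mulr_ge0 ?log_coef_ge0 // (le_trans ler01).
have Em : 0 < E ^+ m by rewrite exprn_gt0 // expR_gt0.
have le1 : x <= (1 + a) * E ^+ m.
  by apply: le_trans hx _; rewrite ler_wpM2r ?(ltW Em) // lerDr.
have a1 : 0 < 1 + a by rewrite ltr_pwDl.
apply: le_trans (_ : ln ((1 + a) * E ^+ m) <= _); first by rewrite ler_ln ?posrE // mulr_gt0.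
rewrite lnM ?posrE // lnXn ?expR_gt0 // expRK /log_coef mulrDl -[_ *+ m]mulr_natl lerD2r.
by rewrite ler_peMr // ln_ge0 // lerDl.
Qed.

Lemma step_budget_ge0 : 0 <= Q.
Proof. by rewrite !addr_ge0 // ?mulr_ge0 ?invr_ge0 ?exprn_ge0 // ltW // ?inv_epsg_gt0 ?inv_sqrt_epsH_gt0. Qed.

Lemma step_budget_le : Q <= 3 * E ^+ 6.
Proof.
have [E1 _ uE uE' vE] := tolerances_le_exp_log; have u0 := inv_epsg_gt0; have v0 := inv_sqrt_epsH_gt0.
have E0 : 0 < E by apply: lt_le_trans E1.
have pE m : (m <= 6)%N -> E ^+ m <= E ^+ 6 by move=> h; rewrite ler_weXn2l.
have h1 : u ^+ 2 <= E ^+ 6.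
  by apply: le_trans (pE 2%N isT); rewrite lerXn2r ?nnegrE // ltW.
have h2 : v ^+ 6 <= E ^+ 6.
  apply: le_trans (pE 3%N isT); rewrite (_ : v ^+ 6 = (v ^+ 2) ^+ 3); last by rewrite -exprM.
  by rewrite lerXn2r ?nnegrE ?exprn_ge0 // ltW.
have h3 : u ^- 2 * v ^+ 8 <= E ^+ 6.
  rewrite (_ : E ^+ 6 = E ^+ 2 * E ^+ 4); last by rewrite -exprD.
  rewrite (_ : v ^+ 8 = (v ^+ 2) ^+ 4); last by rewrite -exprM.
  rewrite -exprVn; apply: ler_pM; [exact: sqr_ge0|by rewrite !exprn_ge0 // ltW| |].
    have iu0 : 0 <= u^-1 by rewrite invrK ltW.
    by rewrite lerXn2r ?nnegrE // ltW.
  by rewrite lerXn2r ?nnegrE ?exprn_ge0 // ltW.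
rewrite /Q; lra.
Qed.

(** The reciprocal of a minimum is the maximum of the reciprocals, here multiples of [u^2] and
    [v^6], both summands of [Q]. *)
Lemma gap_R_eps_le : gap S / R_eps S <= gap_coef (Lg S) (Mh S) Gam * Q.
Proof.
have g0 := gap_ge0 hbelow; rewrite /gap_coef -mulrA ler_wpM2l //.
have u0 := inv_epsg_gt0; have v0 := inv_sqrt_epsH_gt0.
have e1 : (epsg S ^+ 2 / (6 * Lg S))^-1 = 6 * Lg S * u ^+ 2.
  by rewrite /u; field; rewrite !gt_eqF.
have e2 : (2 * epsH S ^+ 3 / (9 * Mh S ^+ 2))^-1 = 9 / 2 * Mh S ^+ 2 * v ^+ 6.
  rewrite (_ : v ^+ 6 = (v ^+ 2) ^+ 3); last by rewrite -exprM.
  by rewrite inv_sqrt_epsH_sqr; field; rewrite !gt_eqF.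
have p1 : 0 <= 6 * Lg S by rewrite mulr_ge0 // ltW.
have p2 : 0 <= 9 / 2 * Mh S ^+ 2 by rewrite mulr_ge0 // sqr_ge0.
have q1 : 0 <= u ^+ 2 by rewrite sqr_ge0.
have q2 : 0 <= v ^+ 6 by rewrite exprn_ge0 // ltW.
have q3 : 0 <= u ^- 2 * v ^+ 8 by rewrite mulr_ge0 ?invr_ge0 ?exprn_ge0 // ltW.
have -> : (R_eps S)^-1 = Num.max (6 * Lg S * u ^+ 2) (9 / 2 * Mh S ^+ 2 * v ^+ 6).
  rewrite -e1 -e2 /R_eps.
  have p3 : 0 < epsg S ^+ 2 / (6 * Lg S) by rewrite divr_gt0 ?mulr_gt0 ?exprn_gt0.
  have p4 : 0 < 2 * epsH S ^+ 3 / (9 * Mh S ^+ 2) by rewrite divr_gt0 ?mulr_gt0 ?exprn_gt0.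
  move: (_ / _) (_ / _) p3 p4 => a b b0 a0.
  case: (leP b a) => ab; first by rewrite (max_idPl _) // lef_pV2 ?posrE.
  by rewrite (max_idPr _) // lef_pV2 ?posrE // ltW.
rewrite /Q; move: (6 * Lg S) (9 / 2 * _) (u ^+ 2) (v ^+ 6) (u ^- 2 * _) p1 p2 q1 q2 q3.
move=> a b p q r a0 b0 p0 q0 r0.
have := mulr_ge0 a0 p0; have := mulr_ge0 a0 q0; have := mulr_ge0 a0 r0.
have := mulr_ge0 b0 p0; have := mulr_ge0 b0 q0; have := mulr_ge0 b0 r0.
by rewrite ge_max; move=> *; apply/andP; split; lra.
Qed.

(** The product has a main term [u^-2 v^8] and a cross term [u^-1 v^6]. The cross term is the
    geometric mean of [u^-2 v^8] and [v^4], and [v^4 <= L v^6]. *)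
Lemma BC_le : Bconst S * Cconst S <= BC_coef (Lg S) (Mh S) * Q.
Proof.
have u0 := inv_epsg_gt0; have v0 := inv_sqrt_epsH_gt0.
have sv : 1 <= Lg S * v ^+ 2.
  rewrite -[Lg S]sqr_sqrtr ?(ltW L_gt0) // -exprMn.
  exact: exprn_ege1 sqrt_Lg_epsH_ge1.
have -> : Bconst S * Cconst S = 2304 * (Mh S ^+ 2 * (u ^- 2 * v ^+ 8) +
    18 * Lg S * Mh S * (u^-1 * v ^+ 6)).
  rewrite /Bconst /Cconst; move: (2304 : R) => c.
  rewrite (_ : v ^+ 8 = (v ^+ 2) ^+ 4); last by rewrite -exprM.
  rewrite (_ : v ^+ 6 = (v ^+ 2) ^+ 3); last by rewrite -exprM.
  by rewrite inv_sqrt_epsH_sqr /u; field; rewrite !gt_eqF.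
rewrite /BC_coef -[X in _ <= X]mulrA ler_wpM2l ?ler0n // [_ * Q]mulrDl.
have q0 := step_budget_ge0.
have h8 : u ^- 2 * v ^+ 8 <= Q.
  by rewrite /Q lerDr addr_ge0 ?exprn_ge0 // ltW.
have h6 : v ^+ 6 <= Q.
  by rewrite /Q -addrA addrCA lerDl addr_ge0 ?mulr_ge0 ?invr_ge0 ?exprn_ge0 // ltW.
have h : u^-1 * v ^+ 6 <= (1 + Lg S) * Q.
  have ag : u^-1 * v ^+ 6 <= u ^- 2 * v ^+ 8 + v ^+ 4.
    rewrite -exprVn; have := sqr_ge0 (u^-1 * v ^+ 4 - v ^+ 2).
    have : 0 <= (u^-1 * v ^+ 4) ^+ 2 by exact: sqr_ge0.
    have : 0 <= (v ^+ 2) ^+ 2 by exact: sqr_ge0.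
    have -> : (v ^+ 2) ^+ 2 = v ^+ 4 by rewrite -exprM.
    have -> : (u^-1 * v ^+ 4) ^+ 2 = u^-1 ^+ 2 * v ^+ 8 by rewrite exprMn -!exprM.
    have -> : (u^-1 * v ^+ 4 - v ^+ 2) ^+ 2 = u^-1 ^+ 2 * v ^+ 8 + v ^+ 4 - 2 * (u^-1 * v ^+ 6) by ring.
    by move: (u^-1 ^+ 2 * _) (v ^+ 4) (u^-1 * _) => *; lra.
  have v4 : v ^+ 4 <= Lg S * v ^+ 6.
    rewrite (_ : v ^+ 6 = v ^+ 2 * v ^+ 4); last by rewrite -exprD.
    by rewrite mulrA ler_peMl // exprn_ge0 // ltW.
  have : Lg S * v ^+ 6 <= Lg S * Q by rewrite ler_wpM2l // ltW.
  lra.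
apply: lerD; first by rewrite ler_wpM2l ?sqr_ge0.
rewrite -[X in _ <= X]mulrA ler_wpM2l //.
by rewrite !mulr_ge0 // ltW.
Qed.

Lemma Kbar_le : Kbar S <= Cconst S * (Kbar_coef (Lg S) (Mh S) Gam * Lam).
Proof.
have C0 : 0 < Cconst S by exact: Cconst_gt0.
have g0 := gap_ge0 hbelow.
have L1 := log_factor_ge1; have [ld0 _ _] := log_terms_ge0.
have gc0 := gap_coef_ge0 (Mh S) (ltW L_gt0) g0.
have bc0 := BC_coef_ge0 (ltW L_gt0) (ltW M_gt0).
have QE := step_budget_le.
rewrite /Kbar ler_wpM2l ?(ltW C0) //.
have ldL : ln (delta S)^-1 <= Lam.
  rewrite /Lam /log_factor; have [_ + +] := log_terms_ge0.
  have := normr_ge0 (ln (epsg S)); have := normr_ge0 (ln (epsH S)); lra.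
have h1 : ln (4 * (gap S / R_eps S)) <= log_coef (12 * gap_coef (Lg S) (Mh S) Gam) 6 * Lam.
  apply: ln_le_log_coef; first by rewrite mulr_ge0.
  have h := gap_R_eps_le; have := ler_wpM2l gc0 QE; lra.
have h2 : ln (2 * Bconst S * Cconst S) <= log_coef (6 * BC_coef (Lg S) (Mh S)) 6 * Lam.
  apply: ln_le_log_coef; first by rewrite mulr_ge0.
  have h := BC_le; have := ler_wpM2l bc0 QE.
  rewrite -mulrA; move: (Bconst S * _) (BC_coef _ _) h => a b; lra.
have L0 := le_trans ler01 L1.
have k1 : 0 <= log_coef (12 * gap_coef (Lg S) (Mh S) Gam) 6 * Lam.
  by rewrite mulr_ge0 // log_coef_ge0 // mulr_ge0.
have k2 : 0 <= log_coef (6 * BC_coef (Lg S) (Mh S)) 6 * Lam.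
  by rewrite mulr_ge0 // log_coef_ge0 // mulr_ge0.
rewrite /Kbar_coef; move: (log_coef _ 6) (log_coef _ 6) h1 h2 k1 k2 => a b h1 h2 k1 k2.
move: (ln _) (ln (2 * _ * _)) (ln _) ldL h1 h2 => x y z ldL h1 h2.
by rewrite !ge_max; apply/and4P; split; lra.
Qed.

Lemma n_iter_le : n_iter S <= n_iter_coef (Lg S) (Mh S) Gam * Lam * Q.
Proof.
have g0 := gap_ge0 hbelow; have L1 := log_factor_ge1; have Q0 := step_budget_ge0.
have gc0 := gap_coef_ge0 (Mh S) (ltW L_gt0) g0.
have K1 := Kbar_coef_ge1 (ltW L_gt0) (ltW M_gt0) g0.
have B1 : 1 <= Bconst S by exact: Bconst_ge1.
have h1 : 2 * (gap S / R_eps S) <= 2 * (gap_coef (Lg S) (Mh S) Gam * Q) * Lam.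
  apply: (@le_trans _ _ (2 * (gap_coef (Lg S) (Mh S) Gam * Q))).
    by rewrite ler_wpM2l // gap_R_eps_le.
  by rewrite ler_peMr // mulr_ge0 // mulr_ge0.
have h2 : Bconst S * Kbar S <= BC_coef (Lg S) (Mh S) * Q * (Kbar_coef (Lg S) (Mh S) Gam * Lam).
  apply: (@le_trans _ _ (Bconst S * (Cconst S * (Kbar_coef (Lg S) (Mh S) Gam * Lam)))).
    by rewrite ler_wpM2l ?Kbar_le // (le_trans ler01).
  rewrite mulrA ler_wpM2r ?BC_le // mulr_ge0 ?(le_trans ler01 L1) //.
  exact: le_trans ler01 K1.
rewrite /n_iter /n_iter_coef -mulrA [_ * (Lam * Q)]mulrDl; apply: lerD.
  by apply: le_trans h1 _; apply: eq_ler; ring.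
apply: le_trans h2 _; apply: eq_ler.
by move: (BC_coef _ _) => a; ring.
Qed.

Lemma n_iter_le_exp : n_iter S <= 3 * n_iter_coef (Lg S) (Mh S) Gam * E ^+ 7.
Proof.
have n0 := n_iter_coef_ge0 (ltW L_gt0) (ltW M_gt0) (gap_ge0 hbelow).
have [E1 LE _ _ _] := tolerances_le_exp_log; have L1 := log_factor_ge1.
apply: le_trans n_iter_le _; rewrite [3 * _]mulrC -!mulrA ler_wpM2l //.
rewrite (_ : 3 * E ^+ 7 = E * (3 * E ^+ 6)); last by rewrite exprS mulrCA.
by apply: ler_pM => //; rewrite ?step_budget_ge0 ?step_budget_le // (le_trans ler01).
Qed.

(** The powers of [E] add up: seven from [n_iter], one from [1/delta] and one from [d]. *)
Lemma ln_xi_le : ln (xi S)^-1 <= xi_log_coef (Lg S) (Mh S) Gam * Lam /\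
  ln (2 * d%:R / xi S) <= xi_log_coef (Lg S) (Mh S) Gam * Lam.
Proof.
have n0 := n_iter_coef_ge0 (ltW L_gt0) (ltW M_gt0) (gap_ge0 hbelow).
have [E1 _ _ _ _] := tolerances_le_exp_log; have [dE _ ddE] := params_le_exp_log.
have /andP[d0 _] := hdelta.
have E0 : 0 <= E := le_trans ler01 E1.
have xiE : (xi S)^-1 <= 3 * n_iter_coef (Lg S) (Mh S) Gam * E ^+ 8.
  rewrite /xi invf_div exprSr mulrA; apply: ler_pM => //; rewrite ?n_iter_le_exp //.
    exact: le_trans ler01 hn.
  by rewrite invr_ge0 ltW.
have E9 : E ^+ 8 <= E ^+ 9 by rewrite ler_weXn2l.
have nE := ler_wpM2l n0 E9.
have n8 : 0 <= n_iter_coef (Lg S) (Mh S) Gam * E ^+ 9 by rewrite mulr_ge0 ?exprn_ge0.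
split; apply: ln_le_log_coef; rewrite ?mulr_ge0 //.
  by move: (n_iter_coef _ _ _) xiE nE n8 => a; move: (E ^+ 8) (E ^+ 9) => p q; lra.
have x0 : 0 <= (xi S)^-1 by rewrite invr_ge0 divr_ge0 ?(ltW d0) // (le_trans ler01).
have := ler_pM (ler0n _ d) x0 ddE xiE.
have -> : E * (3 * n_iter_coef (Lg S) (Mh S) Gam * E ^+ 8) =
  3 * n_iter_coef (Lg S) (Mh S) Gam * E ^+ 9 by rewrite [E ^+ 9]exprS mulrCA.
move: (n_iter_coef _ _ _) => a; move: (E ^+ 9) => q; rewrite -!mulrA.
by move: (_ * (xi S)^-1) => b; lra.
Qed.

(** The summand [v^5] absorbs the rounding constant of [batch_size_lt]. It is the order of one
    eigenvector computation, [v] products with [v^4] samples each, so it does not worsen the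
    rate. *)
Lemma size_g_le G x : 0 <= Gbd S x <= G ->
  (size_g S x)%:R <= size_g_coef (Lg S) (Mh S) Gam G * Lam * (u ^+ 2 + v ^+ 5).
Proof.
move=> /andP[g0 gG]; have u0 := inv_epsg_gt0; have v0 := inv_sqrt_epsH_gt0; have L1 := log_factor_ge1.
have c0 := xi_log_coef_ge0 (ltW L_gt0) (ltW M_gt0) (gap_ge0 hbelow).
have [hx _] := ln_xi_le.
apply: le_trans (batch_size_lt _) _; rewrite /size_g_coef.
set mg := Num.max _ (enorm _).
have mg0 : 0 < mg by rewrite lt_max eg_gt0.
have h1 : (Gbd S x / mg) ^+ 2 <= G ^+ 2 * u ^+ 2.
  have Gu : 0 <= G * u by rewrite mulr_ge0 ?(ltW u0) // (le_trans g0).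
  rewrite -exprMn lerXn2r ?nnegrE ?(divr_ge0 g0) ?(ltW mg0) //.
  apply: ler_pM => //; first by rewrite invr_ge0 ltW.
  by rewrite lef_pV2 ?posrE // le_max lexx.
have p2 : 0 <= (Gbd S x / mg) ^+ 2 := sqr_ge0 _.
have pc : 0 <= xi_log_coef (Lg S) (Mh S) Gam * Lam by rewrite mulr_ge0 // (le_trans ler01).
move: (256 : R) (ler0n R 256) => q q0.
have h2 : q * (Gbd S x / mg) ^+ 2 * ln (xi S)^-1 <=
    q * (G ^+ 2 * u ^+ 2) * (xi_log_coef (Lg S) (Mh S) Gam * Lam).
  apply: (@le_trans _ _ (q * (Gbd S x / mg) ^+ 2 * (xi_log_coef (Lg S) (Mh S) Gam * Lam))).
    by rewrite ler_wpM2l // mulr_ge0.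
  by rewrite ler_wpM2r // ler_wpM2l.
have h3 : 0 <= q * (G ^+ 2 * u ^+ 2) * (xi_log_coef (Lg S) (Mh S) Gam * Lam).
  by rewrite mulr_ge0 // mulr_ge0 // mulr_ge0 // sqr_ge0.
have h4 : Num.max 0 (q * (Gbd S x / mg) ^+ 2 * ln (xi S)^-1) <=
    q * (G ^+ 2 * u ^+ 2) * (xi_log_coef (Lg S) (Mh S) Gam * Lam).
  by rewrite ge_max h3.
apply: le_trans (lerD (lexx _) h4) _.
have h5 : 1 <= sg ^+ 5 * v ^+ 5 by rewrite -exprMn exprn_ege1 // sqrt_Lg_epsH_ge1.
have h6 : 1 <= sg ^+ 5 * v ^+ 5 * Lam by exact: mulr_ege1.
have h7 : 0 <= sg ^+ 5 * Lam * u ^+ 2.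
  by rewrite !mulr_ge0 ?exprn_ge0 ?(ltW sqrt_Lg_gt0) ?(ltW u0) // (le_trans ler01).
have h8 : 0 <= q * G ^+ 2 * (xi_log_coef (Lg S) (Mh S) Gam * Lam) * v ^+ 5.
  by rewrite mulr_ge0 ?exprn_ge0 ?(ltW v0) // mulr_ge0 // mulr_ge0 // sqr_ge0.
rewrite -/sg; move: (xi_log_coef _ _ _) (G ^+ 2) (u ^+ 2) (v ^+ 5) (sg ^+ 5) h6 h7 h8.
by move=> a b c e s h6 h7 h8; lra.
Qed.

Lemma size_H_le K x : 0 <= Kbd S x <= K ->
  (size_H S x)%:R <= size_H_coef (Lg S) (Mh S) Gam K * Lam * v ^+ 4.
Proof.
move=> /andP[k0 kK]; have v0 := inv_sqrt_epsH_gt0; have L1 := log_factor_ge1.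
have c0 := xi_log_coef_ge0 (ltW L_gt0) (ltW M_gt0) (gap_ge0 hbelow).
have [_ hx] := ln_xi_le.
apply: le_trans (batch_size_lt _) _; rewrite /size_H_coef.
have h1 : (Kbd S x / epsH S) ^+ 2 <= K ^+ 2 * v ^+ 4.
  rewrite (_ : v ^+ 4 = (v ^+ 2) ^+ 2); last by rewrite -exprM.
  rewrite inv_sqrt_epsH_sqr -exprMn lerXn2r ?nnegrE ?divr_ge0 ?(ltW eH_gt0) //.
    exact: le_trans kK.
  by rewrite ler_wpM2r // invr_ge0 ltW.
have p2 : 0 <= (Kbd S x / epsH S) ^+ 2 := sqr_ge0 _.
have pc : 0 <= xi_log_coef (Lg S) (Mh S) Gam * Lam by rewrite mulr_ge0 // (le_trans ler01).
have p4 : 0 <= v ^+ 4 by rewrite exprn_ge0 // ltW.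
move: (484 : R) (ler0n R 484) => q q0.
have h2 : q * (Kbd S x / epsH S) ^+ 2 * ln (2 * d%:R / xi S) <=
    q * (K ^+ 2 * v ^+ 4) * (xi_log_coef (Lg S) (Mh S) Gam * Lam).
  apply: (@le_trans _ _ (q * (Kbd S x / epsH S) ^+ 2 * (xi_log_coef (Lg S) (Mh S) Gam * Lam))).
    by rewrite ler_wpM2l // mulr_ge0.
  by rewrite ler_wpM2r // ler_wpM2l.
have h3 : 0 <= q * (K ^+ 2 * v ^+ 4) * (xi_log_coef (Lg S) (Mh S) Gam * Lam).
  by rewrite mulr_ge0 // mulr_ge0 // mulr_ge0 // sqr_ge0.
have h4 : Num.max 0 (q * (Kbd S x / epsH S) ^+ 2 * ln (2 * d%:R / xi S)) <=
    q * (K ^+ 2 * v ^+ 4) * (xi_log_coef (Lg S) (Mh S) Gam * Lam).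
  by rewrite ge_max h3.
apply: le_trans (lerD (lexx _) h4) _.
have h5 : 1 <= sg ^+ 4 * v ^+ 4 by rewrite -exprMn exprn_ege1 // sqrt_Lg_epsH_ge1.
have h6 : 1 <= sg ^+ 4 * v ^+ 4 * Lam by exact: mulr_ege1.
rewrite -/sg; move: (xi_log_coef _ _ _) (K ^+ 2) (v ^+ 4) (sg ^+ 4) h6.
by move=> a b c e h6; lra.
Qed.

Lemma lanczos_budget_le K (H : 'M[R]_d) : specnorm H <= K ->
  lanczos_budget dlL (epsH S) H <= lanczos_coef (Lg S) K * Lam * v.
Proof.
move=> hK; have v0 := inv_sqrt_epsH_gt0; have L1 := log_factor_ge1; have s0 := sqrt_Lg_gt0.
have sv := sqrt_Lg_epsH_ge1; have H0 := specnorm_ge0 H.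
have [E1 _ _ _ _] := tolerances_le_exp_log; have [_ lE dE] := params_le_exp_log.
have /andP[l0 l1] := hdlL.
have E0 : 0 <= E := le_trans ler01 E1.
rewrite /lanczos_budget ge_min; apply/orP; right.
have hl : ln (25 * d%:R / dlL ^+ 2) <= log_coef 25 3 * Lam.
  apply: ln_le_log_coef; first exact: ler0n.
  rewrite -mulrA ler_wpM2l ?ler0n // [E ^+ 3]exprS -exprVn; apply: ler_pM => //.
    by rewrite exprn_ge0 // invr_ge0 ltW.
  by rewrite lerXn2r ?nnegrE // invr_ge0 ltW.
have hs : Num.sqrt (specnorm H / Num.min (epsH S) (9 * specnorm H)) <= (Num.sqrt K + sg) * v.
  have K0 : 0 <= Num.sqrt K * v by rewrite mulr_ge0 ?sqrtr_ge0 // ltW.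
  case: (leP (epsH S) (9 * specnorm H)) => hm.
    rewrite mulrDl; apply: (@le_trans _ _ (Num.sqrt K * v)); last first.
      by rewrite lerDl mulr_ge0 // ltW.
    rewrite /v -sqrtrV ?(ltW eH_gt0) // -sqrtrM ?(le_trans H0) //.
    by rewrite ler_wsqrtr // ler_wpM2r // invr_ge0 ltW.
  (* For [epsH > 9 |H|] the quotient under the root is [1/9], or [0] when [H = 0] because of
     division by zero. *)
  apply: (@le_trans _ _ 1); last by rewrite mulrDl; apply: (le_trans sv); rewrite lerDr.
  rewrite -[leRHS](sqrtr1 R) ler_wsqrtr //.
  have [->|Hn0] := eqVneq (specnorm H) 0; first by rewrite mul0r.
  rewrite ler_pdivrMr ?mul1r; last by rewrite mulr_gt0 // lt_neqAle eq_sym Hn0.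
  by rewrite ler_peMl // ler1n.
have s1 : 0 <= Num.sqrt (specnorm H / Num.min (epsH S) (9 * specnorm H)) := sqrtr_ge0 _.
have lc0 : 0 <= log_coef (25 : R) 3 * Lam.
  by rewrite mulr_ge0 ?log_coef_ge0 ?ler0n // (le_trans ler01).
have hm := le_trans (ler_wpM2r s1 hl) (ler_wpM2l lc0 hs).
have h1 : 1 <= sg * v * Lam by exact: mulr_ege1.
rewrite /lanczos_coef -/sg; move: (log_coef _ _) hm => a.
move: (ln (25 * d%:R / dlL ^+ 2)) => b.
move: (Num.sqrt (_ / _)) (Num.sqrt K) => c k hm.
by rewrite -mulrA; lra.
Qed.

(** Of the six products, [u^4], [u^2 v^6], [v^11] and [u^-2 v^13] are the entries of [rate];
    [u^2 v^5] and [v^8] are raised to [u^2 v^6] and [v^11] by factors [sg * v >= 1]. *)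
Lemma rate_ge : Q * (u ^+ 2 + v ^+ 5) <= (5 + sg + sg ^+ 3) * rate (epsg S) (epsH S).
Proof.
have u0 := inv_epsg_gt0; have v0 := inv_sqrt_epsH_gt0; have s0 := sqrt_Lg_gt0; have sv := sqrt_Lg_epsH_ge1.
have eH0 := ltW eH_gt0.
have powE m : epsH S `^ (- (m%:R / 2)) = v ^+ m.
  rewrite powRN [m%:R / 2]mulrC powRrM powR12_sqrt // powR_mulrn ?sqrtr_ge0 //.
  by rewrite /v exprVn.
rewrite /rate (powE 11%N) (powE 13%N).
have -> : epsg S ^- 4 = u ^+ 4 by rewrite /u exprVn.
have -> : epsg S ^- 2 * epsH S ^- 3 = u ^+ 2 * v ^+ 6.
  rewrite (_ : v ^+ 6 = (v ^+ 2) ^+ 3); last by rewrite -exprM.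
  by rewrite inv_sqrt_epsH_sqr /u !exprVn.
have -> : epsg S ^+ 2 * v ^+ 13 = u ^- 2 * v ^+ 13 by rewrite /u exprVn invrK.
set r := Num.max _ _.
have r1 : u ^+ 4 <= r by rewrite le_max lexx.
have r2 : u ^+ 2 * v ^+ 6 <= r by rewrite !le_max lexx !orbT.
have r3 : v ^+ 11 <= r by rewrite !le_max lexx !orbT.
have r4 : u ^- 2 * v ^+ 13 <= r by rewrite !le_max lexx !orbT.
have -> : Q * (u ^+ 2 + v ^+ 5) = u ^+ 4 + u ^+ 2 * v ^+ 5 + u ^+ 2 * v ^+ 6 + v ^+ 11 + v ^+ 8
    + u ^- 2 * v ^+ 13.
  by rewrite /Q; field; rewrite gt_eqF.
have h1 : u ^+ 2 * v ^+ 5 <= sg * r.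
  apply: (@le_trans _ _ (sg * (u ^+ 2 * v ^+ 6))); last by rewrite ler_wpM2l // ltW.
  have -> : sg * (u ^+ 2 * v ^+ 6) = (sg * v) * (u ^+ 2 * v ^+ 5) by ring.
  by rewrite ler_peMl // mulr_ge0 ?exprn_ge0 // ltW.
have h2 : v ^+ 8 <= sg ^+ 3 * r.
  apply: (@le_trans _ _ (sg ^+ 3 * v ^+ 11)); last by rewrite ler_wpM2l // exprn_ge0 // ltW.
  have -> : sg ^+ 3 * v ^+ 11 = (sg * v) ^+ 3 * v ^+ 8 by ring.
  by rewrite ler_peMl ?exprn_ege1 // exprn_ge0 // ltW.
have r0 : 0 <= r by apply: le_trans r1; rewrite exprn_ge0 // ltW.
by move: (u ^+ 4) (_ * v ^+ 5) (_ * v ^+ 6) (v ^+ 11) (v ^+ 8) (_ * v ^+ 13) (sg ^+ 3) r1 r2 r3 r4 h1 h2 => *; lra.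
Qed.

Lemma n_iter_rate_le (A : R) : 0 <= A ->
  2 * n_iter S * (A * Lam ^+ 2 * (u ^+ 2 + v ^+ 5)) <=
  2 * n_iter_coef (Lg S) (Mh S) Gam * A * (5 + sg + sg ^+ 3) * Lam ^+ 3 *
    rate (epsg S) (epsH S).
Proof.
move=> A0; have L1 := log_factor_ge1; have L0 := le_trans ler01 L1.
have n0 := n_iter_coef_ge0 (ltW L_gt0) (ltW M_gt0) (gap_ge0 hbelow).
have uv0 : 0 <= u ^+ 2 + v ^+ 5.
  by rewrite addr_ge0 // exprn_ge0 // ltW ?inv_epsg_gt0 ?inv_sqrt_epsH_gt0.
have h1 := ler_wpM2r uv0 n_iter_le.
have h2 := ler_wpM2l n0 rate_ge.
have AL : 0 <= A * Lam ^+ 2 by rewrite mulr_ge0 // exprn_ge0.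
have h3 := ler_wpM2l AL h1.
have AL3 : 0 <= A * Lam ^+ 3 by rewrite mulr_ge0 // exprn_ge0.
have h4 := ler_wpM2l AL3 h2.
move: (n_iter_coef _ _ _) (n_iter S) h3 h4 => a n.
move: (rate _ _) => r.
move=> h3 h4.
rewrite (_ : 2 * n * _ = 2 * (A * Lam ^+ 2 * (n * (u ^+ 2 + v ^+ 5)))); last by ring.
rewrite (_ : 2 * a * A * _ * _ * r = 2 * (A * Lam ^+ 3 * (a * ((5 + sg + sg ^+ 3) * r)))); last by ring.
rewrite ler_wpM2l //; apply: le_trans h3 _; apply: le_trans _ h4.
by apply: eq_ler; ring.
Qed.

End RateBound.

Section TotalCost.
Context {R : realType} {N d : nat} {Omega : Type}.
Variables (S : problem R N d) (O : inputs R N d Omega) (dlL : R).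
Hypotheses (N_gt0 : (0 < N)%N) (d_gt0 : (0 < d)%N).
Hypotheses (L_gt0 : 0 < Lg S) (M_gt0 : 0 < Mh S).
Hypotheses (eg_gt0 : 0 < epsg S) (eH_gt0 : 0 < epsH S) (eH_le : epsH S <= Lg S).
Hypothesis hdelta : 0 < delta S <= 1 / 2.
Hypothesis hbelow : forall x, fbar S <= objective S x.
Hypothesis hn : 1 <= n_iter S.
Hypothesis hdlL : 0 < dlL < 1.
Hypothesis hG : forall i x, enorm (grad (fcomp S i) x) <= Gbd S x.
Hypothesis hK : forall i x, specnorm (hess (fcomp S i) x) <= Kbd S x.
Hypothesis heig : eigenvector_oracle S O dlL.

Lemma specnorm_hess_oracle_le k w x : specnorm (hess_oracle S O k w x) <= Kbd S x.
Proof.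
have m0 : (0 < size_H S x)%N by exact: batch_size_gt0.
rewrite /hess_oracle; apply: le_trans (specnormZ_le _ _) _; first by rewrite invr_ge0.
rewrite ler_pdivrMl ?ltr0n //; apply: le_trans (specnorm_sum_le _) _.
have -> : (size_H S x)%:R * Kbd S x = \sum_(j < size_H S x) Kbd S x.
  by rewrite sumr_const card_ord mulr_natl.
by apply: ler_sum => j _; exact: hK.
Qed.

(** The cubed log factor has one power from the number of iterations, one from the Hessian batch and
    one from the eigenvector computation. *)
Lemma sample_ops_le k w (Gmax Kmax : R) : returns_at S O k w -> k.+1%:R <= 2 * n_iter S ->
  (forall i, (i <= k)%N -> Gbd S (xk S O i w) <= Gmax /\ Kbd S (xk S O i w) <= Kmax) ->
  (sample_ops S O k w)%:R <= ops_coef (Lg S) (Mh S) (gap S) Gmax Kmax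
     * log_factor (epsg S) (epsH S) (delta S) dlL d ^+ 3 * rate (epsg S) (epsH S).
Proof.
move=> [rk _] kn hmax.
have G0 x : 0 <= Gbd S x := le_trans (enorm_ge0 _) (hG (Ordinal N_gt0) x).
have K0 x : 0 <= Kbd S x := le_trans (specnorm_ge0 _) (hK (Ordinal N_gt0) x).
have c0 := xi_log_coef_ge0 (ltW L_gt0) (ltW M_gt0) (gap_ge0 hbelow).
have L1 : 1 <= log_factor (epsg S) (epsH S) (delta S) dlL d by exact: log_factor_ge1.
set Lam := log_factor _ _ _ _ _ in L1 *.
have L0 := le_trans ler01 L1.
set u := (epsg S)^-1; set v := (Num.sqrt (epsH S))^-1.
have u0 : 0 < u by exact: inv_epsg_gt0.
have v0 : 0 < v by exact: inv_sqrt_epsH_gt0.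
have cg0 := size_g_coef_ge0 Gmax (ltW L_gt0) (ltW M_gt0) (gap_ge0 hbelow).
have cH0 := size_H_coef_ge0 Kmax (ltW L_gt0) (ltW M_gt0) (gap_ge0 hbelow).
have cl0 := lanczos_coef_ge0 (Lg S) Kmax.
have LL : Lam <= Lam ^+ 2 by rewrite expr2 ler_peMl.
pose A := size_g_coef (Lg S) (Mh S) (gap S) Gmax
  + lanczos_coef (Lg S) Kmax * size_H_coef (Lg S) (Mh S) (gap S) Kmax.
have A0 : 0 <= A by rewrite addr_ge0 // mulr_ge0.
have uv0 : 0 <= u ^+ 2 + v ^+ 5 by rewrite addr_ge0 // exprn_ge0 // ltW.
have cost i : (i <= k)%N -> (size_g S (xk S O i w)
    + (if (enorm (gk S O i w) <= epsg S)%R then nmv O i w * size_H S (xk S O i w)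
       else 0))%:R <= A * Lam ^+ 2 * (u ^+ 2 + v ^+ 5).
  move=> ik; have [hGi hKi] := hmax i ik.
  have hg : (size_g S (xk S O i w))%:R <=
      size_g_coef (Lg S) (Mh S) (gap S) Gmax * Lam * (u ^+ 2 + v ^+ 5).
    by apply: size_g_le => //; rewrite G0.
  have {}hg : (size_g S (xk S O i w))%:R <=
      size_g_coef (Lg S) (Mh S) (gap S) Gmax * Lam ^+ 2 * (u ^+ 2 + v ^+ 5).
    by apply: le_trans hg _; rewrite ler_wpM2r // ler_wpM2l.
  have AE : A * Lam ^+ 2 * (u ^+ 2 + v ^+ 5) =
    size_g_coef (Lg S) (Mh S) (gap S) Gmax * Lam ^+ 2 * (u ^+ 2 + v ^+ 5) +
    lanczos_coef (Lg S) Kmax * size_H_coef (Lg S) (Mh S) (gap S) Kmax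
      * Lam ^+ 2 * (u ^+ 2 + v ^+ 5) by rewrite -!mulrDl.
  have B0 : 0 <= lanczos_coef (Lg S) Kmax * size_H_coef (Lg S) (Mh S) (gap S) Kmax * Lam ^+ 2.
    by rewrite mulr_ge0 ?exprn_ge0 // mulr_ge0.
  rewrite AE natrD; apply: lerD => //.
  case: ifP => hgi; last by rewrite mulr_ge0.
  have ri : reached S O i w by move=> j ji; apply: rk; exact: leq_trans ji ik.
  have [_ _ hmv] := heig ri hgi.
  have hl : lanczos_budget dlL (epsH S) (Hk S O i w) <= lanczos_coef (Lg S) Kmax * Lam * v.
    by apply: lanczos_budget_le => //; apply: le_trans hKi; exact: specnorm_hess_oracle_le.
  have hH : (size_H S (xk S O i w))%:R <= size_H_coef (Lg S) (Mh S) (gap S) Kmax * Lam * v ^+ 4.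
    by apply: size_H_le => //; rewrite K0.
  rewrite natrM; apply: le_trans (ler_pM _ _ (le_trans hmv hl) hH) _ => //.
  have -> : lanczos_coef (Lg S) Kmax * Lam * v *
      (size_H_coef (Lg S) (Mh S) (gap S) Kmax * Lam * v ^+ 4) =
    lanczos_coef (Lg S) Kmax * size_H_coef (Lg S) (Mh S) (gap S) Kmax * Lam ^+ 2 * v ^+ 5.
    by move: (lanczos_coef _ _) (size_H_coef _ _ _ _) => a b; ring.
  by rewrite ler_wpM2l // lerDr exprn_ge0 // ltW.
apply: (@le_trans _ _ (k.+1%:R * (A * Lam ^+ 2 * (u ^+ 2 + v ^+ 5)))).
  rewrite /sample_ops natr_sum mulr_natl -[X in _ *+ X](card_ord k.+1) -sumr_const.
  by apply: ler_sum => i _; apply: cost; rewrite -ltnS.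
apply: (@le_trans _ _ (2 * n_iter S * (A * Lam ^+ 2 * (u ^+ 2 + v ^+ 5)))).
  by rewrite ler_wpM2r // mulr_ge0 // mulr_ge0 // exprn_ge0.
have := n_iter_rate_le d_gt0 L_gt0 M_gt0 eg_gt0 eH_gt0 eH_le hdelta hbelow hdlL A0.
exact.
Qed.

End TotalCost.

(** * Probability of a good run *)

(** A union bound at a deterministic horizon: at most [2 n_iter] oracles fail with probability
    [xi / 2] each, which sums to [delta], and the sign event takes the second [delta]. *)
Lemma prob_good_run (R : realType) (N d : nat) (dO : measure_display)
    (Omega : measurableType dO) (P : probability Omega R) (S : problem R N d)
    (O : inputs R N d Omega) (T : nat) :
  (0 < N)%N -> (0 < d)%N -> 0 < epsg S -> 0 < epsH S -> 0 < delta S <= 1 / 2 ->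
  1 <= n_iter S -> T%:R <= 2 * n_iter S ->
  (forall i, twice_differentiable (fcomp S i)) ->
  (forall i x, enorm (grad (fcomp S i) x) <= Gbd S x) ->
  (forall i x, specnorm (hess (fcomp S i) x) <= Kbd S x) ->
  borel_fun (Gbd S) -> borel_fun (Kbd S) -> measurable_inputs O ->
  uniform_sampling P S O -> fair_signs P S O ->
  prob_ge P [set w | (forall i, (i < T)%N -> accurate S O w i) /\
                     nc_exp S O (sign_rate S) T w < (delta S) ^- 2]
    (1 - 2 * delta S).
Proof.
move=> N0 d0 eg0 eH0 /andP[dl0 dl1] hn hT hf hG hK hGm hKm hmeas hsamp hsgn.
have n0 : 0 < n_iter S by apply: lt_le_trans hn.
have xi01 : 0 < xi S <= 1 / 2.
  rewrite /xi divr_gt0 //= ler_pdivrMr //; apply: le_trans dl1 _.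
  by rewrite ler_peMr // divr_ge0.
have /choice[E hE] : forall k, exists E : set Omega, [/\ measurable E,
    (P E <= (xi S / 2)%:E)%E & forall w, ~ E w -> accurate S O w k].
  by move=> k; exact: prob_bad_oracle.
have mE k : measurable (E k) by have [] := hE k.
pose U := \big[setU/set0]_(i < T) E i.
pose V := [set w | (delta S) ^- 2 <= nc_exp S O (sign_rate S) T w].
have mU : measurable U by exact: bigsetU_measurable.
have mV : measurable V.
  have := measurable_nc_exp eg0 hf hGm hKm hmeas (sign_rate S) T measurableT
    (measurable_itv `[(delta S) ^- 2, +oo[).
  rewrite setTI; congr (measurable _); apply/seteqP.
  by split=> w; rewrite /V /= in_itv /= andbT.
have PU : (P U <= (delta S)%:E)%E.
  apply: (@le_trans _ _ (\sum_(i < T) (xi S / 2)%:E)%E).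
    apply: (@le_trans _ _ (\sum_(i < T) P (E i))%E); first exact: measure_bigsetU_le.
    by apply: lee_sum => i _; have [] := hE i.
  rewrite sumEFin lee_fin sumr_const card_ord -[_ *+ T]mulr_natl.
  have -> : delta S = 2 * n_iter S * (xi S / 2) by rewrite /xi; field; rewrite gt_eqF.
  by rewrite ler_wpM2r // divr_ge0 // ltW; case/andP: xi01.
have PV : (P V <= (delta S)%:E)%E.
  have d20 : 0 < (delta S) ^- 2 by rewrite invr_gt0 exprn_gt0.
  apply: le_trans (prob_nc_exp eg0 hf hGm hKm hmeas hsgn (sign_rate S) T d20) _.
  rewrite invrK lee_fin expr2 ler_piMl ?(ltW dl0) //; lra.
exists (~` (U `|` V)); split.
- by apply: measurableC; exact: measurableU.
- move=> w /= /not_orP[nU nV]; split; last by rewrite ltNge; apply/negP.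
  move=> i iT; have [_ _] := hE i; apply => Ei; apply: nU.
  by rewrite /U -bigcup_mkord; exists i.
rewrite probability_setC; last exact: measurableU.
have : (P (U `|` V) <= (2 * delta S)%:E)%E.
  apply: le_trans (measureU2 P mU mV) _.
  by rewrite mulr_natl mulr2n EFinD; exact: leeD.
by move=> h; rewrite EFinB; exact: leeB.
Qed.

(* The soft-O: the power p of the logarithmic factor is universal, and the
   constant C depends only on L, M, f(x0) - fbar and on bounds Gmax, Kmax for
   G, K along the iterates. [dlL] is the failure probability used in the
   iteration bound of the eigenvector computation. [hn]: n counts iterations;
   for n < delta, xi = delta / n would exceed 1 and the sample-size bounds
   would be void. *)
Theorem theorem4p7 (R : realType) :
  exists (p : nat) (C : R -> R -> R -> R -> R -> R),
  forall (N d : nat) (hN : (0 < N)%N) (hd : (0 < d)%N) (S : problem R N d)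
    (hL : 0 < Lg S) (hM : 0 < Mh S) (heg : 0 < epsg S) (heH : 0 < epsH S)
    (heHL : epsH S <= Lg S)
    (hdelta : 0 < delta S <= 1 / 2)
    (hn : 1 <= n_iter S)
    (hf : forall i, twice_differentiable (fcomp S i))
    (hHess : hessian_lipschitz (Mh S) (objective S))
    (hbelow : forall x, fbar S <= objective S x)
    (hG : forall i x, enorm (grad (fcomp S i) x) <= Gbd S x)
    (hK : forall i x, specnorm (hess (fcomp S i) x) <= Kbd S x)
    (hGm : borel_fun (Gbd S)) (hKm : borel_fun (Kbd S))
    (dO : measure_display) (Omega : measurableType dO)
    (P : probability Omega R) (O : inputs R N d Omega)
    (D : set 'rV[R]_d)
    (hD : points_of_interest S O D)
    (hgrad : gradient_lipschitz_on D (Lg S) (objective S))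
    (dlL : R) (hdlL : 0 < dlL < 1)
    (hmeas : measurable_inputs O)
    (heig : eigenvector_oracle S O dlL)
    (hsamp : uniform_sampling P S O)
    (hsgn : fair_signs P S O)
    (Gmax Kmax : R),
  prob_ge P
    [set w | exists k : nat,
      [/\ returns_at S O k w,
          approx_sosp (objective S) (4 / 3 * epsg S) (4 / 3 * epsH S)
                      (xk S O k w)
        & (forall i : nat, (i <= k)%N ->
             Gbd S (xk S O i w) <= Gmax /\ Kbd S (xk S O i w) <= Kmax) ->
          (sample_ops S O k w)%:R
            <= C (Lg S) (Mh S) (gap S) Gmax Kmax
               * log_factor (epsg S) (epsH S) (delta S) dlL d ^+ p
               * rate (epsg S) (epsH S)]]
    (1 - 2 * delta S).
Proof.
exists 3%N, (@ops_coef R) => N d N0 d0 S L0 M0 eg0 eH0 eHL hdelta hn hf hHess hbelow hG hK hGm hKm.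
move=> dO Omega P O D hD hgrad dlL hdlL hmeas heig hsamp hsgn Gmax Kmax.
have n0 : 0 <= n_iter S := le_trans ler01 hn.
(* The horizon is the first integer beyond [n_iter]; it is at most [n_iter + 1], hence at most
   [2 n_iter] as [1 <= n_iter]. *)
have /andP[nT Tn] := truncn_itv n0.
have T1 : (Num.truncn (n_iter S)).+1%:R <= 2 * n_iter S.
  by rewrite -[leLHS]natr1; lra.
move: (Num.truncn _).+1 Tn T1 => T Tn T1.
have [E [mE hE PE]] := prob_good_run N0 d0 eg0 eH0 hdelta hn T1 hf hG hK hGm hKm hmeas hsamp hsgn.
exists E; split=> // w /hE /= [acc hexp].
have nreached : ~ reached S O T w.
  move=> rT; have := iteration_bound L0 M0 eg0 eH0 hdelta hf hHess hbelow hD hgrad heig rT acc hexp.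
  by rewrite leNgt Tn.
have /existsNP[i0 /not_implyP[i0T /contrapT st0]] := nreached.
have ex : exists i, `[< stops S O i w >] by exists i0; exact/asboolP.
(* The run returns at the first index where the stopping test holds; it lies before [T], where the
   oracles are accurate. *)
case: (ex_minnP ex) => k /asboolP st kmin.
have kT : (k < T)%N by apply: leq_ltn_trans i0T; apply: kmin; exact/asboolP.
have ret : returns_at S O k w.
  by split=> // i ik /asboolP si; have := kmin i si; rewrite leqNgt ik.
have sosp := approx_sosp_returned d0 eg0 hf heig ret (acc k kT).
exists k; split; [exact: ret|exact: sosp|move=> hmax].
apply: sample_ops_le => //; apply: le_trans T1.
by rewrite ler_nat.
Qed.
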